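(* Let $m\ge2$, let $\zeta_{2^m}=e^{2\pi i/2^m}$ and let $k$ be the maximal totally real subfield of $\mathbb Q(\zeta_{2^m})$. Let $q\ge5$ be a prime with $q\equiv1\pmod 4$ and let $a,b$ be positive integers with $q=a^2+b^2$. Let $D_1$ and $D_2$ be the splitting fields inside $\mathbb C$ of $X^{2^m}-(a+ib)$ and $X^{2^m}-(a-ib)$ over $\mathbb Q(\zeta_{2^m})$, respectively. Then $L=D_1D_2$ contains $k$ and is Galois over $\mathbb Q$. Let $G^+=\mathrm{Gal}(L/k)$, let $H$ be a non-trivial proper subgroup of $\mathrm{Gal}(D_1D_2/D_2)$, and let $G=H\cdot\mathrm{Gal}(D_1D_2/D_1)$. Then there exist $\sigma_1,\sigma_2\in G$ such that $L/L^G$ has an extreme Chebyshev bias relative to $(\{\sigma_1\},\{\sigma_2\})$. Moreover there exists an integer $n\in\{1,\dots,m-1\}$ such that $G\simeq\mathbb Z/2^n\mathbb Z\times\mathbb Z/2^m\mathbb Z$ and $G^+\simeq(\mathbb Z/2^m\mathbb Z\times\mathbb Z/2^m\mathbb Z)\rtimes\mathbb Z/2\mathbb Z$.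
   Context: For a Galois extension of number fields $L/K$ with group $G$ and $D\subset G$ conjugation-invariant, $\pi(x;L/K;D)=\sum_{\mathfrak p,\ N\mathfrak p\le x}\mathds 1_D(\varphi_{\mathfrak p})$ over nonzero primes $\mathfrak p$ of $O_K$, where for ramified $\mathfrak p$ the value is the average of $\mathds 1_D(\varphi_{\mathfrak p}s)$ over $s$ in the inertia group. $L/K$ has an extreme Chebyshev bias relative to conjugacy classes $(C_1,C_2)$ if, up to exchanging them, $\frac{|G|}{|C_1|}\pi(x;L/K;C_1)-\frac{|G|}{|C_2|}\pi(x;L/K;C_2)>0$ for all sufficiently large $x$. *)

(* Defs.v *)
From HB Require Import structures.
From mathcomp Require Import all_boot all_order all_algebra.
From mathcomp Require Import all_fingroup all_solvable all_field.
From mathcomp Require Import all_classical all_reals all_analysis.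
From mathcomp Require Import finmap complex.

Set Implicit Arguments.
Unset Strict Implicit.
Unset Printing Implicit Defensive.

Import Order.TTheory GRing.Theory Num.Theory.
Import numFieldNormedType.Exports.

Local Open Scope classical_set_scope.
Local Open Scope ring_scope.

Section NumberFields.

(* Number fields are subfields of an arbitrary number field E which is Galois
   over the rationals. *)
Variable E : splittingFieldType rat.
Implicit Types K L : {subfield E}.

Definition integers K : set E :=
  [set x | x \in K /\ integralOver (intr : int -> E) x].

Definition is_nonzero_prime K (p : set E) : Prop :=
  [/\ p `<=` integers K,
      p 0 /\ (exists2 x, p x & x != 0),
      forall a u v, integers K a -> p u -> p v -> p (a * u + v),
      ~ p 1
    & forall u v, integers K u -> integers K v -> p (u * v) -> p u \/ p v].

Definition ideal_coset K (p : set E) (x : E) : set E :=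
  [set y | integers K y /\ p (y - x)].

Definition ideal_norm K (p : set E) : nat :=
  #|` fset_set (ideal_coset K p @` integers K)|.

Definition is_prime_above K L (p P : set E) : Prop :=
  is_nonzero_prime L P /\ P `&` integers K = p.

Definition prime_above K L (p : set E) : set E :=
  xget set0 [set P | is_prime_above K L p P].

Definition inertia K L (P : set E) : {set gal_of L} :=
  finset (fun s : gal_of L => (s \in 'Gal(L / K)%g) &&
    `[< forall x, integers L x -> P (s x - x) >]).

Definition is_frobenius K L (p P : set E) (s : gal_of L) : Prop :=
  s \in 'Gal(L / K)%g /\
  forall x, integers L x -> P (s x - x ^+ ideal_norm K p).

Definition frobenius K L (p P : set E) : gal_of L :=
  xget 1%g [set s | is_frobenius K p P s].

(* The value at the Frobenius of p of the indicator function of D, averaged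
   over inertia; for unramified p the inertia group is trivial and this is the
   plain value.  When D is invariant under conjugation, the result depends
   neither on the chosen prime above p nor on the chosen Frobenius lift.  The
   product of gal_of L composes from left to right, which is harmless here:
   inertia is normalised by the Frobenius. *)
Definition frobenius_mean (R : realType) K L (D : {set gal_of L})
    (p : set E) : R :=
  let P := prime_above K L p in
  (\sum_(s in inertia K L P) ((frobenius K L p P * s)%g \in D)%:R)
    / #|inertia K L P|%:R.

(* The index set is finite, so this is a genuine finite sum. *)
Definition prime_count (R : realType) K L (D : {set gal_of L}) (x : R) : R :=
  \sum_(p \in [set p | is_nonzero_prime K p /\ (ideal_norm K p)%:R <= x])
    frobenius_mean R K D p.

Definition chebyshev_diff (R : realType) K L (C1 C2 : {set gal_of L})
    (x : R) : R :=
  #|'Gal(L / K)%g|%:R / #|C1|%:R * prime_count K C1 x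
  - #|'Gal(L / K)%g|%:R / #|C2|%:R * prime_count K C2 x.

Definition extreme_chebyshev_bias (R : realType) K L
    (C1 C2 : {set gal_of L}) : Prop :=
  [/\ galois K L,
      C1 \in classes 'Gal(L / K)%g,
      C2 \in classes 'Gal(L / K)%g
    & (\forall x \near +oo, 0 < chebyshev_diff K C1 C2 (x : R)) \/
      (\forall x \near +oo, 0 < chebyshev_diff K C2 C1 (x : R))].

Definition totally_real (R : realType) K : Prop :=
  forall (f : {rmorphism subvs_of K -> R[i]}) (x : subvs_of K),
    f x \is Num.real.

Definition is_maximal_totally_real (R : realType) (F : {vspace E}) K : Prop :=
  [/\ (K <= F)%VS, totally_real R K
    & forall M : {subfield E},
        (K <= M)%VS -> (M <= F)%VS -> totally_real R M -> M = K].

End NumberFields.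

Arguments extreme_chebyshev_bias {E} R K {L} C1 C2.
Arguments is_maximal_totally_real {E} R F K.

(* exp (2 pi i / n) *)
Definition zeta (R : realType) (n : nat) : R[i] :=
  Complex (cos (2 * pi / n%:R)) (sin (2 * pi / n%:R)).

(* Main.v *)
Require Import Defs.
From HB Require Import structures.
From mathcomp Require Import all_boot all_order all_algebra.
From mathcomp Require Import all_fingroup all_solvable all_field.
From mathcomp Require Import all_classical all_reals all_analysis.
From mathcomp Require Import finmap complex.
From mathcomp Require Import zify ring.

Set Implicit Arguments.
Unset Strict Implicit.
Unset Printing Implicit Defensive.

Import Order.TTheory GRing.Theory Num.Theory.
Local Open Scope ring_scope.

(* Write N = Gal(L/Q(zeta)) and let c be complex conjugation.  Choosing alpha with
   alpha^(2^m) = a + ib and beta = c alpha, an element s of N is determined by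
   exponents (i, j) with s alpha = zeta^i alpha and s beta = zeta^j beta, and
   conjugation by c sends (i, j) to (-j, -i).

   In these coordinates G consists of the s with 2^(m-n) | i.  If the Frobenius
   at P of L/L^G has 2^(m-n+1) | i, then the prime of L^G below P has the same norm
   as the prime of Q(zeta) below it.  Hence if sigma_2 has this property, conjugation
   by c injects the primes of L^G with Frobenius sigma_2 into those with Frobenius
   sigma_1 = c sigma_2 c, preserving norms; its image consists of primes having
   residue degree 1 over Q(zeta).  The class sigma_1 can be chosen to contain
   moreover infinitely many primes of larger residue degree, which outweigh the
   finitely many ramified primes.

   These extra primes, and the fact that N is all of (Z/2^m)^2, come from primes
   l = 1 mod 2^m modulo which q is not a square: since alpha^(2^m) beta^(2^m) = q, a
   Frobenius above l has i + j odd.  Infinitely many such l are obtained without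
   Dirichlet's theorem or L-functions: they divide to odd multiplicity the
   determinant of a suitable polynomial in the companion matrix of
   X^(2^r) + 1, and quadratic reciprocity is applied to that determinant. *)

(** * Primes modulo which q is not a square *)

(** The bias is claimed at every large x, so the two counts are compared by an injection at each x
    rather than by densities. For a Frobenius (i, j) over Q(zeta), away from 2q, the residue degree
    of L^G over Q(zeta) is the least f with 2^(m-n) | f i. If f > 1, then f i has 2-adic valuation
    exactly m-n; one further factor 2 therefore excludes f > 1, and this is the origin of the
    exponent m-n+1. If i is odd and j even, then f = 2^(m-n) and 2^(m-n+1) | f j: the f-th power is
    a class sigma_1 that has primes with f > 1, while its conjugate by c has none. This is why a
    Frobenius with i + j odd is wanted. Properness of H gives n < m, hence f > 1 here; nontriviality
    gives n >= 1, so that divisibility by 2^(m-n+1) makes sense modulo 2^m. *)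

Lemma order_of_iter_id (T : finType) (f : T -> T) (x : T) (n : nat) :
  injective f -> iter n f x = x -> (fingraph.order f x %| n)%N.
Proof.
move=> injf fnx; rewrite /dvdn; have o0 := fingraph.order_gt0 f x.
have h : iter (n %% fingraph.order f x) f x = x.
  have hk k : iter (k * fingraph.order f x) f x = x.
    by elim: k => // k IH; rewrite mulSn iterD IH iter_order.
  by rewrite -[RHS]fnx {2}(divn_eq n (fingraph.order f x)) addnC iterD hk.
have := findex_iter (ltn_pmod n o0); rewrite h.
have -> : findex f x x = 0%N by rewrite -{2}[x]/(iter 0 f x) findex_iter.
by move=> <-.
Qed.

(** The order of each x in A divides 2^(r+1) but not 2^r, so all orbits in A have exactly 2^(r+1)
    elements. *)
Lemma dvdn_card_free (T : finType) (f : T -> T) (A : {set T}) (r : nat) :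
  injective f -> (forall x, x \in A -> f x \in A) ->
  (forall x, x \in A -> iter (2 ^ r.+1) f x = x) ->
  (forall x, x \in A -> iter (2 ^ r) f x != x) ->
  (2 ^ r.+1 %| #|A|)%N.
Proof.
move=> injf Af f1 f2.
have oA : A \subset order_set f (2 ^ r.+1)%N.
  apply/fintype.subsetP => x xA; rewrite inE.
  have /(dvdn_pfactor _ _ (isT : prime 2)) [k kr ok] :=
    order_of_iter_id injf (f1 x xA).
  rewrite ok eqn_exp2l // eqn_leq kr /= ltnNge; apply/negP => kr'.
  have /negP[] := f2 x xA.
  have -> : (2 ^ r = 2 ^ (r - k) * fingraph.order f x)%N by rewrite ok -expnD subnK.
  apply/eqP; elim: (2 ^ (r - k))%N => // j IH.
  by rewrite mulSn iterD IH iter_order.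
have clA : fclosed f A.
  apply: (intro_closed (fconnect_sym injf)) => x y /eqP <- xA; exact: Af.
by rewrite -(fcard_order_set injf oA clA) dvdn_mull.
Qed.

(** Writing |d| = u l^a with u coprime to l, the annihilator consists of the l^a multiples of
    l^(k-a). *)
Lemma card_Zp_annihilator (l k : nat) (d : int) :
  prime l -> (0 < k)%N -> d != 0 -> (logn l `|d| <= k)%N ->
  #|[set x : 'Z_(l ^ k) | x * d%:~R == 0]| = (l ^ logn l `|d|)%N.
Proof.
move=> pl k0 d0 lk.
have l0 : (0 < l)%N by exact: prime_gt0.
have K1 : (1 < l ^ k)%N by rewrite -(exp1n k) ltn_exp2r // prime_gt1.
set a := logn l `|d|.
have dn0 : (0 < `|d|)%N by rewrite absz_gt0.
have [u cu du] : exists2 u, coprime l u & `|d|%N = (u * l ^ a)%N.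
  have [u cu du] := pfactor_coprime pl dn0.
  by exists u.
have xd x : (x * d%:~R == 0 :> 'Z_(l ^ k)) = (l ^ (k - a) %| x)%N.
  have -> : (x * d%:~R == 0 :> 'Z_(l ^ k)) = (x * `|d|%:R == 0).
    case: (intP d) => [|n|n]; rewrite ?abszN //=.
    by rewrite mulrNz mulrN oppr_eq0.
  rewrite -[x in LHS](natr_Zp x) -natrM -(inj_eq val_inj) /= Zp_nat /=.
  rewrite [X in (_ %% X)%N]Zp_cast // -/(dvdn _ _) du.
  rewrite -{1}(subnK lk) expnD -/a mulnA dvdn_pmul2r ?expn_gt0 ?l0 //.
  by rewrite Gauss_dvdl // coprimeXl.
pose f (i : 'I_(l ^ a)) : 'Z_(l ^ k) := (i * l ^ (k - a))%:R.
have fv i : f i = (i * l ^ (k - a))%N :> nat.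
  rewrite /f Zp_nat /= Zp_cast // modn_small //.
  by rewrite -{2}(subnKC lk) expnD ltn_pmul2r ?expn_gt0 ?l0.
have injf : injective f.
  move=> i j fij; have := fv i; rewrite fij => fvi; move/eqP: (etrans (esym fvi) (fv j)).
  by rewrite eqn_pmul2r ?expn_gt0 ?l0 // => /eqP ji; apply: val_inj.
rewrite -[RHS]card_ord -(card_imset predT injf); apply: eq_card => x.
rewrite inE xd; apply/idP/imsetP => [/dvdnP [i xi]|[i _ ->]]; last first.
  by rewrite fv dvdn_mull.
have il : (i < l ^ a)%N.
  have := ltn_ord x; rewrite [X in (_ < X)%N]Zp_cast // xi -{2}(subnKC lk) expnD.
  by rewrite ltn_pmul2r ?expn_gt0 ?l0.
exists (Ordinal il) => //; by apply: ord_inj; rewrite fv.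
Qed.

Lemma logn_prod_seq (I : Type) (r : seq I) (F : I -> nat) (l : nat) :
  (forall i, (0 < F i)%N) ->
  logn l (\prod_(i <- r) F i) = (\sum_(i <- r) logn l (F i))%N.
Proof.
move=> F0; elim: r => [|i r IH]; first by rewrite !big_nil logn1.
rewrite !big_cons lognM ?IH //; elim: r {IH} => [|j r IH]; first by rewrite big_nil.
by rewrite big_cons muln_gt0 F0.
Qed.

Lemma card_kernel_unitmx (R : finComUnitRingType) (n : nat) (P D Q : 'M[R]_n) :
  P \in unitmx -> Q \in unitmx ->
  #|[set v : 'rV_n | v *m (P *m D *m Q) == 0]| = #|[set v : 'rV_n | v *m D == 0]|.
Proof.
move=> uP uQ; rewrite -(card_imset _ (can_inj (mulmxK uP))); apply: eq_card => v.
apply/imsetP/idP => [[u uA ->]|vS].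
  move: uA; rewrite !inE !mulmxA => /eqP uA.
  by rewrite -(mulmxK uQ (_ *m D)) uA mul0mx.
exists (v *m invmx P); rewrite ?mulmxKV // inE !mulmxA mulmxKV //.
by move: vS; rewrite inE => /eqP ->; rewrite mul0mx.
Qed.

(** Smith normal form makes A diagonal up to invertible factors, so the kernel is a product of
    annihilators with l^(v_i) elements, v_i being the multiplicity of l in the i-th entry. As k is
    the multiplicity of l in the whole determinant, each v_i is at most k and they add up to k. *)
Lemma card_kernel_mod (M l : nat) (A : 'M[int]_M) (k := logn l `|\det A|) :
  prime l -> (0 < k)%N ->
  #|[set v : 'rV['Z_(l ^ k)]_M | v *m map_mx intr A == 0]| = (l ^ k)%N.
Proof.
move=> pl k0.
have dA0 : \det A != 0 by apply/eqP => A0; move: k0; rewrite /k A0 logn0.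
have [P uP [Q uQ [d _ AE]]] := int_Smith_normal_form A.
set D : 'M[int]_M := \matrix_(i, j) _ in AE.
have Ddiag : D = diag_mx (\row_j d`_j).
  by apply/matrixP => i j; rewrite !mxE.
have detA : `|\det A|%N = (\prod_(i < M) `|(d`_i)%R|)%N.
  rewrite AE !det_mulmx !abszM Ddiag det_diag.
  have unit1 (B : 'M[int]_M) : B \in unitmx -> `|\det B|%N = 1%N.
    rewrite unitmxE => /unitrP[x [_ /(congr1 absz)]]; rewrite abszM => /eqP.
    by rewrite muln_eq1 => /andP[/eqP].
  rewrite !unit1 // mul1n muln1.
  by elim/big_ind2: _ => // [x1 x2 y1 y2 <- <-|i _]; rewrite ?abszM // mxE.
have d0 (i : 'I_M) : (0 < `|(d`_i)%R|)%N.
  rewrite lt0n; apply/eqP => di; move: k0; rewrite /k detA (bigD1 i) //= di.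
  by rewrite mul0n logn0.
have unit_map (B : 'M[int]_M) : B \in unitmx ->
    map_mx (intr : int -> 'Z_(l ^ k)) B \in unitmx.
  by move=> uB; rewrite unitmxE det_map_mx rmorph_unit // -unitmxE.
pose S := [set v : 'rV['Z_(l ^ k)]_M | v *m map_mx intr D == 0].
have -> : #|[set v : 'rV['Z_(l ^ k)]_M | v *m map_mx intr A == 0]| = #|S|.
  by rewrite AE !map_mxM card_kernel_unitmx // unit_map.
pose h (v : 'rV['Z_(l ^ k)]_M) := [ffun i => v 0 i].
have injh : injective h.
  move=> u v /ffunP uv; apply/rowP => i; have := uv i; by rewrite !ffunE.
pose T (i : 'I_M) : pred 'Z_(l ^ k) := fun x => x * (d`_i)%:~R == 0.
have -> : #|S| = #|family T|.
  rewrite -(card_imset _ injh); apply: eq_card => f.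
  have mD (v : 'rV['Z_(l ^ k)]_M) i : (v *m map_mx intr D) 0 i = v 0 i * (d`_i)%:~R :> 'Z_(l ^ k).
    rewrite mxE (bigD1 i) //= big1 ?addr0; first by rewrite !mxE eqxx mulr1n.
    by move=> j ji; rewrite !mxE (negPf ji : (j == i :> nat) = false) mulr0.
  apply/imsetP/familyP => [[v vS ->] i|fT].
    rewrite unfold_in /T ffunE -mD.
    move: vS; rewrite inE => /eqP ->; by rewrite mxE eqxx.
  exists (\row_i f i); last by apply/ffunP => i; rewrite ffunE mxE.
  rewrite inE; apply/eqP/rowP => i; rewrite mD mxE; have := fT i.
  by rewrite unfold_in /T => /eqP ->; rewrite mxE.
have kE : k = (\sum_(i < M) logn l `|(d`_i)%R|)%N by rewrite /k detA logn_prod_seq.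
rewrite card_family foldrE big_map big_enum /=.
have -> : (\prod_(i : 'I_M) #|T i| = \prod_(i < M) l ^ logn l `|(d`_i)%R|)%N.
  apply: eq_bigr => i _.
  have dk : (logn l `|(d`_i)%R| <= k)%N by rewrite kE (bigD1 i) //= leq_addr.
  rewrite -(card_Zp_annihilator pl k0 _ dk) -?absz_gt0 //.
  by apply: eq_card => x; rewrite inE.
by rewrite -expn_sum -kE.
Qed.

(* The companion matrix of X^(n+1) + 1. *)
Definition anticirculant (R : nzRingType) (n : nat) : 'M[R]_n.+1 :=
  \matrix_(i, j) (if i == ord_max then - (j == 0)%:R else (j == i.+1 :> nat)%:R).

Lemma map_anticirculant (R S : nzRingType) (f : {rmorphism R -> S}) (n : nat) :
  map_mx f (anticirculant R n) = anticirculant S n.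
Proof.
by apply/matrixP => i j; rewrite !mxE; case: ifP; rewrite ?rmorphN rmorph_nat.
Qed.

(** * Diagonalisation of the companion matrix *)

Section Diagonalisation.

Variables (K : fieldType) (n : nat) (a : 'I_n.+1 -> K).
Hypothesis a_inj : injective a.
Hypothesis aN1 : forall i, a i ^+ n.+1 = -1.

Let V := Vandermonde n.+1 (\row_j a j).

(** Column j of V lists the powers of a_j and is an eigenvector for a_j; the last row uses a_j^(n+1)
    = -1. *)
Lemma anticirculant_Vandermonde :
  anticirculant K n *m V = V *m diag_mx (\row_j a j).
Proof.
apply/matrixP => i j; rewrite mul_mx_diag !mxE.
case: (unliftP ord_max i) => [i' -> | ->]; last first.
  rewrite (bigD1 0) //= big1 => [|k k0]; rewrite !mxE eqxx ?eqxx ?mxE.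
    by rewrite expr0 mulr1 addr0 -exprSr aN1.
  by rewrite (negPf k0) oppr0 mul0r.
have lti : ((lift ord_max i' : nat).+1 < n.+1)%N by rewrite lift_max ltnS.
rewrite (bigD1 (Ordinal lti)) //= big1 => [|k k0]; rewrite !mxE.
  rewrite eq_sym (negPf (neq_lift _ _)) /= eqxx mul1r addr0.
  by rewrite -exprSr.
rewrite eq_sym (negPf (neq_lift _ _)).
by rewrite (negPf (k0 : (k != (lift ord_max i').+1 :> nat))) mul0r.
Qed.

Lemma Vandermonde_unit : V \in unitmx.
Proof.
rewrite unitmxE det_Vandermonde unitfE.
apply/prodf_neq0 => i _; apply/prodf_neq0 => j ij.
rewrite !mxE subr_eq0; apply/eqP => /a_inj ji; by rewrite ji ltnn in ij.
Qed.

Lemma horner_anticirculant (p : {poly K}) :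
  horner_mx (anticirculant K n) p =
  V *m diag_mx (\row_j p.[a j]) *m invmx V.
Proof.
have uV := Vandermonde_unit.
have -> : anticirculant K n = V *m diag_mx (\row_j a j) *m invmx V.
  by rewrite -anticirculant_Vandermonde mulmxK.
rewrite horner_mx_uconj // horner_mx_diag; congr (_ *m diag_mx _ *m _).
by apply/rowP => j; rewrite !mxE.
Qed.

Lemma det_horner_anticirculant (p : {poly K}) :
  \det (horner_mx (anticirculant K n) p) = \prod_j p.[a j].
Proof.
have uV := Vandermonde_unit.
rewrite horner_anticirculant !det_mulmx det_diag mulrAC -det_mulmx mulmxV //.
by rewrite det1 mul1r; apply: eq_bigr => j _; rewrite mxE.
Qed.

End Diagonalisation.

(** The odd powers of z are thus the 2^r roots of X^(2^r) + 1, the eigenvalues required by the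
    diagonalisation. *)
Lemma prim_root_odd_pow (K : fieldType) (r : nat) (z : K) :
  (2 ^ r.+1).-primitive_root z ->
  z ^+ (2 ^ r) = -1 /\ injective (fun j : 'I_(2 ^ r) => z ^+ (j.*2.+1)).
Proof.
move=> zP; split.
  have z1 : z ^+ (2 ^ r) != 1.
    by rewrite -(prim_order_dvd zP) dvdn_Pexp2l // ltnn.
  have : (z ^+ (2 ^ r)) ^+ 2 == 1 by rewrite -exprM -expnSr prim_expr_order.
  by rewrite sqrf_eq1 (negPf z1) => /eqP.
have lt (j : 'I_(2 ^ r)) : (j.*2.+1 < 2 ^ r.+1)%N.
  by rewrite expnS mul2n -doubleS leq_double.
move=> i j /= /eqP; rewrite (eq_prim_root_expr zP) !modn_small // => /eqP [].
by move/double_inj/ord_inj.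
Qed.

(** The identity is checked after diagonalisation over [algC], into which the integers embed; it can
    then be reduced modulo any integer. *)
Lemma anticirculant_expN1 (r n : nat) : n.+1 = (2 ^ r)%N ->
  anticirculant int n ^+ n.+1 = -1.
Proof.
move=> nE; have [z zP] := C_prim_root_exists (expn_gt0 2 r.+1 : 0 < 2 ^ r.+1)%N.
have [zN1 zinj] := prim_root_odd_pow zP.
pose a (i : 'I_n.+1) := z ^+ (i.*2.+1).
have ainj : injective a.
  by move=> i j /(zinj (cast_ord nE i) (cast_ord nE j)) /(congr1 val) /= /ord_inj.
have aN1 i : a i ^+ n.+1 = -1.
  by rewrite /a -exprM mulnC exprM [X in z ^+ X]nE zN1 -signr_odd /= odd_double expr1.
have := horner_anticirculant ainj aN1 ('X^(n.+1)).
rewrite rmorphXn /= horner_mx_X => hC.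
have : map_mx (intr : int -> algC) (anticirculant int n ^+ n.+1) = map_mx intr (-1 : 'M[int]_n.+1).
  rewrite rmorphXn /= map_anticirculant hC map_mxN map_mx1.
  have -> : (\row_j ('X^(n.+1)).[a j]) = const_mx (-1).
    by apply/rowP => j; rewrite !mxE hornerXn aN1.
  rewrite diag_const_mx mul_mx_scalar -scalemxAl mulmxV ?Vandermonde_unit //.
  by rewrite scaleN1r.
move=> /matrixP e; apply/matrixP => i j; have := e i j.
by rewrite /= mxE [in RHS]mxE => /intr_inj.
Qed.

(* The kernel of g(C) modulo l^v, v being the multiplicity of l in the determinant,
   has l^v elements.  As C^(2^r) = -1, C permutes its nonzero elements in cycles of
   length 2^(r+1), so that l^v = 1 modulo 2^(r+1). *)
Lemma odd_logn_det_horner (r n l : nat) (g : {poly int}) : n.+1 = (2 ^ r)%N ->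
  prime l -> odd l ->
  odd (logn l `|\det (horner_mx (anticirculant int n) g)|) ->
  (2 ^ r.+1 %| l - 1)%N.
Proof.
move=> nE pl ol; set A := horner_mx _ _; set v := logn _ _ => ov.
have v0 : (0 < v)%N by case: v ov.
have := card_kernel_mod pl v0; rewrite -/v; set S := finset _ => cS.
have K1 : (1 < l ^ v)%N by rewrite -(exp1n v) ltn_exp2r // prime_gt1.
set C := anticirculant 'Z_(l ^ v) n.
have CN1 : C ^+ n.+1 = -1.
  rewrite /C -(map_anticirculant intr) -rmorphXn /=.
  by rewrite (anticirculant_expN1 nE) map_mxN map_mx1.
have CA : C *m map_mx intr A = map_mx intr A *m C.
  rewrite /C -(map_anticirculant intr) -!map_mxM; congr (map_mx _ _).
  by rewrite -(horner_mx_X (anticirculant int n)) !mulmxE -!rmorphM mulrC.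
have iterC k (x : 'rV['Z_(l ^ v)]_n.+1) :
    iter k (mulmxr C) x = x *m (C ^+ k).
  elim: k => [|k IH]; first by rewrite expr0 mulmx1.
  by rewrite iterS IH /= exprSr -mulmxA.
have injC : injective (mulmxr C : 'rV['Z_(l ^ v)]_n.+1 -> _).
  move=> x y /(congr1 (fun x => - (x *m C ^+ n))).
  by rewrite /= -!mulmxA !mulmxE -!exprS CN1 !mulmxN !mulmx1 !opprK.
pose S' := S :\ 0; have : (2 ^ r.+1 %| #|S'|)%N.
  apply: (dvdn_card_free injC) => x; rewrite !inE => /andP[x0 /eqP xA].
  - rewrite /= -mulmxA CA mulmxA xA mul0mx eqxx andbT.
    by rewrite -(inj_eq injC) /= mul0mx in x0 *.
  - by rewrite iterC expnS mulnC exprM -nE CN1 sqrrN expr1n mulmx1.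
  (* A vector fixed by C^(2^r) = -1 satisfies 2x = 0, hence vanishes because l is odd. *)
  rewrite iterC -nE CN1 mulmxN mulmx1 eq_sym -subr_eq0 opprK -mulr2n.
  apply: contra x0 => /eqP x2; apply/eqP.
  have u2 : (2%:R : 'Z_(l ^ v)) \is a GRing.unit.
    by rewrite unitZpE // coprimeXl // coprime_sym prime_coprime // dvdn2 ol.
  have : 2%:R^-1 *: (2%:R *: x) = x by rewrite scalerA mulVr // scale1r.
  by rewrite scaler_nat x2 scaler0 => <-.
have S0 : 0 \in S by rewrite inE mul0mx.
have := cardsD1 0 S; rewrite S0 cS add1n => cE.
have -> : #|S'| = (l ^ v - 1)%N by rewrite subn1 [in RHS]cE.
(* l^v - 1 is l - 1 times a sum of v odd terms. This sum is odd because v is, so 2^(r+1) divides l -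
   1 itself. *)
have := subn_exp l 1 v; rewrite exp1n => ->.
rewrite mulnC Gauss_dvdr //.
rewrite coprimeXl // coprime2n.
have -> : odd (\sum_(i < v) l ^ (v.-1 - i) * 1 ^ i) = odd v; last exact: ov.
rewrite -[in RHS](card_ord v) -sum1_card.
by apply: (big_ind2 (fun x y => odd x = odd y)) => // [x1 x2 y1 y2|i _];
  rewrite ?oddD ?exp1n ?muln1 ?oddX ?ol ?orbT // => -> ->.
Qed.

Lemma finField_prim_root (F : finFieldType) (d : nat) :
  (d %| #|F|.-1)%N -> exists z : F, d.-primitive_root z.
Proof.
move=> dF; have c1 := finNzRing_gt1 F.
have n0 : (0 < #|F|.-1)%N by rewrite -ltnS prednK // ltnW.
pose rs := [seq x <- enum F | x != 0].
have rsU : all (#|F|.-1).-unity_root rs.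
  apply/allP => x; rewrite mem_filter => /andP[x0 _].
  apply/unity_rootP; apply: (mulfI x0).
  by rewrite -exprS prednK ?(ltnW c1) // expf_card mulr1.
have rs1 : (#|F|.-1 <= size rs)%N.
  have := count_predC (pred1 (0 : F)) (enum F).
  rewrite -cardE count_uniq_mem ?enum_uniq // mem_enum /= => <-.
  by rewrite size_filter; exact: leqnn.
have /hasP[z _ zP] := has_prim_root n0 rsU (filter_uniq _ (enum_uniq _)) rs1.
by exists (z ^+ (#|F|.-1 %/ d)); apply: dvdn_prim_root.
Qed.

Lemma fixed_frobenius_nat (F : idomainType) (p : nat) (x : F) :
  p \in [pchar F] -> x ^+ p = x -> exists n : nat, x = n%:R.
Proof.
move=> pF xp; have pp := pcharf_prime pF.
case: (boolP (x \in [seq n%:R | n <- iota 0 p])) => [/mapP[n _ ->]|xs].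
  by exists n.
pose P : {poly F} := 'X^p - 'X.
have sP : size P = p.+1.
  by rewrite /P size_polyDl ?size_polyXn // size_polyN size_polyX ltnS prime_gt1.
have P0 : P != 0 by rewrite -size_poly_eq0 sP.
have := max_poly_roots (rs := x :: [seq n%:R | n <- iota 0 p]) P0.
rewrite sP /= size_map size_iota ltnn => h; suff: false by []; apply: h.
  rewrite /root /P !hornerE xp subrr eqxx /=.
  apply/allP => y /mapP[n _ ->]; rewrite /root !hornerE.
  by rewrite -(pFrobenius_autE pF) pFrobenius_aut_nat subrr.
rewrite xs /= map_inj_in_uniq ?iota_uniq // => i j.
rewrite !mem_iota /= !add0n => ip jp /eqP.
wlog ij : i j ip jp / (i <= j)%N.
  move=> H; case: (leqP i j) => [/H|/ltnW/H]; first exact.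
  by rewrite eq_sym => H' /H' -> .
rewrite eq_sym -subr_eq0 -natrB // -(dvdn_pcharf pF) => /dvdnP[k jk].
case: k jk => [|k] jk; first by apply/eqP; rewrite eqn_leq ij -subn_eq0 jk.
by move: jk; rewrite mulSn; lia.
Qed.

(** The exponents 2th + 1 for t < s add up to s + h s (s - 1); since z^(hs) = -1 and s - 1 is odd,
    the second term contributes only a sign. *)
Lemma prod_anticirculant_roots (K : fieldType) (s h : nat) (z : K) :
  (0 < h)%N -> ~~ odd s -> (0 < s)%N -> z ^+ (s * h) = -1 ->
  \prod_(j < s * h | (h %| j)%N) z ^+ (j.*2.+1) = - z ^+ s.
Proof.
move=> h0 s2 s0 zN1.
rewrite -(big_mkord (fun j => (h %| j)%N) (fun j => z ^+ (j.*2.+1))).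
have -> : \prod_(0 <= j < s * h | (h %| j)%N) z ^+ (j.*2.+1) =
  \prod_(0 <= t < s) z ^+ ((t * h).*2.+1).
  rewrite big_mkcond big_nat_mul; apply: eq_bigr => t _.
  rewrite -[X in \big[_/_]_(X <= _ < _) _]add0n mulSn.
  rewrite big_addn addnK -[X in \big[_/_]_(_ <= _ < X) _](prednK h0).
  rewrite big_nat_recl // add0n dvdn_mull //=.
  rewrite big_nat big1 ?mulr1 // => i /andP[_ ih].
  rewrite dvdn_addl ?dvdn_mull // gtnNdvd //.
  by rewrite -[X in (_ < X)%N](prednK h0) ltnS.
have -> : \prod_(0 <= t < s) z ^+ ((t * h).*2.+1) = z ^+ (s + h * (s * s.-1)).
  elim: (s) => [|t IH]; first by rewrite big_geq // muln0.
  rewrite big_nat_recr //= IH -exprD; congr (z ^+ _).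
  case: t {IH} => [|t]; first by rewrite !muln0.
  by rewrite -muln2 /=; ring.
rewrite exprD mulnA (mulnC h) exprM zN1 -signr_odd.
by move: s2 s0; case: (s) => //= t; rewrite negbK => -> _; rewrite expr1 mulrN1.
Qed.

(* Modulo q the eigenvalues of C are the primitive 2^(r+1)-th roots of unity; g is
   chosen to fix those a with a^s = w, for some w of order 2^e, and to send the others
   to 1.  The determinant of g(C) is then - w, a generator of the 2-part of F_q^*,
   hence a nonresidue.  The coefficient K makes g congruent to 1 modulo D. *)
Lemma exists_det_nonresidue (q D r n : nat) :
  prime q -> (4 %| q - 1)%N -> coprime D q -> (logn 2 (q - 1) <= r)%N ->
  n.+1 = (2 ^ r)%N ->
  exists g : {poly int},
    let N := `|\det (horner_mx (anticirculant int n) g)|%N in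
    (q %| N ^ (q - 1)./2 + 1)%N /\
    forall l, prime l -> (l %| D)%N -> ~~ (l %| N)%N.
Proof.
move=> pq q4 Dq er nE.
have q1 := prime_gt1 pq.
set e := logn 2 (q - 1) in er.
have q10 : (0 < q - 1)%N by rewrite subn_gt0.
have e2 : (2 <= e)%N by rewrite -(pfactor_dvdn 2 (isT : prime 2)).
have [t t2 qt] := pfactor_coprime (isT : prime 2) q10; rewrite -/e in qt.
have tO : odd t by rewrite coprime2n in t2.
pose h := (2 ^ e.-1)%N; pose s := (2 ^ (r.+1 - e))%N.
have h0 : (0 < h)%N by rewrite expn_gt0.
have s0 : (0 < s)%N by rewrite expn_gt0.
have sE : ~~ odd s by rewrite oddX orbF subn_eq0 -ltnNge ltnS.
have shE : (s * h = 2 ^ r)%N by rewrite -expnD; congr expn; lia.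
have hq : (q - 1 = 2 * h * t)%N.
  by rewrite qt mulnC -expnS prednK // ltnW.
have cop2q : coprime 2 q.
  by rewrite coprime2n; move: (dvdn_trans (isT : 2 %| 4)%N q4); rewrite dvdn2; lia.
(* By Euler, q^k = 1 modulo 2^(r+1), so the field with q^k elements contains z. *)
pose k := totient (2 ^ r.+1).
have k0 : (0 < k)%N by rewrite totient_gt0 expn_gt0.
have [F Fq cF] := pPrimePowerField pq k0.
have dF : (2 ^ r.+1 %| #|F|.-1)%N.
  rewrite cF -subn1 -eqn_mod_dvd ?expn_gt0 ?prime_gt0 //.
  by apply/eqP/Euler_exp_totient; rewrite coprimeXr // coprime_sym.
have [z zP] := finField_prim_root dF.
have [zN1 zinj] := prim_root_odd_pow zP.
pose w := z ^+ s.
have wh : w ^+ h = -1 by rewrite -exprM shE.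
have w0 : w != 0 by rewrite expf_eq0 (prim_root_eq0 zP) expn_eq0 andbF.
(* w lies in the prime field, since its order 2h divides q - 1; its inverse is therefore the class
   of an integer, and g can have integer coefficients. *)
have [W WE] : exists W : nat, w^-1 = W%:R.
  apply: (fixed_frobenius_nat Fq); rewrite exprVn; congr (_^-1).
  have -> : q = (q - 1).+1 by rewrite subn1 prednK // ltnW.
  by rewrite exprS hq mulnAC mulnC exprM wh exprM sqrrN !expr1n mulr1.
have hne : h%:R != 0 :> F.
  rewrite -(dvdn_pcharf Fq) -prime_coprime // coprime_sym coprimeXl //.
have [K KD KE] : exists2 K : nat, (D %| K)%N & K%:R * h%:R = 1 :> F.
  have hDq : coprime (D * h) q by rewrite coprimeMl Dq coprimeXl.
  have /(coprimeP _ _) : coprime (D * h) q by [].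
  case=> [|[u v] /= uv].
    rewrite muln_gt0 h0 andbT lt0n; apply/eqP => D0; move: Dq.
    by rewrite D0 /coprime gcd0n => /eqP q1'; rewrite q1' in q1.
  exists (D * u)%N; first exact: dvdn_mulr.
  have : (u * (D * h) = v * q + 1)%N by move: uv; lia.
  move/(congr1 (fun x => x%:R : F)).
  rewrite natrD !natrM (pcharf0 Fq) mulr0 add0r => uv1.
  by apply: etrans uv1; ring.
(* At an eigenvalue a, the quotient y = a^s / w is an h-th root of unity, so the geometric sum is h
   if y = 1 and 0 otherwise; K, an inverse of h modulo q, normalises it. *)
pose g : {poly int} := 1 + (K%:Z)%:P * ('X - 1) * \sum_(i < h) ((W%:Z)%:P * 'X^s) ^+ i.
exists g => N.
pose a (j : 'I_n.+1) := z ^+ (j.*2.+1).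
have ainj : injective a.
  by move=> i j /(zinj (cast_ord nE i) (cast_ord nE j)) /(congr1 val) /= /ord_inj.
have aN1 i : a i ^+ n.+1 = -1.
  by rewrite /a -exprM mulnC exprM [X in z ^+ X]nE zN1 -signr_odd /= odd_double expr1.
have ga j : (map_poly intr g).[a j] = if (h %| j)%N then a j else 1 :> F.
  rewrite rmorphD rmorph1 !rmorphM rmorphB rmorph1 /= map_polyX map_polyC /=.
  rewrite rmorph_sum hornerD hornerM hornerM hornerC hornerD hornerN !hornerC hornerX.
  rewrite horner_sum /=.
  have -> : \sum_(i < h) (map_poly intr (((W%:Z)%:P * 'X^s) ^+ i)).[a j] =
    \sum_(i < h) (a j ^+ s / w) ^+ i :> F.
    apply: eq_bigr => i _; rewrite rmorphXn rmorphM /= map_polyC map_polyXn /=.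
    by rewrite horner_exp hornerM hornerC hornerXn WE mulrC.
  have yh : (a j ^+ s / w) ^+ h = 1.
    rewrite expr_div_n wh -exprM shE /a -exprM mulnC exprM zN1 -signr_odd /=.
    by rewrite odd_double expr1 divrr // unitrN1.
  have yE : (a j ^+ s == w) = (h %| j)%N.
    rewrite /a /w -exprM (eq_prim_root_expr zP) -{2}[s]mul1n.
    rewrite -[j.*2.+1]addn1 mulnDl -[X in _ == X %[mod _]]add0n eqn_modDr mod0n.
    have -> : (2 ^ r.+1 = s * 2 * h)%N by rewrite expnS -shE; ring.
    have -> : (j.*2 * s = s * 2 * j)%N by rewrite -muln2; ring.
    by rewrite -/(dvdn _ _) dvdn_pmul2l // muln_gt0 s0.
  case: ifP => hj; rewrite hj in yE.
    rewrite (eqP yE) divff // (eq_bigr (fun=> 1)) => [|i _]; last by rewrite expr1n.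
    by rewrite sumr_const card_ord mulrAC KE mul1r addrC subrK.
  have y1 : a j ^+ s / w - 1 != 0.
    by rewrite subr_eq0 -(inj_eq (mulIf w0)) mulfVK // mul1r yE.
  have : (a j ^+ s / w - 1) * \sum_(i < h) (a j ^+ s / w) ^+ i = 0.
    by rewrite -subrX1 yh subrr.
  by move/eqP; rewrite mulf_eq0 (negPf y1) => /eqP ->; rewrite mulr0 addr0.
have detF : (\det (horner_mx (anticirculant int n) g))%:~R = - w :> F.
  rewrite -det_map_mx map_horner_mx map_anticirculant.
  rewrite (det_horner_anticirculant ainj aN1).
  have zsh : z ^+ (s * h) = -1 by rewrite shE.
  rewrite /w -(prod_anticirculant_roots h0 sE s0 zsh).
  rewrite (eq_bigr _ (fun j _ => ga j)) -big_mkcond /= /a.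
  rewrite -2!(big_mkord (fun j => (h %| j)%N) (fun j => z ^+ (j.*2.+1))).
  by rewrite nE shE.
split.
  rewrite (dvdn_pcharf Fq) natrD natrX.
  have q2 : ((q - 1)./2 = h * t)%N by rewrite hq -mulnA mul2n doubleK.
  have evh : ~~ odd h by rewrite oddX orbF -subn1 subn_eq0 -ltnNge.
  (* [N] is the determinant only up to sign, which the even exponent h t = (q - 1) / 2 removes. *)
  have sg (x y : F) : x = y \/ x = - y -> x ^+ (h * t) = y ^+ (h * t).
    case=> -> //; rewrite exprNn -signr_odd oddM (negPf evh) expr0 mul1r //.
  rewrite q2 (sg N%:R w); last first.
    have : N%:Z = \det (horner_mx (anticirculant int n) g) \/
           N%:Z = - \det (horner_mx (anticirculant int n) g).
      by rewrite /N; case: (intP (\det _)) => [|i|i]; [left|left|right; rewrite opprK].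
    case=> /(congr1 (fun x : int => x%:~R : F)); rewrite ?rmorphN /= detF.
      by right.
    by rewrite opprK; left.
  by rewrite exprM wh -signr_odd tO expr1 addNr.
move=> l pl lD; apply/negP => lN.
have lF := pchar_Fp pl.
have : (\det (horner_mx (anticirculant int n) g))%:~R = 1 :> 'F_l.
  rewrite -det_map_mx map_horner_mx map_anticirculant /g.
  rewrite rmorphD rmorph1 !rmorphM /= map_polyC /=.
  have -> : K%:~R = 0 :> 'F_l.
    by apply/eqP; rewrite -(dvdn_pcharf lF) (dvdn_trans lD).
  by rewrite polyC0 !mul0r addr0 rmorph1 det1.
have intr0 (x : int) : (l %| `|x|)%N -> x%:~R = 0 :> 'F_l.
  case: (intP x) => [//|i|i]; rewrite ?abszN (dvdn_pcharf lF) => /eqP // i0.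
  by rewrite rmorphN /= -[X in X%:~R]/(i.+1 : int) -pmulrn i0 oppr0.
by rewrite intr0 // => /eqP; rewrite eq_sym oner_eq0.
Qed.

(** * The quadratic Gauss sum modulo q in characteristic l *)

Section GaussSum.

Variables (q l : nat).
Hypotheses (pq : prime q) (q4 : (4 %| q - 1)%N) (pl : prime l).
Hypothesis lq : (q %| l ^ (q - 1)./2 + 1)%N.
Variables (F : finFieldType) (eta : F).
Hypotheses (Fl : l \in [pchar F]) (etaP : q.-primitive_root eta).
Hypothesis l2 : odd l.

Let hq := (q - 1)./2.
(** [chi] is the Legendre symbol modulo q with values in F, of characteristic l, and [tau] is its
    Gauss sum. *)
Let chi (a : 'F_q) : F :=
  if a == 0 then 0 else if a ^+ hq == 1 then 1 else -1.
Let e (a : 'F_q) : F := eta ^+ a.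
Let tau : F := \sum_a chi a * e a.

Let oneN1 : 1 != -1 :> F.
Proof.
rewrite -subr_eq0 opprK -mulr2n -(dvdn_pcharf Fl); apply/negP.
by rewrite dvdn_prime2 // => /eqP l2'; move: l2; rewrite l2'.
Qed.

Let oneN1q : 1 != -1 :> 'F_q.
Proof.
rewrite -subr_eq0 opprK -mulr2n -(dvdn_pcharf (pchar_Fp pq)); apply/negP.
rewrite dvdn_prime2 // => /eqP q2; by move: q4; rewrite q2.
Qed.

Let hq2 : (hq * 2 = q - 1)%N.
Proof.
by rewrite /hq; have /dvdnP[t ->] := q4; lia.
Qed.

Let expq (a : 'F_q) : a != 0 -> a ^+ (q - 1) = 1.
Proof.
move=> a0; apply: (mulfI a0); rewrite -exprS mulr1.
rewrite subn1 prednK ?prime_gt0 //.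
by rewrite -[in RHS](expf_card a) card_Fp.
Qed.

Let exphq (a : 'F_q) : a != 0 -> a ^+ hq = 1 \/ a ^+ hq = -1.
Proof.
move=> a0; have : (a ^+ hq) ^+ 2 == 1 by rewrite -exprM hq2 expq.
by rewrite sqrf_eq1 => /orP[] /eqP; [left|right].
Qed.

Let chiM a b : chi (a * b) = chi a * chi b.
Proof.
rewrite /chi mulf_eq0; case: (eqVneq a) => [_|a0]; first by rewrite mul0r.
case: (eqVneq b) => [_|b0]; first by rewrite mulr0.
have N1 : (-1 == 1 :> 'F_q) = false by rewrite eq_sym (negPf oneN1q).
by rewrite /= exprMn; case: (exphq a0) => ->; case: (exphq b0) => ->;
  rewrite ?mulrNN ?mulr1 ?mul1r ?eqxx ?N1 ?mulrNN ?mulr1 ?mul1r.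
Qed.

Let chi_sqr a : a != 0 -> chi a * chi a = 1.
Proof.
by rewrite /chi => /negPf ->; case: ifP; rewrite ?mulrNN mulr1.
Qed.

Let chiN1 : chi (-1) = 1.
Proof.
rewrite /chi oppr_eq0 oner_eq0 -signr_odd.
suff -> : odd hq = false by rewrite eqxx.
have /dvdnP[t qt] := q4; have : (hq = t * 2)%N by rewrite /hq qt; lia.
by move=> ->; rewrite oddM andbF.
Qed.

Let chil : chi l%:R = -1.
Proof.
have lN1 : (l%:R : 'F_q) ^+ hq = -1.
  by apply/eqP; rewrite -addr_eq0 -natrX natr1 -addn1 -(dvdn_pcharf (pchar_Fp pq)).
rewrite /chi; case: eqP => l0; last by rewrite lN1 eq_sym (negPf oneN1q).
have h0 : (0 < hq)%N by move: hq2 (prime_gt1 pq); lia.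
by move/eqP: lN1; rewrite l0 expr0n (gtn_eqF h0) eq_sym oppr_eq0 oner_eq0.
Qed.

Let lF0 : l%:R != 0 :> 'F_q.
Proof.
by apply/eqP => l0; move: chil; rewrite l0 /chi eqxx => /eqP; rewrite eq_sym oppr_eq0 oner_eq0.
Qed.

(** Multiplication by l permutes the classes modulo q and, l being a nonresidue, changes the sign of
    the sum. *)
Let sum_chi : \sum_a chi a = 0.
Proof.
have mulI : injective (fun a : 'F_q => l%:R * a) by apply: mulfI.
have : \sum_a chi a = - \sum_a chi a.
  rewrite [LHS](reindex_inj mulI) /= -sumrN; apply: eq_bigr => a _.
  by rewrite chiM chil mulN1r.
move/eqP; rewrite -subr_eq0 opprK -[X in X + X]mulr1 -mulrDr mulf_eq0.
case/orP => [/eqP //|]; by rewrite -[X in _ + X]opprK subr_eq0 (negPf oneN1).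
Qed.

Let eD a b : e (a + b) = e a * e b.
Proof.
rewrite /e /= -exprD -[RHS](prim_expr_mod etaP); congr (_ ^+ _).
by rewrite [X in (_ %% X)%N = _]Fp_cast.
Qed.

Let e0 : e 0 = 1. Proof. by rewrite /e expr0. Qed.

Let sum_e (c : 'F_q) : c != 0 -> \sum_a e (a * c) = 0.
Proof.
move=> c0; have <- : \sum_a e a = \sum_a e (a * c) by rewrite (reindex_inj (mulIf c0)).
have e1 : e 1 != 1.
  rewrite /e -(prim_order_dvd etaP) /= dvdn1.
  by apply/eqP => q1; move: (prime_gt1 pq); rewrite q1.
have : \sum_a e a = e 1 * \sum_a e a.
  rewrite [LHS](reindex_inj (addrI 1)) mulr_sumr /=.
  by apply: eq_bigr => a _; rewrite eD.
move/eqP; rewrite -[X in X == _]mul1r -subr_eq0 -mulrBl mulf_eq0 subr_eq0.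
by rewrite eq_sym (negPf e1) => /eqP.
Qed.

Let tau_sqr : tau ^+ 2 = q%:R.
Proof.
(* Substituting b = a t in the double sum turns chi(a) chi(b) into chi(t) for a != 0. Summing over a
   first, and using [sum_chi], leaves only t = -1, where chi(-1) = 1 because q = 1 modulo 4. *)
have -> : tau ^+ 2 = \sum_(a | a != 0) \sum_t chi t * e (a * (1 + t)).
  rewrite expr2 {1}/tau mulr_suml (bigID (fun a => a == 0)) /= big_pred1_eq.
  rewrite {1}/chi eqxx !mul0r add0r; apply: eq_bigr => a a0.
  rewrite /tau (reindex_inj (mulfI a0)) mulr_sumr; apply: eq_bigr => t _.
  rewrite chiM mulrDr mulr1 eD mulrACA mulrA [chi a * (_ * _)]mulrA chi_sqr //.
  by rewrite mul1r mulrA.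
rewrite exchange_big /=.
have sE t : \sum_(a | a != 0) chi t * e (a * (1 + t)) =
    chi t * (q%:R * (t == -1)%:R) - chi t.
  rewrite -mulr_sumr -[X in _ - X]mulr1 -mulrBr; congr (_ * _).
  apply/eqP; rewrite eq_sym subr_eq addrC; apply/eqP.
  transitivity (\sum_a e (a * (1 + t))).
    case: eqVneq => [->|t1]; last first.
      by rewrite sum_e ?mulr0 // addrC -[1]opprK subr_eq0.
    rewrite (eq_bigr (fun=> 1)) ?sumr_const ?mulr1 => [|a _].
      by rewrite -[in LHS](card_Fp pq) cardT.
    by rewrite subrr mulr0 e0.
  by rewrite (bigD1 0) //= mul0r e0.
rewrite (eq_bigr _ (fun t _ => sE t)) sumrB sum_chi subr0 (bigD1 (-1)) //=.
rewrite chiN1 eqxx mulr1 mul1r big1 ?addr0 // => t /negPf ->.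
by rewrite !mulr0.
Qed.

(** The l-th power map sends eta^a to eta^(l a) and fixes the values of chi, l being odd; reindexing
    by a -> l a brings out chi(l) = -1. *)
Let tau_frob : tau ^+ l = - tau.
Proof.
rewrite -(pFrobenius_autE Fl) /tau rmorph_sum /= -sumrN.
rewrite [in RHS](reindex_inj (mulfI lF0)) /=; apply: eq_bigr => a _.
rewrite chiM chil mulN1r mulNr opprK rmorphM /= !pFrobenius_autE.
congr (_ * _).
  rewrite /chi; case: ifP => _; first by rewrite expr0n gtn_eqF ?prime_gt0.
  by case: ifP => _; rewrite ?expr1n // -signr_odd l2 expr1.
elim: (l) => [|k IH]; first by rewrite expr0 mul0r e0.
by rewrite exprS IH -natr1 mulrDl mul1r addrC eD.
Qed.

(** Frobenius negates tau, so tau^(l-1) = -1; as tau^2 = q, this reads q^((l-1)/2) = -1 in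
    characteristic l. *)
Lemma gauss_sum_nonresidue : (l %| q ^ (l - 1)./2 + 1)%N.
Proof.
have q0 : q%:R != 0 :> F.
  rewrite -(dvdn_pcharf Fl); apply/negP; rewrite dvdn_prime2 // => /eqP lq'.
  by move: (lF0); rewrite lq' -(dvdn_pcharf (pchar_Fp pq)) dvdnn.
have tau0 : tau != 0.
  by apply: contra q0 => /eqP t0; rewrite -tau_sqr t0 expr0n.
have l21 : (((l - 1)./2 * 2).+1 = l)%N by move: l2 (prime_gt1 pl); lia.
have : tau * tau ^+ ((l - 1)./2 * 2) = tau * -1.
  by rewrite -exprS l21 tau_frob mulrN1.
move/(mulfI tau0); rewrite mulnC exprM tau_sqr => qN1.
by rewrite (dvdn_pcharf Fl) natrD natrX qN1 addNr.
Qed.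

End GaussSum.

Lemma quadratic_reciprocity_nonresidue (q l : nat) :
  prime q -> (4 %| q - 1)%N -> prime l -> odd l ->
  (q %| l ^ (q - 1)./2 + 1)%N -> (l %| q ^ (l - 1)./2 + 1)%N.
Proof.
move=> pq q4 pl l2 lq.
have q10 : (0 < q - 1)%N by rewrite subn_gt0 prime_gt1.
have [F Fl cF] := pPrimePowerField pl q10.
have qF : (q %| #|F|.-1)%N.
  rewrite cF -subn1 -eqn_mod_dvd ?expn_gt0 ?prime_gt0 //.
  have -> : (q - 1 = totient q)%N by rewrite totient_prime // subn1.
  apply/eqP/Euler_exp_totient; rewrite coprime_sym prime_coprime //.
  apply/negP => ql; move: lq; rewrite dvdn_addr ?dvdn1.
    by move/eqP => q1; move: (prime_gt1 pq); rewrite q1.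
  rewrite dvdn_exp //; move/dvdnP: q4 => [t qt]; move: q10; rewrite qt; lia.
have [eta etaP] := finField_prim_root qF.
exact: (gauss_sum_nonresidue pq q4 pl lq Fl etaP l2).
Qed.

(** The determinant N is a nonresidue modulo q, so some prime l of odd multiplicity in N is one too.
    The odd multiplicity gives l = 1 modulo 2^(r+1), reciprocity exchanges l and q, and coprimality
    of N with D gives l > B. *)
Lemma exists_prime_nonresidue (q m B : nat) : prime q -> (4 %| q - 1)%N ->
  exists l, [/\ prime l, (B < l)%N, (2 ^ m %| l - 1)%N &
                (l %| q ^ (l - 1)./2 + 1)%N].
Proof.
move=> pq q4; pose r := (m + logn 2 (q - 1))%N.
have nE : (2 ^ r).-1.+1 = (2 ^ r)%N by rewrite prednK // expn_gt0.
(* The range is 2, ..., B + 3: it always contains 2, so that l is odd. The prime q is left out to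
   keep D coprime to q; it does not divide N anyway. *)
pose D := (\prod_(p <- iota 2 B.+2 | prime p && (p != q)) p)%N.
have Dq : coprime D q.
  rewrite /D; elim/big_rec: _ => [|p x /andP[pp pneq] cx]; first exact: coprime1n.
  by rewrite coprimeMl cx andbT prime_coprime // dvdn_prime2.
have er : (logn 2 (q - 1) <= r)%N by apply: leq_addl.
have [g [] ] := exists_det_nonresidue pq q4 Dq er nE.
set N := absz _ => Nq ND.
have hq0 : (0 < (q - 1)./2)%N.
  move/dvdnP: q4 (prime_gt1 pq) => [t qt]; lia.
have qN : ~~ (q %| N)%N.
  apply/negP => qN; move: Nq; rewrite dvdn_addr ?dvdn1.
    by move/eqP => q1; move: (prime_gt1 pq); rewrite q1.
  by rewrite dvdn_exp.
have N0 : (0 < N)%N by case: (N) qN => //; rewrite dvdn0.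
have Fq := pchar_Fp pq.
have chi2 (x : nat) : (x%:R : 'F_q) != 0 -> ((x%:R : 'F_q) ^+ (q - 1)./2) ^+ 2 = 1.
  move=> x0; rewrite -exprM.
  have -> : ((q - 1)./2 * 2 = q - 1)%N.
    by move/dvdnP: q4 => [t ->]; lia.
  apply: (mulfI x0); rewrite -exprS mulr1 subn1 prednK ?prime_gt0 //.
  by rewrite -[in RHS](expf_card (x%:R : 'F_q)) card_Fp.
have [l lN [lo lq]] : exists2 l, l \in primes N &
    odd (logn l N) /\ (q %| l ^ (q - 1)./2 + 1)%N.
  have [/hasP[l lN /andP[]]|/hasPn nex] :=
    boolP (has (fun l => odd (logn l N) && (q %| l ^ (q - 1)./2 + 1)%N) (primes N)).
    by exists l.
  have NE : (N%:R : 'F_q) ^+ (q - 1)./2 = 1.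
    rewrite (prod_prime_decomp N0) prime_decompE big_map /= natr_prod.
    rewrite -prodrXl big_seq big1 // => l lN.
    have ln0 : (l%:R : 'F_q) != 0.
      rewrite -(dvdn_pcharf Fq); apply: contra qN => /dvdn_trans; apply.
      by move: lN; rewrite mem_primes => /and3P[].
    rewrite natrX -exprM mulnC exprM.
    case: (boolP (odd (logn l N))) => [lo|le]; last first.
      rewrite -[logn l N]odd_double_half (negPf le) add0n -mul2n exprM chi2 //.
      by rewrite expr1n.
    have /eqP := chi2 _ ln0; rewrite sqrf_eq1 => /orP[/eqP ->|/eqP lN1].
      by rewrite expr1n.
    have /negP[] := nex _ lN; rewrite lo /=.
    by rewrite (dvdn_pcharf Fq) natrD natrX lN1 addNr.
  move: Nq; rewrite (dvdn_pcharf Fq) natrD natrX NE -mulr2n -(dvdn_pcharf Fq).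
  rewrite dvdn_prime2 // => /eqP q2; by move: q4; rewrite q2.
move: lN; rewrite mem_primes => /and3P[pl _ lN].
have lB : (B < l)%N.
  rewrite ltnNge; apply/negP => lB.
  have lneq : l != q by apply/eqP => le; move: qN; rewrite -le lN.
  have lI : l \in iota 2 B.+2 by rewrite mem_iota prime_gt1 //; lia.
  by move: lN; apply/negP/ND; rewrite // /D (big_rem l lI) pl lneq /= dvdn_mulr.
have ol : odd l.
  apply: contraT => le; have l2 : l = 2.
    by apply/eqP; move: le; rewrite -dvdn2 dvdn_prime2 // eq_sym.
  move: lN; rewrite l2; apply: contraTT => _; apply: ND => //.
  have q2 : 2 != q by apply/eqP => q2; move: q4; rewrite -q2.
  have lI : 2 \in iota 2 B.+2 by rewrite mem_iota.
  by rewrite /D (big_rem 2 lI) q2 dvdn_mulr.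
exists l; split=> //; last exact: quadratic_reciprocity_nonresidue.
apply: dvdn_trans (odd_logn_det_horner nE pl ol lo).
by apply: dvdn_exp2l; rewrite /r; lia.
Qed.

(** * Finite groups acting on commutative rings *)

Section GroupActingOnRing.

Variables (A : comNzRingType) (I : finType) (act : I -> {rmorphism A -> A}).
Variables (i1 : I) (mul : I -> I -> I).
Hypothesis act1 : forall a, act i1 a = a.
Hypothesis mul_inj : forall i, injective (mul i).
Hypothesis actM : forall i j a, act i (act j a) = act (mul i j) a.

Lemma prod_act_fixed (B : comNzRingType) (F : I -> B) (u : I -> {rmorphism B -> B}) :
  (forall i j, u i (F j) = F (mul i j)) ->
  forall i, u i (\prod_j F j) = \prod_j F j.
Proof.
move=> uF i; rewrite rmorph_prod (eq_bigr _ (fun j _ => uF i j)).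
by rewrite [RHS](reindex_inj (@mul_inj i)).
Qed.

(* The elements of a finite family are packed as the coefficients of one
   polynomial: a product of conjugates then vanishes modulo a prime only if one
   conjugation works for the whole family at once. *)
Let pack (x : I -> A) : {poly A} := \sum_i (x i) *: 'X^(enum_rank i).

Let coef_pack (x : I -> A) (i : I) : (pack x)`_(enum_rank i) = x i.
Proof.
rewrite /pack coef_sum (bigD1 i) //= coefZ coefXn eqxx mulr1.
rewrite big1 ?addr0 // => j ji; rewrite coefZ coefXn.
case: eqP => [/ord_inj/enum_rank_inj ij|_]; last by rewrite mulr0.
by rewrite ij eqxx in ji.
Qed.

Let pack_coef (x : I -> A) (P : A -> Prop) : P 0 ->
  (forall i, P (x i)) -> forall n, P (pack x)`_n.
Proof.
move=> P0 Px n; have [nI|In] := ltnP n #|I|; last first.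
  rewrite /pack coef_sum big1 // => i _; rewrite coefZ coefXn.
  case: eqP => [ni|_]; last by rewrite mulr0.
  by have := ltn_ord (enum_rank i); rewrite -ni ltnNge In.
have -> : n = enum_rank (enum_val (Ordinal nI)) by rewrite enum_valK.
by rewrite coef_pack.
Qed.

(** A norm argument: choose for each i a counterexample x_i and pack them. The product of the
    conjugates of the packed polynomial is invariant and vanishes under pi', hence under pi; over a
    domain one conjugate then vanishes, which contradicts the choice of x_i. *)
Lemma conjugate_transitive (K K' : idomainType)
    (pi : {rmorphism A -> K}) (pi' : {rmorphism A -> K'}) :
  (forall a, (forall i, act i a = a) -> pi' a = 0 -> pi a = 0) ->
  exists i, forall a, pi' a = 0 -> pi (act i a) = 0.
Proof.
move=> fixP; apply: contrapT => nex.
have /choice[x xP] i : exists a, pi' a = 0 /\ pi (act i a) <> 0.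
  apply: contrapT => h; apply: nex; exists i => a a0.
  by apply: contrapT => ai; apply: h; exists a.
pose T i := map_poly (act i) (pack x).
pose N := \prod_i T i.
have NF i : map_poly (act i) N = N.
  apply: (prod_act_fixed (u := fun i => map_poly (act i))) => {}i j /=.
  by apply/polyP => n; rewrite !coef_map /= actM.
have N0 n : pi' N`_n = 0.
  rewrite -coef_map /= /N (bigD1 i1) //= rmorphM /=.
  have -> : map_poly pi' (T i1) = 0; last by rewrite mul0r coef0.
  apply/polyP => k; rewrite coef0 !coef_map /= act1.
  by apply: (pack_coef (P := fun a => pi' a = 0)) => [|i]; rewrite ?rmorph0 //; case: (xP i).
have : map_poly pi N = 0.
  apply/polyP => n; rewrite coef0 coef_map /=; apply: fixP => // i.
  by rewrite -coef_map NF.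
move/eqP; rewrite /N rmorph_prod /= prodf_seq_eq0 => /hasP[i _ /andP[_ /eqP Ti]].
case: (xP i) => _; apply.
by rewrite -[in LHS]coef_pack -!coef_map -/(T i) Ti coef0.
Qed.

(** The polynomial whose roots are the conjugates of the packed counterexamples has invariant
    coefficients, so its reduction is fixed by y -> y^(p^e). This map therefore sends the reduction
    of the packed element to that of one of its conjugates. *)
Lemma conjugate_frobenius (K : idomainType) (pi : {rmorphism A -> K})
    (p e : nat) : p \in [pchar K] ->
  (forall a, (forall i, act i a = a) -> pi a ^+ (p ^ e) = pi a) ->
  exists i, forall a, pi (act i a) = pi a ^+ (p ^ e).
Proof.
move=> pK fixP; apply: contrapT => nex.
have /choice[x xP] i : exists a, pi (act i a) <> pi a ^+ (p ^ e).
  apply: contrapT => h; apply: nex; exists i => a.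
  by apply: contrapT => ai; apply: h; exists a.
have [phi phiE] : exists phi : {rmorphism K -> K}, forall y, phi y = y ^+ (p ^ e).
  elim: (e) => [|k [f fE]]; first by exists idfun => y; rewrite expr1.
  exists (pFrobenius_aut pK \o f) => y.
  by rewrite /= pFrobenius_autE fE -exprM -expnSr.
pose T i := map_poly (act i) (pack x).
pose N : {poly {poly A}} := \prod_i ('X - (T i)%:P).
have NF i : map_poly (map_poly (act i)) N = N.
  apply: (prod_act_fixed (u := fun i => map_poly (map_poly (act i)))) => {}i j /=.
  rewrite rmorphB /= map_polyX map_polyC /=; congr (_ - _%:P).
  by apply/polyP => n; rewrite !coef_map /= actM.
pose M := map_poly (map_poly pi) N.
have ME : M = \prod_i ('X - (map_poly pi (T i))%:P).
  rewrite /M rmorph_prod; apply: eq_bigr => i _.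
  by rewrite rmorphB /= map_polyX map_polyC.
have MF : map_poly (map_poly phi) M = M.
  apply/polyP => n; rewrite /M !coef_map /=; apply/polyP => k.
  rewrite !coef_map /= phiE; apply: fixP => i.
  by rewrite -[in LHS]coef_map /= -[in LHS](coef_map (map_poly (act i))) /= NF.
have : root M (map_poly phi (map_poly pi (pack x))).
  rewrite -MF; apply: rmorph_root; rewrite ME.
  rewrite (bigD1 i1) //= rootM; apply/orP; left.
  suff -> : T i1 = pack x by rewrite root_XsubC.
  by apply/polyP => n; rewrite coef_map /= act1.
rewrite ME /root horner_prod prodf_seq_eq0 => /hasP[i _ /andP[_]].
rewrite hornerXsubC subr_eq0 => /eqP Ti; apply: (xP i).
by rewrite -phiE -[in LHS]coef_pack -[in RHS]coef_pack -!coef_map -/(T i) Ti.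
Qed.

End GroupActingOnRing.

(** * Finite subrings of a domain *)

Section FiniteSubrings.

Variable K : idomainType.
Implicit Types S T : seq K.

Definition sub_closed S := 0 \in S /\ {in S &, forall x y, x - y \in S}.

(** Residue rings are only known as domains, without a finite structure; their finite subrings are
    therefore duplicate-free lists, whose size serves as norm. *)
Definition subring_seq S :=
  [/\ uniq S, 1 \in S, {in S &, forall x y, x - y \in S}
    & {in S &, forall x y, x * y \in S}].

Lemma subring_seq_sub S : subring_seq S -> sub_closed S.
Proof. by case=> _ S1 SB _; split=> //; rewrite -(subrr 1) SB. Qed.

Lemma subring_seq_expr S x n : subring_seq S -> x \in S -> x ^+ n \in S.
Proof.
case=> _ S1 _ SM xS; elim: n => [|n IH]; first by rewrite expr0.
by rewrite exprS SM.
Qed.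

Lemma expr_size_pred S x : subring_seq S -> x \in S -> x != 0 ->
  x ^+ (size S).-1 = 1.
Proof.
move=> SR xS x0; have [S0 _] := subring_seq_sub SR; have [uS S1 _ SM] := SR.
pose S' := rem 0 S.
have S'P y : (y \in S') = (y != 0) && (y \in S) by rewrite mem_rem_uniq.
have uS' : uniq S' by apply: rem_uniq.
have perm : perm_eq [seq x * y | y <- S'] S'.
  have uM : uniq [seq x * y | y <- S'] by rewrite map_inj_uniq //; apply: mulfI.
  apply: uniq_perm => //; have sub : {subset [seq x * y | y <- S'] <= S'}.
    move=> z /mapP[y]; rewrite S'P => /andP[y0 yS] ->.
    by rewrite S'P mulf_neq0 // SM.
  by apply: (uniq_min_size uM sub _).2; rewrite size_map.
have P0 : \prod_(y <- S') y != 0.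
  by rewrite prodf_seq_neq0; apply/allP => y; rewrite S'P => /andP[].
apply: (mulIf P0); rewrite mul1r -[RHS](perm_big _ perm) big_map big_split /=.
by rewrite big_const_seq count_predT -Monoid.iteropE size_rem.
Qed.

Lemma expr_size S x : subring_seq S -> x \in S -> x ^+ size S = x.
Proof.
move=> SR xS; have s0 : (0 < size S)%N by case: (S) xS.
rewrite -(prednK s0); have [->|x0] := eqVneq x 0; first by rewrite expr0n.
by rewrite exprS expr_size_pred // mulr1.
Qed.

Lemma size_le_expr S n : uniq S -> (1 < n)%N ->
  (forall x, x \in S -> x ^+ n = x) -> (size S <= n)%N.
Proof.
move=> uS n1 SX; pose P : {poly K} := 'X^n - 'X.
have sP : size P = n.+1.
  by rewrite /P size_polyDl ?size_polyXn // size_polyN size_polyX ltnS.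
have P0 : P != 0 by rewrite -size_poly_eq0 sP.
rewrite -ltnS -sP; apply: max_poly_roots P0 _ uS.
by apply/allP => x xS; rewrite /root !hornerE SX // subrr.
Qed.

(* S is a vector space over the finite field S0, counted one basis vector at a
   time. *)
Lemma size_span S0 S : subring_seq S0 -> uniq S -> sub_closed S ->
  {in S0 & S, forall c x, c * x \in S} ->
  exists f : nat, size S = (size S0 ^ f)%N.
Proof.
move=> R0 uS [S00 SB] SZ; have [u0 S01 S0B S0M] := R0.
have SD x y : x \in S -> y \in S -> x + y \in S.
  by move=> xS yS; rewrite -[y]opprK -[- y]sub0r !SB.
pose Q k T := [/\ uniq T, sub_closed T, {in S0 & T, forall c x, c * x \in T},
  {subset T <= S} & size T = (size S0 ^ k)%N].
have step k T : Q k T -> (exists f : nat, size S = (size S0 ^ f)%N) \/ exists T', Q k.+1 T'.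
  case=> uT [T0 TB] TZ TS sT.
  have [/allP ST|/allPn[y yS yT]] := boolP (all (mem T) S).
    left; exists k; rewrite -sT; apply/eqP.
    by rewrite eqn_leq !uniq_leq_size.
  have TD x z : x \in T -> z \in T -> x + z \in T.
    by move=> xS zS; rewrite -[z]opprK -[- z]sub0r !TB.
  right; exists [seq t + c * y | t <- T, c <- S0]; split.
  - apply: allpairs_uniq => // -[t c] [t' c'] /allpairsP[[a b] /= [aT bS [-> ->]]].
    move=> /allpairsP[[a' b'] /= [aT' bS' [-> ->]]].
    move=> /eqP; rewrite -subr_eq0 opprD addrACA -mulrBl addr_eq0 => /eqP E.
    have [bb|bb] := eqVneq b b'.
      move: E; rewrite bb subrr mul0r oppr0 => /eqP; rewrite subr_eq0.
      by move=> /eqP ->.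
    have cS : b - b' \in S0 by apply: S0B.
    have c0 : b - b' != 0 by rewrite subr_eq0.
    have s0 : (1 < size S0)%N.
      have := uniq_leq_size (s1 := [:: 0; 1]) (s2 := S0); apply.
        by rewrite /= inE eq_sym oner_eq0.
      by move=> z; rewrite !inE => /orP[] /eqP -> //; case: (subring_seq_sub R0).
    have yT' : (y \notin T) := yT.
    have sp : ((size S0).-1 = (size S0).-2.+1)%N by case: (size S0) s0 => [|[]].
    (* The power of exponent |S0| - 2 inverts b - b' inside S0, so y would already lie in T. *)
    have yE : y = (b - b') ^+ (size S0).-2 * ((b - b') * y).
      by rewrite mulrA -exprSr -sp (expr_size_pred R0 cS c0) mul1r.
    case/negP: yT'; rewrite yE TZ //; first exact: subring_seq_expr.
    by rewrite -[_ * y]opprK -E -sub0r TB // TB.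
  - have S0z := (subring_seq_sub R0).1.
    split; first by apply/allpairsP; exists (0, 0); rewrite mul0r addr0.
    move=> x x' /allpairsP[[a b] /= [aT bS ->]] /allpairsP[[a' b'] /= [aT' bS' ->]].
    apply/allpairsP; exists (a - a', b - b'); split; rewrite /= ?TB ?S0B //.
    by rewrite mulrBl opprD addrACA.
  - move=> c x cS /allpairsP[[a b] /= [aT bS ->]].
    apply/allpairsP; exists (c * a, c * b); split; rewrite /= ?TZ ?S0M //.
    by rewrite mulrDr mulrA.
  - move=> x /allpairsP[[a b] /= [aT bS ->]].
    by rewrite SD ?SZ // TS.
  by rewrite size_allpairs sT expnSr.
have Q0 : exists T, Q 0%N T.
  exists [:: 0]; split => //.
  - by split; rewrite ?mem_head // => x y; rewrite !inE => /eqP -> /eqP ->; rewrite subrr.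
  - by move=> c x _; rewrite !inE => /eqP ->; rewrite mulr0.
  - by move=> x; rewrite inE => /eqP ->.
have s0 : (1 < size S0)%N.
  have := uniq_leq_size (s1 := [:: 0; 1]) (s2 := S0); apply.
    by rewrite /= inE eq_sym oner_eq0.
  by move=> z; rewrite !inE => /orP[] /eqP -> //; case: (subring_seq_sub R0).
have lt0 : (size S < size S0 ^ (0 + (size S)))%N by apply: ltn_expl.
suff gen n : forall k, (size S < size S0 ^ (k + n))%N -> (exists T, Q k T) ->
    exists f : nat, size S = (size S0 ^ f)%N by exact: gen lt0 Q0.
elim: n => [|n IH] k lt [T QT].
  have [uT _ _ TS sT] := QT.
  by move: lt; rewrite addn0 -sT ltnNge uniq_leq_size.
by have [//|] := step _ _ QT; apply: IH; rewrite addSnnS.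
Qed.

Lemma prime_subring_seq p : p \in [pchar K] ->
  subring_seq [seq n%:R | n <- iota 0 p].
Proof.
move=> pK; have pp := pcharf_prime pK; have p0 := prime_gt0 pp.
have memP n : n%:R \in [seq n%:R : K | n <- iota 0 p].
  apply/mapP; exists (n %% p)%N; first by rewrite mem_iota ltn_mod.
  by rewrite {1}(divn_eq n p) natrD natrM (pcharf0 pK) mulr0 add0r.
split.
- rewrite map_inj_in_uniq ?iota_uniq // => i j.
  rewrite !mem_iota /= !add0n => ip jp /eqP.
  wlog ij : i j ip jp / (i <= j)%N.
    move=> H; case: (leqP i j) => [/H|/ltnW/H]; first exact.
    by rewrite eq_sym => H' /H' ->.
  rewrite eq_sym -subr_eq0 -natrB // -(dvdn_pcharf pK) => /dvdnP[k jk].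
  case: k jk => [|k] jk; first by apply/eqP; rewrite eqn_leq ij -subn_eq0 jk.
  by move: jk; rewrite mulSn; lia.
- exact: (memP 1%N).
- move=> _ _ /mapP[i _ ->] /mapP[j _ ->].
  have -> : i%:R - j%:R = (i + (p.-1 * j))%:R :> K; last exact: memP.
  rewrite natrD natrM; congr (_ + _); rewrite -mulN1r; congr (_ * _).
  by apply/eqP; rewrite eq_sym -subr_eq0 opprK natr1 prednK // (pcharf0 pK).
move=> _ _ /mapP[i _ ->] /mapP[j _ ->]; rewrite -natrM; exact: memP.
Qed.

Lemma finite_of_roots (P : {poly K}) : P != 0 -> (forall x, root P x) ->
  exists S : seq K, uniq S /\ forall x, x \in S.
Proof.
move=> P0 rP; apply: contrapT => nex.
have [S [uS sS]] : exists S : seq K, uniq S /\ size S = size P.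
  elim: (size P) => [|n [S [uS <-]]]; first by exists [::].
  have [x xS] : exists x, x \notin S.
    apply: contrapT => h; apply: nex; exists S; split=> // x.
    by apply/negPn/negP => xS; apply: h; exists x.
  by exists (x :: S); rewrite /= xS.
have := max_poly_roots P0 (_ : all (root P) S) uS.
by rewrite sS ltnn => /(_ (introT allP (fun x _ => rP x))).
Qed.

End FiniteSubrings.

(** Every residue is a root of the reduction of a product of factors X - act i a, which is monic of
    degree #|I| with coefficients among 0, ..., p-1. There are finitely many such polynomials, and K
    consists of roots of their product. *)
Lemma finite_residue_ring (A : comNzRingType) (I : finType)
    (act : I -> {rmorphism A -> A}) (i1 : I) (mul : I -> I -> I)
    (K : idomainType) (pi : {rmorphism A -> K}) (p : nat) :
  (forall a, act i1 a = a) -> (forall i, injective (mul i)) ->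
  (forall i j a, act i (act j a) = act (mul i j) a) ->
  (forall a, (forall i, act i a = a) -> exists n : int, a = n%:~R) ->
  (forall y, exists a, pi a = y) -> p \in [pchar K] ->
  exists S : seq K, uniq S /\ forall y, y \in S.
Proof.
move=> act1 mulI actM fixZ surj pK; have pp := pcharf_prime pK.
pose d := #|I|.
pose G (f : {ffun 'I_d -> 'I_p.-1.+1}) : {poly K} :=
  'X^d + \poly_(i < d) (if insub i is Some j then (f j)%:R else 0).
have G0 f : G f != 0.
  rewrite -size_poly_eq0 size_polyDl ?size_polyXn //.
  by rewrite ltnS size_poly.
apply: (finite_of_roots (P := \prod_f G f)) => [|y].
  by apply/prodf_neq0 => f _.
have [a <-] := surj y.
pose N : {poly A} := \prod_i ('X - (act i a)%:P).
have NF i : map_poly (act i) N = N.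
  apply: (prod_act_fixed mulI (u := fun i => map_poly (act i))) => {}i j /=.
  by rewrite rmorphB /= map_polyX map_polyC /= actM.
have Nm : N \is monic by apply: monic_prod_XsubC.
have Nsz : size N = d.+1.
  by rewrite /N -big_enum size_prod_XsubC -cardE.
have /choice[z zE] k : exists n : int, N`_k = n%:~R.
  by apply: fixZ => i; rewrite -coef_map NF.
pose f : {ffun 'I_d -> 'I_p.-1.+1} := [ffun i : 'I_d => inord `|(z i %% p)%Z|].
have fE (i : 'I_d) : (f i)%:R = pi N`_i.
  rewrite ffunE inordK; last first.
    by rewrite prednK ?prime_gt0 // -ltz_nat gez0_abs ?modz_ge0 ?ltz_pmod //
      ?ltz_nat ?prime_gt0 // -lt0n prime_gt0.
  rewrite zE rmorph_int {2}(divz_eq (z i) p) intrD intrM.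
  rewrite -[(Posz p)%:~R]/(p%:R) (pcharf0 pK) mulr0 add0r.
  by rewrite pmulrn gez0_abs // modz_ge0 // -lt0n prime_gt0.
have GN : G f = map_poly pi N.
  apply/polyP => k; rewrite coefD coefXn coef_poly coef_map /=.
  have [kd|dk] := ltnP k d.
    by rewrite insubT fE (ltn_eqF kd) add0r.
  case: eqVneq => [->|kd].
    by rewrite addr0 -[d]/(d.+1.-1) -Nsz -lead_coefE (monicP Nm) rmorph1.
  by rewrite addr0 nth_default ?rmorph0 // Nsz ltn_neqAle eq_sym kd.
rewrite (bigD1 f) //= rootM GN; apply/orP; left; apply: rmorph_root.
by rewrite /root /N (bigD1 i1) //= hornerM act1 hornerXsubC subrr mul0r.
Qed.

(** * Prime ideals and Frobenius elements *)

Section IntegerRing.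

Variables (E : splittingFieldType rat) (L : {subfield E}).

Definition integer_pred : pred E := fun x => `[< integers L x >].

Lemma integer_subring_closed : subring_closed integer_pred.
Proof.
split; rewrite /integer_pred.
- by apply/asboolP; split; [exact: mem1v | exact: integral1].
- move=> x y /asboolP[xL xI] /asboolP[yL yI]; apply/asboolP.
  by split; [exact: rpredB | exact: integral_sub].
move=> x y /asboolP[xL xI] /asboolP[yL yI]; apply/asboolP.
by split; [exact: rpredM | exact: integral_mul].
Qed.

HB.instance Definition _ :=
  GRing.isSubringClosed.Build E integer_pred integer_subring_closed.

Record oint := OInt { oval : E; ovalP : oval \in integer_pred }.

HB.instance Definition _ := [isSub for oval].
HB.instance Definition _ := [Choice of oint by <:].
HB.instance Definition _ := [SubChoice_isSubComNzRing of oint by <:].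

Lemma oint_integers (x : oint) : integers L (oval x).
Proof. by apply/asboolP; exact: ovalP. Qed.

Definition oint_of (x : E) (xL : integers L x) : oint := OInt (asboolT xL).

Lemma integral_gal (K : {subfield E}) (s : gal_of K) (x : E) : x \in K ->
  integralOver (intr : int -> E) x -> integralOver (intr : int -> E) (s x).
Proof.
move=> xK [p pm px]; exists p => //.
have -> : map_poly (intr : int -> E) p = map_poly s (map_poly intr p).
  by apply/polyP => i; rewrite !coef_map /= rmorph_int.
exact: rmorph_root.
Qed.

Lemma integers_gal (s : gal_of L) (x : E) : integers L x -> integers L (s x).
Proof. by case=> xL xI; split; [exact: memv_gal | exact: integral_gal]. Qed.

Definition oint_gal (s : gal_of L) (x : oint) : oint :=
  oint_of (integers_gal s (oint_integers x)).

Lemma oint_gal_zmod_morphism s : zmod_morphism (oint_gal s).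
Proof. by move=> x y; apply: val_inj; rewrite /= !rmorphB. Qed.

Lemma oint_gal_monoid_morphism s : monoid_morphism (oint_gal s).
Proof.
by split=> [|x y]; apply: val_inj; rewrite /= ?rmorph1 ?rmorphM.
Qed.

HB.instance Definition _ s :=
  GRing.isZmodMorphism.Build oint oint (oint_gal s) (oint_gal_zmod_morphism s).
HB.instance Definition _ s :=
  GRing.isMonoidMorphism.Build oint oint (oint_gal s) (oint_gal_monoid_morphism s).

Lemma oval_natr n : oval n%:R = n%:R.
Proof. exact: (rmorph_nat (val : {rmorphism oint -> E})). Qed.

Lemma oval_expr x n : oval (x ^+ n) = oval x ^+ n.
Proof. exact: (rmorphXn (val : {rmorphism oint -> E})). Qed.

Lemma integers_subfield (K : {subfield E}) x : (K <= L)%VS -> integers K x -> integers L x.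
Proof. by move=> KL [xK xI]; split=> //; apply: subvP KL _ xK. Qed.

End IntegerRing.

Arguments oint_of {E L x}.

(* Alias of a quotient ring, made into an idomainType by a classical choice of
   inverses. *)
Definition domain_of (Q : comNzRingType)
  of (forall x y : Q, x * y = 0 -> (x == 0) || (y == 0)) : Type := Q.

Section ResidueRing.

Variable (Q : comNzRingType).
Hypothesis Qdom : forall x y : Q, x * y = 0 -> (x == 0) || (y == 0).

Local Notation D := (domain_of Qdom).

HB.instance Definition _ := GRing.ComNzRing.on D.

Definition domain_unit : pred D := fun x => `[< exists y, y * x = 1 >].
Definition domain_inv (x : D) : D :=
  xget x [set y | y * x = 1].

Lemma domain_mulVr : {in domain_unit, left_inverse 1 domain_inv *%R}.
Proof.
move=> x; rewrite unfold_in => /asboolP[y yx]; rewrite /domain_inv.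
by case: xgetP => [z -> //|/(_ y)].
Qed.

Lemma domain_unitP (x y : D) : y * x = 1 -> domain_unit x.
Proof. by move=> yx; apply/asboolP; exists y. Qed.

Lemma domain_invr_out : {in [predC domain_unit], domain_inv =1 id}.
Proof.
move=> x; rewrite inE /= => xU; rewrite /domain_inv.
by case: xgetP => // y _ yx; case/negP: xU; exact: domain_unitP yx.
Qed.

HB.instance Definition _ := GRing.ComNzRing_hasMulInverse.Build D
  domain_mulVr domain_unitP domain_invr_out.
HB.instance Definition _ := GRing.ComUnitRing_isIntegral.Build D Qdom.

Definition to_domain (x : Q) : D := x.

Lemma to_domain_zmod_morphism : zmod_morphism to_domain.
Proof. by []. Qed.

Lemma to_domain_monoid_morphism : monoid_morphism to_domain.
Proof. by []. Qed.

HB.instance Definition _ :=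
  GRing.isZmodMorphism.Build Q D to_domain to_domain_zmod_morphism.
HB.instance Definition _ :=
  GRing.isMonoidMorphism.Build Q D to_domain to_domain_monoid_morphism.

End ResidueRing.

(** The primality proof is an argument, so that the instances of ideal and prime ideal can be
    attached to this predicate. *)
Definition ideal_pred (E : splittingFieldType rat) (L : {subfield E}) (P : set E)
    of is_nonzero_prime L P : pred (oint L) :=
  fun x => `[< P (oval x) >].

Section PrimeQuotient.

Variables (E : splittingFieldType rat) (L : {subfield E}) (P : set E).
Hypothesis primeP : is_nonzero_prime L P.
Local Notation I := (ideal_pred primeP).

Lemma ideal_pred_idealr : idealr_closed I.
Proof.
have [PL [P0 _] Plin P1 _] := primeP; split.
- exact/asboolP.
- by apply/negP => /asboolP.
move=> a u v /asboolP uP /asboolP vP; apply/asboolP => /=.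
by apply: Plin => //; exact: oint_integers.
Qed.

Lemma ideal_pred_prime : prime_idealr_closed I.
Proof.
have [PL [P0 _] Plin P1 PM] := primeP; move=> u v /asboolP /= uvP; apply/orP.
by have [] := PM _ _ (oint_integers u) (oint_integers v) uvP;
  [left|right]; exact/asboolP.
Qed.

HB.instance Definition _ := isIdealr.Build (oint L) I ideal_pred_idealr.
HB.instance Definition _ := isPrimeIdealrClosed.Build (oint L) I ideal_pred_prime.

Lemma residue_ring_exists :
  exists (K : idomainType) (pi : {rmorphism oint L -> K}),
    (forall x, pi x = 0 <-> P (oval x)) /\ (forall y, exists x, pi x = y).
Proof.
pose J : prime_idealr (oint L) := I.
pose Q := {ideal_quot J}.
pose f : {rmorphism oint L -> domain_of (@Quotient.rquot_IdomainAxiom (oint L) J)} :=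
  (@to_domain Q (@Quotient.rquot_IdomainAxiom (oint L) J)) \o (\pi_Q)%qT.
exists (domain_of (@Quotient.rquot_IdomainAxiom (oint L) J)), f; split => [x|y].
  have -> : P (oval x) <-> (x \in J) by split=> /asboolP.
  by rewrite -[x in x \in J]subr0 Quotient.idealrBE rmorph0; split => /eqP.
by exists (generic_quotient.repr (y : {ideal_quot J})); rewrite /f /= /to_domain reprK.
Qed.

End PrimeQuotient.

Lemma rat_integral_int (E : splittingFieldType rat) (x : E) : x \in 1%VS ->
  integralOver (intr : int -> E) x -> exists n : int, x = n%:~R.
Proof.
move=> /vlineP[a ->] [p pm rp].
have pa : root (map_poly (intr : int -> rat) p) a.
  rewrite -(fmorph_root (in_alg E)) -map_poly_comp.
  rewrite (eq_map_poly (g := (intr : int -> E))) // => z /=.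
  by rewrite scaler_int.
have aA : ratr a \in Aint.
  apply: (@root_monic_Aint (map_poly (intr : int -> algC) p)).
  - have -> : map_poly (intr : int -> algC) p = map_poly ratr (map_poly (intr : int -> rat) p).
      by rewrite -map_poly_comp; apply: eq_map_poly => z /=; rewrite ratr_int.
    by rewrite fmorph_root.
  - exact: monic_map.
  by apply/polyOverP => i; rewrite coef_map intr_int.
have /intrP[n an] := Cint_rat_Aint (Crat_rat a) aA.
exists n; have -> : a = n%:~R.
  by apply: (fmorph_inj (ratr : {rmorphism rat -> algC})); rewrite /= an ratr_int.
by rewrite scaler_int.
Qed.

Section ResidueFields.

Variables (E : splittingFieldType rat) (L : {subfield E}).
Hypothesis galL : galois 1 L.

Lemma mem_fixed_gal (K : {subfield E}) x : (K <= L)%VS -> x \in L ->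
  (forall s, s \in 'Gal(L / K)%g -> s x = x) -> x \in K.
Proof.
move=> KL xL fx; have galK : galois K L by apply: galoisS galL; rewrite sub1v.
by rewrite -(galois_fixedField galK); apply/fixedFieldP.
Qed.

Lemma sub_gal_fixed (K : {subfield E}) x s : (K <= L)%VS -> x \in K ->
  s \in 'Gal(L / K)%g -> s x = x.
Proof. by move=> KL xK sG; apply: fixed_gal KL sG xK. Qed.

Lemma prime_natM (K : {subfield E}) (p : set E) (n : nat) :
  is_nonzero_prime K p -> (0 < n)%N -> p n%:R -> exists l, prime l /\ p l%:R.
Proof.
case=> pK _ plin p1 pM; elim/ltn_ind: n => n IH n0 pn.
have [n1|n1] := leqP n 1.
  by case: p1; move: pn; rewrite (_ : n = 1%N) //; lia.
have pp := pdiv_prime n1.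
have nI i : integers K i%:R by split; [exact: rpred_nat | exact: integral_nat].
move: pn; rewrite {1}(divn_eq n (pdiv n)) (eqP (pdiv_dvd n)) addn0 natrM.
case/pM => //; last by exists (pdiv n).
move=> pd; apply: (IH (n %/ pdiv n)%N) => //.
- by rewrite ltn_Pdiv // prime_gt1.
by rewrite divn_gt0 ?prime_gt0 // dvdn_leq // pdiv_dvd.
Qed.

(** The norm to Q of a nonzero x in p is a nonzero integer. It lies in p because its cofactor, a
    product of conjugates of x and so integral, is also the quotient of the norm by x and so in
    K. *)
Lemma prime_over_rational (K : {subfield E}) (p : set E) : (K <= L)%VS ->
  is_nonzero_prime K p -> exists l, prime l /\ p l%:R.
Proof.
move=> KL pp; have [pK [p0 [x px x0]] plin p1 pM] := pp.
have [xK xI] := pK _ px.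
have xL := subvP KL _ xK.
pose c := \prod_(s in 'Gal(L / 1)%g :\ 1%g) (s : gal_of L) x.
have NE : galNorm 1 L x = x * c.
  by rewrite /galNorm (big_setD1 1%g) ?group1 //= gal_id.
have cI : integralOver (intr : int -> E) c.
  apply: (big_ind (fun y => integralOver (intr : int -> E) y)).
  - exact: integral1.
  - by move=> *; apply: integral_mul.
  - by move=> s _; apply: integral_gal xI.
have N1 := mem_galNorm galL xL.
have cK : c \in K.
  have -> : c = galNorm 1 L x / x by rewrite NE mulrAC divff ?mul1r.
  by rewrite rpredM ?rpredV // (subvP (sub1v K)).
have [n nE] : exists n : int, galNorm 1 L x = n%:~R.
  by apply: rat_integral_int N1 _; rewrite NE; apply: integral_mul.
have pN : p n%:~R.
  rewrite -nE NE mulrC -[_ * _]addr0; apply: plin => //; by split.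
apply: (prime_natM (n := `|n|) pp).
  rewrite absz_gt0; apply/eqP => n0; move/eqP: nE.
  by rewrite n0 galNorm_eq0 (negPf x0).
move: pN; case: (intP n) => [|i|i]; rewrite ?abszN //= => pN.
have := plin (-1) _ 0 _ pN p0; rewrite addr0 mulN1r rmorphN opprK; apply.
by split; [rewrite rpredN rpred1 | apply/integral_opp/integral1].
Qed.

End ResidueFields.

(** * Conjugacy of primes, Frobenius lifts and lying over *)

Section GaloisOnIntegers.

Local Open Scope classical_set_scope.

Variables (E : splittingFieldType rat) (L : {subfield E}).
Hypothesis galL : galois 1 L.

Section Action.

Variable K : {subfield E}.
Hypothesis KL : (K <= L)%VS.

Let I := subg_of 'Gal(L / K).
Let act (i : I) : {rmorphism oint L -> oint L} := oint_gal (sgval i).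
(** The factors are reversed because the product of [gal_of L] composes from left to right. *)
Let mul (i j : I) : I := (j * i)%g.

Let act1 x : act 1%g x = x.
Proof. by apply: val_inj; rewrite /= gal_id. Qed.

Let mulI i : injective (mul i).
Proof. exact: mulIg. Qed.

Let actM i j x : act i (act j x) = act (mul i j) x.
Proof. by apply: val_inj; rewrite /= galM //; case: (oint_integers x). Qed.

Let act_fixed x : (forall i, act i x = x) -> oval x \in K.
Proof.
move=> fx; apply: (mem_fixed_gal galL KL); first by case: (oint_integers x).
by move=> s sG; have := congr1 val (fx (subg _ s)); rewrite /= subgK.
Qed.

Lemma reduction_transitive (k k' : idomainType) (pi : {rmorphism oint L -> k})
    (pi' : {rmorphism oint L -> k'}) :
  (forall x, oval x \in K -> pi' x = 0 -> pi x = 0) ->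
  exists2 s, s \in 'Gal(L / K)%g & forall x, pi' x = 0 -> pi (oint_gal s x) = 0.
Proof.
move=> h; have [|i iP] := conjugate_transitive act1 mulI actM (pi := pi) (pi' := pi').
  by move=> x /act_fixed; exact: h.
by exists (sgval i); rewrite ?subgP.
Qed.

Lemma reduction_frobenius (k : idomainType) (pi : {rmorphism oint L -> k}) (l e : nat) :
  l \in [pchar k] ->
  (forall x, oval x \in K -> pi x ^+ (l ^ e) = pi x) ->
  exists2 s, s \in 'Gal(L / K)%g & forall x, pi (oint_gal s x) = pi x ^+ (l ^ e).
Proof.
move=> lk h; have [|i iP] := conjugate_frobenius act1 mulI actM lk (e := e) (pi := pi).
  by move=> x /act_fixed; exact: h.
by exists (sgval i); rewrite ?subgP.
Qed.

(** Let Q(X) be the product of the s - act_j(x) X; its coefficients are integers of K. One factor of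
    Q(a) is i, so Q(a) lies in J and in K, hence in p. As Q(a) - Q(0) is a multiple of a, the power
    Q(0) = s^n lies in p too. *)
Let lying_over_aux (J p : set E) : is_nonzero_prime K p ->
  (forall x, J x -> x \in K -> p x) ->
  (forall a u, integers L a -> J u -> J (a * u)) ->
  forall a x i s, p a -> integers L x -> J i -> integers K s ->
    s = i + a * x -> p s.
Proof.
move=> [pK [p0 _] plin p1 pM] Jp JM a x i s pa xL Ji sK sE.
pose a' := oint_of (integers_subfield KL (pK _ pa)).
pose s' := oint_of (integers_subfield KL sK).
pose x' := oint_of xL.
pose Q : {poly oint L} := \prod_j (s'%:P - act j x' *: 'X).
have fixK j (y : oint L) : oval y \in K -> act j y = y.
  move=> yK; apply: val_inj; apply: sub_gal_fixed KL yK _; exact: subgP.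
have QF j : map_poly (act j) Q = Q.
  apply: (prod_act_fixed mulI (u := fun j => map_poly (act j))) => {}j j' /=.
  by rewrite rmorphB /= map_polyC map_polyZ /= map_polyX fixK ?actM //; exact: sK.1.
have QK n : integers K (oval Q`_n).
  split; last by case: (oint_integers Q`_n).
  by apply: act_fixed => j; rewrite -coef_map QF.
have aK := (pK _ pa).1.
have NE : oval Q.[a'] = oval (\prod_j (s' - act j x' * a')).
  rewrite /Q horner_prod; congr oval; apply: eq_bigr => j _.
  by rewrite hornerD hornerN hornerC hornerZ hornerX.
have pN : p (oval Q.[a']).
  apply: (Jp); last first.
    apply: act_fixed => j; rewrite -[in RHS](QF j) -horner_map /= fixK //.
  rewrite NE (bigD1 1%g) // [X in oval X]mulrC; apply: (JM (oval _)); first exact: oint_integers.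
  have -> : val (s' - act 1%g x' * a') = i by rewrite act1 /= sE mulrC addrK.
  by [].
pose n := #|I|.
have Q0 : oval Q`_0 = s ^+ n.
  rewrite -horner_coef0 /Q horner_prod.
  have -> : s ^+ n = oval (s' ^+ n) by rewrite oval_expr.
  congr oval; rewrite -[RHS]prodr_const; apply: eq_bigr => j _.
  by rewrite hornerD hornerN hornerC hornerZ hornerX mulr0 subr0.
have pS : p (s ^+ n).
  have -> : s ^+ n = -1 * (oval (Q.[a'] - (Q`_0)%:P.[a'])) + oval Q.[a'].
    by rewrite hornerC -[oval (_ - _)]/(oval _ - oval _) Q0 mulN1r opprB subrK.
  apply: (plin) => //; first by split; [rewrite rpredN rpred1 | apply/integral_opp/integral1].
  have -> : Q.[a'] - (Q`_0)%:P.[a'] = (Q - (Q`_0)%:P).[a'] by rewrite hornerD hornerN.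
  rewrite horner_coef -[oval _]/(val _) raddf_sum /=.
  apply: (big_ind p) => // [u v pu pv|j _].
    by rewrite -[u]mul1r; apply: (plin) => //; split; [exact: mem1v|exact: integral1].
  rewrite coefB coefC; case: eqP => [->|/eqP j0].
    by rewrite subrr mul0r.
  rewrite subr0 /= -(prednK (_ : 0 < j)%N) ?lt0n // exprSr mulrA -[X in p X]addr0.
  apply: (plin) => //; split; last by case: (oint_integers (Q`_j.-1.+1 * a' ^+ j.-1)).
  rewrite rpredM //; first by case: (QK j.-1.+1).
  by rewrite -[\val _]/(oval _) oval_expr rpredX.
elim: (n) pS => [|j IH]; first by rewrite expr0.
have sX i' : integers K (s ^+ i').
  split; first by rewrite rpredX // sK.1.
  elim: i' => [|i' IHi]; first exact: integral1.
  by rewrite exprS; apply: integral_mul IHi; exact: sK.2.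
by rewrite exprS => /(pM _ _ sK (sX j))[].
Qed.

(** Take J maximal among the ideals meeting K inside p. The auxiliary result shows that J contains
    p. If u and v are outside J, the ideals J + (u) and J + (v) meet K outside p, in s and t; were
    uv in J, then st would lie in p. *)
Lemma reduction_lying_over (p : set E) : is_nonzero_prime K p ->
  exists P, is_prime_above K L p P.
Proof.
move=> pp; have [pK [p0 [x0 px0 x00]] plin p1 pM] := pp.
(* Membership of 0 is not part of [good], since the empty chain has an empty union; it follows from
   maximality below. *)
pose good (J : set E) := [/\ (J `<=` integers L),
  (forall a u v, integers L a -> J u -> J v -> J (a * u + v)) &
  (forall x, J x -> x \in K -> p x)].
have [|J [gJ maxJ]] := @Zorn_bigcup E good.
  move=> F Fgood tot; split.
  - by move=> x [X FX Xx]; case: (Fgood _ FX) => XL _ _; exact: XL.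
  - move=> a u v aL [X FX Xu] [Y FY Yv].
    by have [XY|YX] := tot _ _ FX FY; [exists Y | exists X] => //;
      case: (Fgood _ FX) => _ X2 _; case: (Fgood _ FY) => _ Y2 _;
      [apply: Y2 => //; exact: XY | apply: X2 => //; exact: YX].
  by move=> x [X FX Xx]; case: (Fgood _ FX) => _ _; exact.
have [JL Jlin Jp] := gJ.
have N1L : integers L (-1).
  by split; [rewrite rpredN mem1v | apply/integral_opp/integral1].
have I1 : integers L 1 by split; [exact: mem1v|exact: integral1].
have I0 : integers L 0 by split; [exact: mem0v | exact: mxpoly.integral0].
have J0 : J 0.
  have [u Ju] : exists u, J u.
    apply: contrapT => nJ; apply: (maxJ [set 0]); last first.
      split; first by move=> x ->.
        by move=> a u v _ -> ->; rewrite mulr0 addr0.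
      by move=> x -> _.
    split; first by move=> x Jx; case: nJ; exists x.
    by move=> /(_ 0 erefl) J0; apply: nJ; exists 0.
  by have := Jlin (-1) u u N1L Ju Ju; rewrite mulN1r addNr.
have JM a u : integers L a -> J u -> J (a * u).
  by move=> aL Ju; rewrite -[_ * _]addr0; apply: (Jlin).
pose adj a := [set y | exists i x, [/\ J i, integers L x & y = i + a * x]].
have adjJ a : J `<=` adj a.
  move=> y Jy; exists y, 0; split=> //; last by rewrite mulr0 addr0.
have adja a : adj a a by exists 0, 1; split; rewrite ?mulr1 ?add0r.
have adj_good a : integers L a -> (forall x, adj a x -> x \in K -> p x) -> J a.
  move=> aL adjp; apply: contrapT => nJa; apply: (maxJ (adj a)); last first.
    split=> //.
    - move=> y [i [x [Ji xL ->]]]; have [iL iI] := JL _ Ji.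
      have [aL' aI] := aL; have [xL' xI] := xL.
      by split; [rewrite rpredD ?rpredM | apply: integral_add => //; apply: integral_mul].
    - move=> b u v bL [i [x [Ji xL ->]]] [i' [x' [Ji' xL' ->]]].
      exists (b * i + i'), (b * x + x'); split; first exact: Jlin.
        have [bL1 bI] := bL; have [xL1 xI] := xL; have [xL1' xI'] := xL'.
        by split; [rewrite rpredD ?rpredM | apply: integral_add => //; apply: integral_mul].
      by ring.
  split; first exact: adjJ.
  by move/(_ a (adja a)).
have pJ : p `<=` J.
  move=> a pa; apply: (adj_good); first by apply: integers_subfield KL (pK _ pa).
  move=> y [i [x [Ji xL yE]]] yK.
  apply: (lying_over_aux pp Jp JM pa xL Ji _ yE); split=> //.
  rewrite yE; apply: integral_add; first by case: (JL _ Ji).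
  by apply: integral_mul; [case: (pK _ pa) | case: xL].
exists J; split.
  split=> //; first by split=> //; exists x0 => //; exact: pJ.
  - by move=> /Jp /(_ (mem1v _)).
  move=> u v uL vL Juv; apply: contrapT => /not_orP[nu nv].
  have sep a : integers L a -> ~ J a -> exists s, [/\ adj a s, s \in K & ~ p s].
    move=> aL nJ; apply: contrapT => h; apply: nJ; apply: (adj_good) => // x ax xK.
    by apply: contrapT => npx; apply: h; exists x.
  have [s [su sK nps]] := sep _ uL nu.
  have [t [tv tK npt]] := sep _ vL nv.
  have adjI a y : integers L a -> adj a y -> integralOver (intr : int -> E) y.
    move=> [_ aI] [i [x [Ji [_ xI] ->]]]; apply: integral_add; first by case: (JL _ Ji).
    exact: integral_mul.
  have : p (s * t).
    apply: (Jp); last by rewrite rpredM.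
    case: su => i [x [Ji xL ->]]; case: tv => j [y [Jj yL ->]].
    have xyL : integers L (x * y).
      by case: xL yL => xL xI [yL yI]; split; [rewrite rpredM|apply: integral_mul].
    have -> : (i + u * x) * (j + v * y) =
      j * i + (u * x * j + (v * y * i + x * y * (u * v))) by ring.
    have IM a b : integers L a -> integers L b -> integers L (a * b).
      by move=> [aL aI] [bL bI]; split; [rewrite rpredM|apply: integral_mul].
    apply: (Jlin _ _ _ (JL _ Jj) Ji); apply: (Jlin _ _ _ (IM _ _ uL xL) Jj).
    by apply: (Jlin _ _ _ (IM _ _ vL yL) Ji); apply: (JM).
  by move=> /pM[] //; split=> //; [exact: adjI su|exact: adjI tv].
apply/seteqP; split=> [x [Jx [xK _]]|x px]; first exact: Jp.
by split; [exact: pJ | exact: pK].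
Qed.

End Action.
End GaloisOnIntegers.

Section PrimesOfL.

Local Open Scope classical_set_scope.

Variables (E : splittingFieldType rat) (L : {subfield E}).
Hypothesis galL : galois 1 L.

Definition is_reduction (P : set E) (k : idomainType) (pi : {rmorphism oint L -> k}) :=
  (forall x, pi x = 0 <-> P (oval x)) /\ (forall y, exists x, pi x = y).

Lemma reduction_eqP P (k : idomainType) (pi : {rmorphism oint L -> k}) : is_reduction P pi ->
  forall x y, pi x = pi y <-> P (oval x - oval y).
Proof.
move=> [piP _] x y; rewrite -[oval x - _]/(oval (x - y)) -piP rmorphB.
by split=> [->|/eqP]; rewrite ?subrr // subr_eq0 => /eqP.
Qed.

Lemma reduction_exists P : is_nonzero_prime L P ->
  exists (k : idomainType) (pi : {rmorphism oint L -> k}), is_reduction P pi.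
Proof.
by move=> /residue_ring_exists[k [pi [h1 h2]]]; exists k, pi.
Qed.

Lemma reduction_pchar P (k : idomainType) (pi : {rmorphism oint L -> k}) l : is_reduction P pi ->
  prime l -> P l%:R -> l \in [pchar k].
Proof.
move=> [piP _] pl Pl; rewrite inE pl /= -(rmorph_nat pi); apply/eqP/piP.
by rewrite oval_natr.
Qed.

Lemma oint_rational_int (x : oint L) : oval x \in 1%VS -> exists n : int, x = n%:~R.
Proof.
move=> x1; have [n xn] := rat_integral_int x1 (oint_integers x).2.
by exists n; apply: val_inj; rewrite /= xn -[RHS]/(val _) rmorph_int.
Qed.

Lemma reduction_finite P (k : idomainType) (pi : {rmorphism oint L -> k}) :
  is_nonzero_prime L P -> is_reduction P pi ->
  exists S : seq k, uniq S /\ forall y, y \in S.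
Proof.
move=> pP red; have [l [pl Pl]] := prime_over_rational galL (subvv L) pP.
have lk := reduction_pchar red pl Pl.
apply: (@finite_residue_ring _ (gal_of L) (fun s => oint_gal s) 1%g
  (fun s t => (t * s)%g) _ pi l) => //.
- by move=> a; apply: val_inj; rewrite /= gal_id.
- by move=> s; apply: mulIg.
- by move=> s t a; apply: val_inj; rewrite /= galM //; case: (oint_integers a).
- move=> a fa; apply: oint_rational_int.
  have aL : oval a \in L by case: (oint_integers a).
  apply: (mem_fixed_gal galL (sub1v L) aL) => s _.
  exact: (congr1 val (fa s)).
exact: red.2.
Qed.

Section ImageOfSubfield.

Variables (P : set E) (k : idomainType) (pi : {rmorphism oint L -> k}).
Hypotheses (pP : is_nonzero_prime L P) (red : is_reduction P pi).

Definition image_seq (K : {subfield E}) (S : seq k) :=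
  forall y, (y \in S) <-> exists2 x, oval x \in K & pi x = y.

Lemma subfield_image (K : {subfield E}) :
  exists S, subring_seq S /\ image_seq K S.
Proof.
have [S [uS SA]] := reduction_finite pP red.
pose T := [seq y <- S | `[< exists2 x, oval x \in K & pi x = y >]].
have TP : image_seq K T.
  move=> y; rewrite mem_filter SA andbT; split=> [/asboolP//|h].
  exact/asboolP.
exists T; split=> //; split.
- exact: filter_uniq.
- by apply/TP; exists 1; rewrite ?rmorph1 ?mem1v.
- move=> y y' /TP[x xK <-] /TP[x' x'K <-]; apply/TP; exists (x - x').
    by rewrite rpredB.
  by rewrite rmorphB.
move=> y y' /TP[x xK <-] /TP[x' x'K <-]; apply/TP; exists (x * x').
  by rewrite rpredM.
by rewrite rmorphM.
Qed.

(** The cosets counted by [ideal_norm] are the residues of K inside k, so norms become sizes of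
    finite subrings, where [expr_size] applies. *)
Lemma size_image_norm (K : {subfield E}) S : (K <= L)%VS -> uniq S ->
  image_seq K S -> ideal_norm K (P `&` integers K) = size S.
Proof.
move=> KL uS SP; rewrite /ideal_norm; apply: card_fset_set.
pose g y := [set t : E | integers K t /\ exists2 x : oint L, oval x = t & pi x = y].
pose f i := g (nth 0 S i).
have -> : ideal_coset K (P `&` integers K) @` integers K = f @` `I_(size S).
  apply/seteqP; split=> [_ [x xK <-]|_ [i iS <-]].
    pose x' := oint_of (integers_subfield KL xK).
    have xS : pi x' \in S by apply/SP; exists x' => //; exact: xK.1.
    exists (index (pi x') S); first by rewrite /= index_mem.
    rewrite /f nth_index //; apply/seteqP; split=> y /=.
      move=> [yK [y' yy' y'x]]; split=> //; split; last first.
        split; first by rewrite rpredB ?yK.1 ?xK.1.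
        exact: integral_sub yK.2 xK.2.
      by rewrite -yy'; apply/(reduction_eqP red y' x').
    move=> [yK [Pyx _]]; split=> //.
    exists (oint_of (integers_subfield KL yK)) => //.
    exact/(reduction_eqP red).
  have /SP[x xK xi] := mem_nth 0 iS.
  have xK' : integers K (oval x) by split; [| exact: (oint_integers x).2].
  exists (oval x) => //; rewrite /f -xi; apply/seteqP; split=> y /=.
    move=> [yK [Pyx _]]; split=> //.
    exists (oint_of (integers_subfield KL yK)) => //.
    exact/(reduction_eqP red).
  move=> [yK [y' yy' y'x]]; split=> //; split; last first.
    split; first by rewrite rpredB ?yK.1.
    exact: integral_sub yK.2 xK'.2.
  by rewrite -yy'; apply/(reduction_eqP red y' x).
apply: inj_card_eq => i j /set_mem /= iS /set_mem /= jS fij.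
have /SP[x xK xi] := mem_nth 0 iS.
have : f i (oval x).
  by split; [split => //; exact: (oint_integers x).2 | exists x].
rewrite fij => -[_ [x' /val_inj -> x'j]].
by apply/eqP; rewrite -(nth_uniq 0 _ _ uS) // -xi x'j.
Qed.

Lemma size_subring_gt1 (S : seq k) : subring_seq S -> (1 < size S)%N.
Proof.
move=> SR; have := uniq_leq_size (s1 := [:: 0; 1]) (s2 := S); apply.
  by rewrite /= inE eq_sym oner_eq0.
by move=> z; rewrite !inE => /orP[] /eqP -> //; [case: (subring_seq_sub SR)|case: SR].
Qed.

Lemma size_image_power (S0 S : seq k) : subring_seq S0 -> subring_seq S ->
  {subset S0 <= S} -> exists2 f, (0 < f)%N & size S = (size S0 ^ f)%N.
Proof.
move=> R0 R SS; have [uS _ _ SM] := R.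
have [|f fE] := size_span R0 uS (subring_seq_sub R).
  by move=> c x /SS cS xS; exact: SM.
exists f => //; case: f fE => // fE.
by have := size_subring_gt1 R; rewrite fE expn0.
Qed.

Lemma norm_power_pchar (K : {subfield E}) l : (K <= L)%VS -> prime l -> P l%:R ->
  exists2 e, (0 < e)%N & ideal_norm K (P `&` integers K) = (l ^ e)%N.
Proof.
move=> KL pl Pl; have [S [RS SP]] := subfield_image K; have [uS _ _ _] := RS.
have lk := reduction_pchar red pl Pl.
have [|e e0 eE] := size_image_power (prime_subring_seq lk) RS.
  move=> _ /mapP[n _ ->]; apply/SP; exists n%:R; rewrite ?rmorph_nat //.
  by rewrite oval_natr rpred_nat.
by exists e; rewrite // (size_image_norm KL uS SP) eE size_map size_iota.
Qed.

End ImageOfSubfield.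

Lemma prime_below (K : {subfield E}) P : (K <= L)%VS -> is_nonzero_prime L P ->
  is_nonzero_prime K (P `&` integers K).
Proof.
move=> KL pP; have [l [pl Pl]] := prime_over_rational galL (subvv L) pP.
have [PL [P0 _] Plin P1 PM] := pP.
have KI0 : integers K 0 by split; [exact: mem0v | exact: mxpoly.integral0].
split.
- by move=> x [].
- split=> //; exists l%:R.
    by split=> //; split; [exact: rpred_nat | exact: integral_nat].
  apply/eqP => l0; have : (l%:R : rat) *: (1 : E) == 0 by rewrite scaler_nat l0.
  by rewrite scaler_eq0 oner_eq0 orbF pnatr_eq0 -leqn0 leqNgt prime_gt0.
- move=> a u v aK [Pu uK] [Pv vK]; split.
    by apply: Plin => //; exact: integers_subfield KL aK.
  split; first by rewrite rpredD ?rpredM ?aK.1 ?uK.1 ?vK.1.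
  by apply: integral_add vK.2; apply: integral_mul aK.2 uK.2.
- by move=> [].
move=> u v uK vK [Puv _].
by case: (PM _ _ (integers_subfield KL uK) (integers_subfield KL vK) Puv); [left|right].
Qed.

(** For x in P outside P', a power of x is 1 modulo P', hence modulo P, which would put 1 in P. *)
Lemma prime_subset_eq P P' : is_nonzero_prime L P -> is_nonzero_prime L P' ->
  P' `<=` P -> P' = P.
Proof.
move=> pP pP' PP'; apply/seteqP; split=> // x Px; apply: contrapT => nx.
have [PL [P0 _] Plin P1 PM] := pP.
have [k [pi red]] := reduction_exists pP'.
have [S [RS SP]] := subfield_image pP' red L.
pose x' := oint_of (PL _ Px).
have x0 : pi x' != 0 by apply/eqP => /(red.1 x').
have xS : pi x' \in S by apply/SP; exists x' => //; exact: (PL _ Px).1.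
have := expr_size_pred RS xS x0; rewrite -rmorphXn -(rmorph1 pi).
move/(reduction_eqP red)/PP'; rewrite oval_expr /= => P1x; apply: P1.
have s1 := size_subring_gt1 RS.
have -> : 1 = (-1) * (x ^+ (size S).-1 - 1) + x ^+ (size S).-1.
  by rewrite mulN1r opprB subrK.
have N1 : integers L (-1).
  by split; [rewrite rpredN mem1v | apply/integral_opp/integral1].
apply: (Plin _ _ _ N1 P1x).
have -> : ((size S).-1 = (size S).-2.+1)%N by case: (size S) s1 => [|[]].
rewrite exprSr -[_ * x]addr0; apply: (Plin) => //.
have := oint_integers (x' ^+ (size S).-2); by rewrite oval_expr.
Qed.

(** This is the image s(P), written as a preimage under the inverse; it is a right action for the
    product of [gal_of L]. *)
Definition conjp (s : gal_of L) (P : set E) : set E :=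
  [set x | integers L x /\ P ((s^-1)%g x)].

Lemma galVK (s : gal_of L) x : x \in L -> (s^-1)%g (s x) = x.
Proof. by move=> xL; rewrite -galM // mulgV gal_id. Qed.

Lemma galKV (s : gal_of L) x : x \in L -> s ((s^-1)%g x) = x.
Proof. by move=> xL; rewrite -galM // mulVg gal_id. Qed.

Lemma conjpM s t P : conjp t (conjp s P) = conjp (s * t)%g P.
Proof.
apply/seteqP; split=> x [xL]; rewrite /conjp /= invMg galM ?xL.1 //.
  by move=> [].
by move=> Px; split=> //; split=> //; exact: integers_gal.
Qed.

Lemma conjp1 P : P `<=` integers L -> conjp 1%g P = P.
Proof.
move=> PL; apply/seteqP; split=> x; rewrite /conjp /= invg1 gal_id; first by case.
by move=> Px; split=> //; exact: PL.
Qed.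

Lemma conjpE s P x : P `<=` integers L -> x \in L -> conjp s P (s x) <-> P x.
Proof.
move=> PL xL; rewrite /conjp /= galVK //; split=> [[]//|Px]; split=> //.
by apply: integers_gal; exact: PL.
Qed.

Lemma conjp_prime s P : is_nonzero_prime L P -> is_nonzero_prime L (conjp s P).
Proof.
move=> [PL [P0 [x Px x0]] Plin P1 PM]; split.
- by move=> y [].
- split.
    by split; [split; [exact: mem0v|exact: mxpoly.integral0] | rewrite rmorph0].
  exists (s x); last by rewrite fmorph_eq0.
  by apply/conjpE => //; exact: (PL _ Px).1.
- move=> a u v aL [uL Pu] [vL Pv]; split.
    split; first by rewrite rpredD ?rpredM ?aL.1 ?uL.1 ?vL.1.
    by apply: integral_add vL.2; apply: integral_mul aL.2 uL.2.
  by rewrite rmorphD rmorphM; apply: Plin => //; exact: integers_gal.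
- by move=> [_]; rewrite rmorph1.
move=> u v uL vL [_]; rewrite rmorphM => /PM[]; try exact: integers_gal.
  by left.
by right.
Qed.

Lemma conjp_reduction s P (k : idomainType) (pi : {rmorphism oint L -> k}) : is_reduction P pi ->
  is_reduction (conjp s P) (pi \o oint_gal (s^-1)%g).
Proof.
move=> [piP pis]; split=> [x|y].
  rewrite /= piP /= /conjp /=; split=> [Px|[]//]; split=> //; exact: oint_integers.
have [x <-] := pis y; exists (oint_gal s x); rewrite /=; congr (pi _).
by apply: val_inj; rewrite /= galVK //; case: (oint_integers x).
Qed.

Lemma conjp_below (K : {subfield E}) s P : (K <= L)%VS ->
  s \in 'Gal(L / K)%g -> conjp s P `&` integers K = P `&` integers K.
Proof.
move=> KL sK; have fx x : x \in K -> (s^-1)%g x = x.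
  by move=> xK; apply: (sub_gal_fixed KL xK); rewrite groupV.
apply/seteqP; split=> x [] /=.
  by move=> [_ Px] xK; move: Px; rewrite fx ?xK.1.
move=> Px xK; split=> //; split; first exact: integers_subfield KL xK.
by rewrite /= fx // xK.1.
Qed.

Lemma conjp_below_stable (K : {subfield E}) (s : gal_of L) P : (K <= L)%VS ->
  (forall x, x \in K -> (s^-1)%g x \in K) ->
  P `<=` integers L ->
  conjp s P `&` integers K = [set x | integers K x /\ (P `&` integers K) ((s^-1)%g x)].
Proof.
move=> KL sK PL; apply/seteqP; split=> x [].
  move=> [xL Px] xK; split=> //; split=> //; split; first by rewrite sK // xK.1.
  exact: integral_gal xL.1 xL.2.
by move=> xK [Px _]; split=> //; split=> //; exact: integers_subfield KL xK.
Qed.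

Lemma conjp_norm (K : {subfield E}) (s : gal_of L) P : (K <= L)%VS -> is_nonzero_prime L P ->
  (forall x, x \in K -> s x \in K) -> (forall x, x \in K -> (s^-1)%g x \in K) ->
  ideal_norm K (conjp s P `&` integers K) = ideal_norm K (P `&` integers K).
Proof.
move=> KL pP sK sVK; have [k [pi red]] := reduction_exists pP.
have [S [RS SP]] := subfield_image pP red K; have [uS _ _ _] := RS.
rewrite (size_image_norm red KL uS SP).
apply: (size_image_norm (conjp_reduction s red)) => // y; rewrite SP /=.
split=> [[x xK <-]|[x xK <-]]; last by exists (oint_gal (s^-1)%g x); rewrite //= sVK.
exists (oint_gal s x); first by rewrite /= sK.
by congr (pi _); apply: val_inj; rewrite /= galVK //; case: (oint_integers x).
Qed.

Lemma primes_transitive (K : {subfield E}) P P' : (K <= L)%VS ->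
  is_nonzero_prime L P -> is_nonzero_prime L P' ->
  P' `&` integers K = P `&` integers K ->
  exists2 s, s \in 'Gal(L / K)%g & P' = conjp s P.
Proof.
move=> KL pP pP' PP'.
have [k [pi red]] := reduction_exists pP; have [k' [pi' red']] := reduction_exists pP'.
have [|s sG sP] := reduction_transitive galL KL (pi := pi) (pi' := pi').
  move=> x xK /red'.1 Px; apply/red.1.
  have : (P' `&` integers K) (oval x).
    by split=> //; split=> //; exact: (oint_integers x).2.
  by rewrite PP' => -[].
exists (s^-1)%g; first by rewrite groupV.
apply: prime_subset_eq => //; first exact: conjp_prime.
move=> x Px; have [PL _ _ _ _] := pP'.
split; first exact: PL.
rewrite invgK.
by have /sP/red.1 : pi' (oint_of (PL _ Px)) = 0 by apply/red'.1.
Qed.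

Lemma frobenius_exists (K : {subfield E}) P : (K <= L)%VS -> is_nonzero_prime L P ->
  exists s : gal_of L, is_frobenius K (P `&` integers K) P s.
Proof.
move=> KL pP; have [k [pi red]] := reduction_exists pP.
have [S [RS SP]] := subfield_image pP red K; have [uS _ _ _] := RS.
have [l [pl Pl]] := prime_over_rational galL (subvv L) pP.
have [e e0 eE] := norm_power_pchar pP red KL pl Pl.
have [|s sG sP] := reduction_frobenius galL KL (reduction_pchar red pl Pl) (e := e) (pi := pi).
  move=> x xK; rewrite -eE (size_image_norm red KL uS SP) expr_size //.
  by apply/SP; exists x.
exists s; split=> // x xL; rewrite eE.
have := sP (oint_of xL); rewrite -rmorphXn => /(reduction_eqP red).
by rewrite oval_expr.
Qed.

Lemma rational_frobenius P l : is_nonzero_prime L P -> prime l -> P l%:R ->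
  exists s : gal_of L, forall x, integers L x -> P (s x - x ^+ l).
Proof.
move=> pP pl Pl; have [k [pi red]] := reduction_exists pP.
have lk := reduction_pchar red pl Pl.
have [|s _ sP] := reduction_frobenius galL (sub1v L) lk (e := 1) (pi := pi).
  move=> x /oint_rational_int[n ->]; rewrite rmorph_int expn1.
  by rewrite -(pFrobenius_autE lk) rmorph_int.
exists s => x xL; have := sP (oint_of xL); rewrite expn1 -rmorphXn.
by move=> /(reduction_eqP red); rewrite oval_expr.
Qed.

End PrimesOfL.

(** * Frobenius congruences and residue degrees *)

Section FrobeniusElements.

Local Open Scope classical_set_scope.

Variables (E : splittingFieldType rat) (L : {subfield E}).
Hypothesis galL : galois 1 L.

(** The exponent is not tied to a base field, so that one congruence can be read over Q, F or K and
    carried along by conjugation. *)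
Definition frob_at (P : set E) (n : nat) (s : gal_of L) : Prop :=
  forall x, integers L x -> P (s x - x ^+ n).

Lemma integers_expr x n : integers L x -> integers L (x ^+ n).
Proof.
move=> xL; have := oint_integers (oint_of xL ^+ n); by rewrite oval_expr.
Qed.

Lemma frob_at_red P (k : idomainType) (pi : {rmorphism oint L -> k}) n s :
  is_reduction P pi ->
  frob_at P n s <-> forall x, pi (oint_gal s x) = pi x ^+ n.
Proof.
move=> red; split=> [h x|h x xL].
  rewrite -rmorphXn; apply/(reduction_eqP red).
  by rewrite oval_expr; apply: h; exact: oint_integers.
by have := h (oint_of xL); rewrite -rmorphXn => /(reduction_eqP red); rewrite oval_expr.
Qed.

Lemma frob_atX P n s j : is_nonzero_prime L P -> frob_at P n s ->
  frob_at P (n ^ j) (s ^+ j)%g.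
Proof.
move=> pP; have [k [pi red]] := reduction_exists pP.
rewrite !(frob_at_red _ _ red) => h; elim: j => [|j IH] x.
  rewrite expn0 expr1 (_ : oint_gal _ x = x) //; apply: val_inj.
  by rewrite /= expg0 gal_id.
have -> : oint_gal (s ^+ j.+1)%g x = oint_gal s (oint_gal (s ^+ j)%g x).
  by apply: val_inj; rewrite /= expgSr galM //; case: (oint_integers x).
by rewrite h IH -exprM -expnSr.
Qed.

Lemma frob_at_conj P n s t : is_nonzero_prime L P -> frob_at P n s ->
  frob_at (conjp t P) n (s ^ t)%g.
Proof.
move=> [PL _ _ _ _] h x xL.
have yL := integers_gal (t^-1)%g xL.
have -> : (s ^ t)%g x - x ^+ n = t (s ((t^-1)%g x) - ((t^-1)%g x) ^+ n).
  rewrite rmorphB rmorphXn /= galKV ?xL.1 //; congr (_ - _).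
  by rewrite /conjg galM ?xL.1 // galM //; exact: yL.1.
by apply/conjpE; rewrite ?rpredB ?rpredX ?memv_gal ?xL.1 //; exact: h.
Qed.

Lemma frob_at_unique (F : {subfield E}) P n s t : (F <= L)%VS ->
  is_nonzero_prime L P ->
  (forall u, u \in 'Gal(L / F)%g -> (forall x, integers L x -> P (u x - x)) -> u = 1%g) ->
  s \in 'Gal(L / F)%g -> t \in 'Gal(L / F)%g ->
  frob_at P n s -> frob_at P n t -> s = t.
Proof.
move=> FL pP inert sF tF hs ht; have [k [pi red]] := reduction_exists pP.
apply/eqP; rewrite eq_mulVg1; apply/eqP/inert; first by rewrite groupM ?groupV.
move=> x xL; have yL := integers_gal (s^-1)%g xL.
rewrite galM ?xL.1 //.
have /(frob_at_red _ _ red) hs' := hs; have /(frob_at_red _ _ red) ht' := ht.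
have := reduction_eqP red (oint_gal t (oint_of yL)) (oint_of xL) => /= -[+ _].
apply; rewrite ht' -hs'; congr (pi _); apply: val_inj.
by rewrite /= galKV ?xL.1.
Qed.

Lemma ideal_norm_gt1 (K : {subfield E}) P : (K <= L)%VS -> is_nonzero_prime L P ->
  (1 < ideal_norm K (P `&` integers K))%N.
Proof.
move=> KL pP; have [k [pi red]] := reduction_exists pP.
have [S [RS SP]] := subfield_image galL pP red K; have [uS _ _ _] := RS.
by rewrite (size_image_norm red KL uS SP) size_subring_gt1.
Qed.

(** As s fixes K, every residue of K is a root of X^n - X. *)
Lemma ideal_norm_le (K : {subfield E}) P n s : (K <= L)%VS -> is_nonzero_prime L P ->
  (1 < n)%N -> s \in 'Gal(L / K)%g -> frob_at P n s ->
  (ideal_norm K (P `&` integers K) <= n)%N.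
Proof.
move=> KL pP n1 sK; have [k [pi red]] := reduction_exists pP.
have [S [RS SP]] := subfield_image galL pP red K; have [uS _ _ _] := RS.
rewrite (frob_at_red _ _ red) (size_image_norm red KL uS SP) => h.
apply: size_le_expr => // y /SP[x xK <-]; rewrite -h; congr (pi _).
by apply: val_inj; apply: (sub_gal_fixed KL xK).
Qed.

Lemma ideal_norm_power (F K : {subfield E}) P : (F <= K)%VS -> (K <= L)%VS ->
  is_nonzero_prime L P -> exists2 f, (0 < f)%N &
  ideal_norm K (P `&` integers K) = (ideal_norm F (P `&` integers F) ^ f)%N.
Proof.
move=> FK KL pP; have [k [pi red]] := reduction_exists pP.
have FL := subv_trans FK KL.
have [S [RS SP]] := subfield_image galL pP red K; have [uS _ _ _] := RS.
have [S0 [RS0 SP0]] := subfield_image galL pP red F; have [uS0 _ _ _] := RS0.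
rewrite (size_image_norm red KL uS SP) (size_image_norm red FL uS0 SP0).
apply: size_image_power => // _ /SP0[x xF <-]; apply/SP; exists x => //.
exact: (subvP FK).
Qed.

Lemma ideal_norm_eq_lift (F K : {subfield E}) P : (F <= K)%VS -> (K <= L)%VS ->
  is_nonzero_prime L P ->
  ideal_norm K (P `&` integers K) = ideal_norm F (P `&` integers F) ->
  forall x, integers K x -> exists2 y, integers F y & P (x - y).
Proof.
move=> FK KL pP; have [k [pi red]] := reduction_exists pP.
have FL := subv_trans FK KL.
have [S [RS SP]] := subfield_image galL pP red K; have [uS _ _ _] := RS.
have [S0 [RS0 SP0]] := subfield_image galL pP red F; have [uS0 _ _ _] := RS0.
rewrite (size_image_norm red KL uS SP) (size_image_norm red FL uS0 SP0) => sz x xK.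
have SS : {subset S0 <= S}.
  move=> _ /SP0[y yF <-]; apply/SP; exists y => //; exact: (subvP FK).
have [_ SE] := uniq_min_size uS0 SS (eq_leq sz).
have xL := integers_subfield KL xK.
have : pi (oint_of xL) \in S by apply/SP; exists (oint_of xL) => //; exact: xK.1.
rewrite -SE => /SP0[y yF /esym/(reduction_eqP red) yx].
by exists (oval y) => //; split=> //; exact: (oint_integers y).2.
Qed.

(** Here f is the residue degree of K over F. If s^j fixes K, then [ideal_norm_le] bounds the norm
    over K by the j-th power of the norm over F, whence f <= j. *)
Lemma frobenius_power (F K : {subfield E}) P s : (F <= K)%VS -> (K <= L)%VS ->
  is_nonzero_prime L P -> s \in 'Gal(L / F)%g ->
  frob_at P (ideal_norm F (P `&` integers F)) s ->
  exists f, [/\ (0 < f)%N,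
    ideal_norm K (P `&` integers K) = (ideal_norm F (P `&` integers F) ^ f)%N,
    frob_at P (ideal_norm K (P `&` integers K)) (s ^+ f)%g
    & forall j, (0 < j)%N -> (s ^+ j)%g \in 'Gal(L / K)%g -> (f <= j)%N].
Proof.
move=> FK KL pP sF hs; have [f f0 fE] := ideal_norm_power FK KL pP.
have FL := subv_trans FK KL.
have N1 := ideal_norm_gt1 FL pP.
exists f; split=> //; first by rewrite fE; apply: frob_atX.
move=> j j0 sjK; rewrite -(leq_exp2l _ _ N1) -fE.
apply: (ideal_norm_le KL pP _ sjK); last exact: frob_atX.
by rewrite -(exp1n j) ltn_exp2r.
Qed.

Lemma prime_contains_dvd P l n : is_nonzero_prime L P -> prime l -> P l%:R ->
  P n%:R <-> (l %| n)%N.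
Proof.
move=> pP pl Pl; have [k [pi red]] := reduction_exists pP.
rewrite (dvdn_pcharf (reduction_pchar red pl Pl)) -(rmorph_nat pi).
by have := red.1 n%:R; rewrite oval_natr => <-; split=> /eqP.
Qed.

Lemma same_rational_prime P P' l : is_nonzero_prime L P -> is_nonzero_prime L P' ->
  prime l -> P l%:R -> P' l%:R -> P' `&` integers 1%AS = P `&` integers 1%AS.
Proof.
move=> pP pP' pl Pl P'l.
suff main Q Q' : is_nonzero_prime L Q -> is_nonzero_prime L Q' -> Q l%:R -> Q' l%:R ->
    Q `&` integers 1%AS `<=` Q' `&` integers 1%AS by apply/seteqP; split; apply: main.
move=> pQ pQ' Ql Q'l x [Qx x1]; split=> //.
have [n xn] := rat_integral_int x1.1 x1.2.
have pN R : is_nonzero_prime L R -> R (- x) <-> R x.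
  move=> [RL [R0 _] Rlin _ _].
  have N1 : integers L (-1).
    by split; [rewrite rpredN mem1v | apply/integral_opp/integral1].
  have RN y : R y -> R (- y).
    by move=> Ry; rewrite -mulN1r -[_ * y]addr0; apply: Rlin.
  by split=> [/RN|/RN//]; rewrite opprK.
have [xm|xm] : x = `|n|%N%:R \/ - x = `|n|%N%:R.
  rewrite xn; case: (intP n) => [|i|i]; [by left|by left|right].
  by rewrite abszN rmorphN opprK.
  move: Qx; rewrite xm => /(prime_contains_dvd _ pQ pl Ql).
  by move/(prime_contains_dvd _ pQ' pl Q'l).
move: Qx; rewrite -pN // xm => /(prime_contains_dvd _ pQ pl Ql).
by move/(prime_contains_dvd _ pQ' pl Q'l); rewrite -xm pN.
Qed.

(** The primes of L above a given l are conjugate over Q, so each l contributes at most #|gal_of L|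
    primes. *)
Lemma finite_primes_over (K : {subfield E}) n : (K <= L)%VS ->
  finite_set [set p | is_nonzero_prime K p /\ exists l, [/\ prime l, (l <= n)%N & p l%:R]].
Proof.
move=> KL.
pose P0 l := xget set0 [set P | is_nonzero_prime L P /\ P l%:R].
pose g (ls : nat * gal_of L) := conjp ls.2 (P0 ls.1) `&` integers K.
apply: (@sub_finite_set _ _ (g @` (`I_n.+1 `*` [set: gal_of L]))); last first.
  by apply: finite_image; apply: finite_setX; [exact: finite_II | exact: finite_finset].
move=> p [pp [l [pl ln pl']]].
have [P [pP Pp]] := reduction_lying_over galL KL pp.
have Pl : P l%:R by move: pl'; rewrite -Pp => -[].
have [pP0 P0l] : is_nonzero_prime L (P0 l) /\ P0 l l%:R.
  by rewrite /P0; case: xgetP => [Q -> //|/(_ P)[]].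
have [s _ PE] := primes_transitive galL (sub1v L) pP0 pP (same_rational_prime pP0 pP pl P0l Pl).
exists (l, s); first by split.
by rewrite /g /= -PE.
Qed.

Lemma prime_norm_ge (K : {subfield E}) P l : (K <= L)%VS -> is_nonzero_prime L P ->
  prime l -> P l%:R -> (l <= ideal_norm K (P `&` integers K))%N.
Proof.
move=> KL pP pl Pl; have [k [pi red]] := reduction_exists pP.
have [e e0 ->] := norm_power_pchar galL pP red KL pl Pl.
by rewrite -{1}(expn1 l) leq_exp2l ?prime_gt1.
Qed.

End FrobeniusElements.

(** * The Galois group of the Kummer extension *)

Section GaloisFixed.

Variables (E : splittingFieldType rat) (L : {subfield E}).

Lemma mem_galP (K : {subfield E}) (s : gal_of L) : (K <= L)%VS ->
  reflect (forall x, x \in K -> s x = x) (s \in 'Gal(L / K)%g).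
Proof.
move=> KL; apply: (iffP idP) => [sG x xK|fx]; first exact: fixed_gal KL sG xK.
by rewrite (gal_kHom _ KL); apply/kAHomP => x; exact: fx.
Qed.

Lemma mem_gal_adjoinP (K K' : {subfield E}) x (s : gal_of L) :
  (K' <= L)%VS -> K' = <<K; x>>%VS :> {vspace E} ->
  reflect (s \in 'Gal(L / K)%g /\ s x = x) (s \in 'Gal(L / K')%g).
Proof.
move=> K'L K'E; have KK' : (K <= K')%VS by rewrite K'E subv_adjoin.
have KL := subv_trans KK' K'L.
apply: (iffP idP) => [sK'|[sK sx]].
  split; first exact: (fintype.subsetP (galS _ KK') _ sK').
  by apply: (mem_galP s K'L sK'); rewrite K'E memv_adjoin.
have fixP y : y \in fixedField [set s]%SET <-> (y \in L /\ s y = y).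
  split=> [/mem_fixedFieldP[yL fy]|[yL sy]]; first by rewrite fy ?inE.
  by apply/fixedFieldP => // t; rewrite inE => /eqP ->.
have : (K' <= fixedField_aspace [set s]%SET)%VS.
  rewrite K'E; apply/FadjoinP; split.
    by apply/subvP => y yK; apply/fixP; split; [apply: subvP KL _ yK | apply: (mem_galP s KL sK)].
  by apply/fixP; split=> //; rewrite (subvP K'L) // K'E memv_adjoin.
by move=> /subvP K'fix; apply/mem_galP => // y /K'fix/fixP[].
Qed.

End GaloisFixed.

Section KummerGroup.

Variables (E : splittingFieldType rat) (L F D1 D2 k : {subfield E}).
Variables (m : nat) (z alpha beta : E) (c : gal_of L).
Implicit Types (s t : gal_of L).
Hypothesis m2 : (2 <= m)%N.
Hypothesis galL : galois 1 L.
Hypothesis zN1 : z ^+ (2 ^ m.-1) = -1.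
Hypothesis FE : F = <<1; z>>%VS :> {vspace E}.
Hypothesis D1E : D1 = <<F; alpha>>%VS :> {vspace E}.
Hypothesis D2E : D2 = <<F; beta>>%VS :> {vspace E}.
Hypothesis LE : L = <<D1; beta>>%VS :> {vspace E}.
Hypothesis alphaF : alpha ^+ (2 ^ m) \in F.
Hypothesis betaF : beta ^+ (2 ^ m) \in F.
Hypothesis alpha0 : alpha != 0.
Hypothesis beta0 : beta != 0.
Hypothesis ca : c alpha = beta.
Hypothesis cb : c beta = alpha.
Hypothesis cz : c z = z^-1.

Local Notation M := (2 ^ m)%N.
Local Notation Zm := 'Z_(2 ^ m).
Local Notation N := 'Gal(L / F)%g.

Lemma kummer_M1 : (1 < M)%N.
Proof. exact: leq_ltn_trans (ltnW m2) (ltn_expl m (isT : (1 < 2)%N)). Qed.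
Let M1 := kummer_M1.

Lemma E_natr_neq0 n : (0 < n)%N -> (n%:R : E) != 0.
Proof.
move=> n0; apply/eqP => l0; have : (n%:R : rat) *: (1 : E) == 0 by rewrite scaler_nat l0.
by rewrite scaler_eq0 oner_eq0 orbF pnatr_eq0 -leqn0 leqNgt n0.
Qed.

Lemma kummer_zprim : M.-primitive_root z.
Proof.
have mE : (M = 2 ^ m.-1 * 2)%N by rewrite -expnSr prednK //; exact: ltnW m2.
have zM : z ^+ M = 1 by rewrite mE exprM zN1 sqrrN expr1n.
have [d zd dM] := prim_order_exists (expn_gt0 2 m) zM.
move: dM => /(dvdn_pfactor _ _ (isT : prime 2))[j jm dE].
move: jm; rewrite leq_eqVlt => /orP[/eqP <-|jm]; first by rewrite -dE.
have : z ^+ (2 ^ m.-1) == 1.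
  rewrite -(prim_order_dvd zd) dE dvdn_exp2l // -ltnS prednK //.
  exact: ltnW m2.
rewrite zN1 eq_sym -subr_eq0 opprK -mulr2n => /eqP h.
by have := @E_natr_neq0 2 isT; rewrite h eqxx.
Qed.
Let zprim := kummer_zprim.

Lemma kummer_z0 : z != 0.
Proof. by rewrite (prim_root_eq0 zprim) expn_eq0. Qed.
Let z0 := kummer_z0.

Lemma kummer_D1L : (D1 <= L)%VS. Proof. by rewrite LE subv_adjoin. Qed.
Lemma kummer_FD1 : (F <= D1)%VS. Proof. by rewrite D1E subv_adjoin. Qed.
Lemma kummer_FL : (F <= L)%VS. Proof. exact: subv_trans kummer_FD1 kummer_D1L. Qed.
Lemma kummer_bL : beta \in L. Proof. by rewrite LE memv_adjoin. Qed.
Lemma kummer_aL : alpha \in L.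
Proof. by apply: (subvP kummer_D1L); rewrite D1E memv_adjoin. Qed.
Lemma kummer_zF : z \in F. Proof. by rewrite FE memv_adjoin. Qed.
Lemma kummer_zL : z \in L. Proof. exact: (subvP kummer_FL) kummer_zF. Qed.
Lemma kummer_D2L : (D2 <= L)%VS.
Proof. by rewrite D2E; apply/FadjoinP; rewrite kummer_FL kummer_bL. Qed.
Let FL := kummer_FL.
Let aL := kummer_aL.
Let bL := kummer_bL.
Let zL := kummer_zL.

Lemma kummer_memN s : (s \in N) = (s z == z).
Proof.
apply/idP/eqP => [sN|sz]; first exact: (mem_galP s FL sN _ kummer_zF).
apply/(mem_gal_adjoinP (K := 1%AS) (x := z)) => //; split=> //.
apply/mem_galP; first exact: sub1v.
by move=> x /vlineP[y ->]; rewrite linearZ /= rmorph1.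
Qed.

Lemma kummer_memD1 s : (s \in 'Gal(L / D1)%g) = (s z == z) && (s alpha == alpha).
Proof.
rewrite -kummer_memN; apply/idP/andP.
  by move=> /(mem_gal_adjoinP _ kummer_D1L D1E)[-> ->].
by move=> [sN /eqP sa]; apply/(mem_gal_adjoinP _ kummer_D1L D1E).
Qed.

Lemma kummer_memD2 s : (s \in 'Gal(L / D2)%g) = (s z == z) && (s beta == beta).
Proof.
rewrite -kummer_memN; apply/idP/andP.
  by move=> /(mem_gal_adjoinP _ kummer_D2L D2E)[-> ->].
by move=> [sN /eqP sa]; apply/(mem_gal_adjoinP _ kummer_D2L D2E).
Qed.

Lemma kummer_eq1 s : s z = z -> s alpha = alpha -> s beta = beta -> s = 1%g.
Proof.
move=> sz sa sb; have : s \in 'Gal(L / L)%g.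
  apply/(mem_gal_adjoinP (K := D1) (x := beta)) => //; split=> //.
  by rewrite kummer_memD1 sz sa !eqxx.
move/mem_galP => /(_ (subvv _)) fx; apply/eqP/gal_eqP => x xL.
by rewrite fx // gal_id.
Qed.

Lemma kummer_eq s t : s z = t z -> s alpha = t alpha -> s beta = t beta -> s = t.
Proof.
move=> ez ea eb; apply/eqP; rewrite eq_mulgV1; apply/eqP/kummer_eq1.
- by rewrite galM // ez galVK.
- by rewrite galM // ea galVK.
by rewrite galM // eb galVK.
Qed.

Lemma kummer_cc : (c * c)%g = 1%g.
Proof.
apply: kummer_eq1; rewrite galM //.
- by rewrite cz fmorphV /= cz invrK.
- by rewrite ca cb.
by rewrite cb ca.
Qed.

Lemma kummer_cV : (c^-1)%g = c.
Proof. by apply/eqP; rewrite eq_invg_mul kummer_cc. Qed.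

Lemma kummer_expo s g : s \in N -> g \in L -> g != 0 -> g ^+ M \in F ->
  exists i : nat, s g = z ^+ i * g.
Proof.
move=> sN gL g0 gF; have : (s g / g) ^+ M = 1.
  rewrite expr_div_n -rmorphXn /= (mem_galP s FL sN _ gF) divff //.
  by rewrite expf_neq0.
by move/(prim_rootP zprim) => [i iE]; exists i; rewrite -iE mulfVK.
Qed.

(** The exponent matters modulo 2^m, the order of z. For s in N and nonzero g in L with g^M in F it
    exists, and the default 0 is not reached. *)
Definition kummer_exp (g : E) (s : gal_of L) : Zm :=
  (xget 0%N [set i | s g = z ^+ i * g])%:R.

Lemma kummer_expz (i : nat) : z ^+ (i%:R : Zm) = z ^+ i.
Proof. by rewrite val_Zp_nat // (prim_expr_mod zprim). Qed.

Lemma kummer_expE s g : s \in N -> g \in L -> g != 0 -> g ^+ M \in F ->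
  s g = z ^+ (kummer_exp g s) * g.
Proof.
move=> sN gL g0 gF; have [i iE] := kummer_expo sN gL g0 gF.
by rewrite /kummer_exp kummer_expz; case: xgetP => [j _ //|/(_ i)].
Qed.

Lemma kummer_exp_eq (i j : nat) : z ^+ i = z ^+ j -> i%:R = j%:R :> Zm.
Proof.
move=> /eqP; rewrite (eq_prim_root_expr zprim) => /eqP ij.
by rewrite -(Zp_nat_mod M1 i) ij Zp_nat_mod.
Qed.

Lemma kummer_exp_uniq s g i : s \in N -> g \in L -> g != 0 -> g ^+ M \in F ->
  s g = z ^+ i * g -> kummer_exp g s = i%:R.
Proof.
move=> sN gL g0 gF; rewrite (kummer_expE sN gL g0 gF) => /(mulIf g0)/kummer_exp_eq.
by rewrite natr_Zp.
Qed.

Local Notation ka := (kummer_exp alpha).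
Local Notation kb := (kummer_exp beta).

Lemma kummer_kaE s : s \in N -> s alpha = z ^+ (ka s) * alpha.
Proof. by move=> sN; apply: kummer_expE. Qed.
Lemma kummer_kbE s : s \in N -> s beta = z ^+ (kb s) * beta.
Proof. by move=> sN; apply: kummer_expE. Qed.
Lemma kummer_ka_uniq s i : s \in N -> s alpha = z ^+ i * alpha -> ka s = i%:R.
Proof. by move=> sN; apply: kummer_exp_uniq. Qed.
Lemma kummer_kb_uniq s i : s \in N -> s beta = z ^+ i * beta -> kb s = i%:R.
Proof. by move=> sN; apply: kummer_exp_uniq. Qed.

Lemma kummer_Nz s : s \in N -> s z = z.
Proof. by rewrite kummer_memN => /eqP. Qed.

Lemma kummer_kaM s t : s \in N -> t \in N -> ka (s * t)%g = ka s + ka t.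
Proof.
move=> sN tN; rewrite -[RHS](natr_Zp _) -(natr_Zp (ka s)) -(natr_Zp (ka t)) -natrD.
rewrite natr_Zp; apply: kummer_ka_uniq; first exact: groupM.
rewrite galM // (kummer_kaE sN) rmorphM rmorphXn /= (kummer_Nz tN) (kummer_kaE tN).
by rewrite mulrA exprD.
Qed.

Lemma kummer_kbM s t : s \in N -> t \in N -> kb (s * t)%g = kb s + kb t.
Proof.
move=> sN tN; rewrite -[RHS](natr_Zp _) -(natr_Zp (kb s)) -(natr_Zp (kb t)) -natrD.
rewrite natr_Zp; apply: kummer_kb_uniq; first exact: groupM.
rewrite galM // (kummer_kbE sN) rmorphM rmorphXn /= (kummer_Nz tN) (kummer_kbE tN).
by rewrite mulrA exprD.
Qed.

Lemma kummer_inj s t : s \in N -> t \in N -> ka s = ka t -> kb s = kb t -> s = t.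
Proof.
move=> sN tN ea eb; apply: kummer_eq; first by rewrite !kummer_Nz.
  by rewrite !kummer_kaE // ea.
by rewrite !kummer_kbE // eb.
Qed.

Lemma kummer_ka1 : ka 1%g = 0.
Proof. by apply: (kummer_ka_uniq (i := 0)); rewrite ?group1 // gal_id mul1r. Qed.
Lemma kummer_kb1 : kb 1%g = 0.
Proof. by apply: (kummer_kb_uniq (i := 0)); rewrite ?group1 // gal_id mul1r. Qed.

Lemma kummer_kaX s n : s \in N -> ka (s ^+ n)%g = ka s *+ n.
Proof.
move=> sN; elim: n => [|n IH]; first by rewrite expg0 kummer_ka1.
by rewrite expgS kummer_kaM ?groupX // IH mulrS.
Qed.
Lemma kummer_kbX s n : s \in N -> kb (s ^+ n)%g = kb s *+ n.
Proof.
move=> sN; elim: n => [|n IH]; first by rewrite expg0 kummer_kb1.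
by rewrite expgS kummer_kbM ?groupX // IH mulrS.
Qed.

Lemma kummer_comm s t : s \in N -> t \in N -> (s * t)%g = (t * s)%g.
Proof.
by move=> sN tN; apply: kummer_inj; rewrite ?groupM // ?kummer_kaM ?kummer_kbM // addrC.
Qed.

Lemma kummer_conjN s : s \in N -> (s ^ c)%g \in N.
Proof.
move=> sN; rewrite kummer_memN /conjg kummer_cV !galM // ?memv_gal // cz.
by rewrite fmorphV /= (kummer_Nz sN) fmorphV /= cz invrK.
Qed.

Lemma kummer_expN (i : nat) : (z^-1) ^+ i = z ^+ (- (i%:R) : Zm).
Proof.
apply: (mulfI (expf_neq0 i z0)); rewrite exprVn divff ?expf_neq0 //.
rewrite -exprD; apply/esym/eqP; rewrite -(prim_order_dvd zprim).
have := val_Zp_nat M1 (i + (- (i%:R) : Zm)%R); rewrite natrD natr_Zp subrr /= => /esym/eqP.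
by [].
Qed.

Lemma kummer_ka_conj s : s \in N -> ka (s ^ c)%g = - kb s.
Proof.
move=> sN; rewrite -[RHS]natr_Zp; apply: kummer_ka_uniq; first exact: kummer_conjN.
rewrite /conjg kummer_cV !galM // ?memv_gal // ca (kummer_kbE sN) rmorphM rmorphXn /=.
by rewrite cb cz kummer_expN natr_Zp.
Qed.

Lemma kummer_kb_conj s : s \in N -> kb (s ^ c)%g = - ka s.
Proof.
move=> sN; rewrite -[RHS]natr_Zp; apply: kummer_kb_uniq; first exact: kummer_conjN.
rewrite /conjg kummer_cV !galM // ?memv_gal // cb (kummer_kaE sN) rmorphM rmorphXn /=.
by rewrite ca cz kummer_expN natr_Zp.
Qed.

Lemma unit_oddZm (x : Zm) : odd x -> x \is a GRing.unit.
Proof.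
move=> ox; rewrite -(natr_Zp x) unitZpE // coprimeXl // coprime2n //.
Qed.

Lemma odd_Zm_nat n : odd (n%:R : Zm) = odd n.
Proof.
rewrite val_Zp_nat // [in RHS](divn_eq n M) oddD oddM oddX /=.
by rewrite orbF (gtn_eqF (ltnW m2)) andbF.
Qed.

Lemma odd_ZmD (x y : Zm) : odd (x + y)%R = odd x (+) odd y.
Proof. by rewrite -(natr_Zp x) -(natr_Zp y) -natrD !odd_Zm_nat oddD. Qed.

Lemma odd_ZmM (x y : Zm) : odd (x * y)%R = odd x && odd y.
Proof. by rewrite -(natr_Zp x) -(natr_Zp y) -natrM !odd_Zm_nat oddM. Qed.

Lemma odd_ZmN (x : Zm) : odd (- x)%R = odd x.
Proof.
have : odd (x - x)%R = false by rewrite subrr.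
by rewrite odd_ZmD; case: (odd x); case: (odd _).
Qed.

(** The coordinates (a1, b1) of s0 and (-b1, -a1) of its conjugate by c have determinant -(a1^2 -
    b1^2), which is odd and hence invertible modulo 2^m. The exponents u and v come from Cramer's
    rule. *)
Lemma kummer_surj s0 : s0 \in N -> odd (ka s0) -> ~~ odd (kb s0) ->
  forall x y : Zm, exists2 s, s \in N & ka s = x /\ kb s = y.
Proof.
move=> sN oa eb x y; set a1 := ka s0 in oa; set b1 := kb s0 in eb.
pose d := a1 ^+ 2 - b1 ^+ 2.
have dU : d \is a GRing.unit.
  by apply: unit_oddZm; rewrite /d odd_ZmD odd_ZmN !odd_ZmM oa (negPf eb).
have [u ud] : exists u, u * d = a1 * x - b1 * y.
  by exists ((a1 * x - b1 * y) / d); rewrite mulrVK.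
have [v vd] : exists v, v * d = b1 * x - a1 * y.
  by exists ((b1 * x - a1 * y) / d); rewrite mulrVK.
exists (s0 ^+ u * (s0 ^ c) ^+ v)%g.
  by rewrite groupM ?groupX // kummer_conjN.
have [cN sX] := (kummer_conjN sN, fun n => groupX n sN).
rewrite kummer_kaM ?kummer_kbM ?groupX // !kummer_kaX ?kummer_kbX //.
rewrite kummer_ka_conj // kummer_kb_conj // -/a1 -/b1.
rewrite -[a1 *+ u]mulr_natr -[(- b1) *+ v]mulr_natr -[b1 *+ u]mulr_natr.
rewrite -[(- a1) *+ v]mulr_natr !natr_Zp.
split; apply: (mulIr dU).
  transitivity (a1 * (u * d) - b1 * (v * d)); first by ring.
  by rewrite ud vd /d; ring.
transitivity (b1 * (u * d) - a1 * (v * d)); first by ring.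
by rewrite ud vd /d; ring.
Qed.

Hypothesis kE : forall x, x \in k <-> x \in F /\ c x = x.
Hypothesis surj : forall x y : Zm, exists2 s, s \in N & ka s = x /\ kb s = y.

Definition kummer_inv (x : Zm * Zm) : gal_of L :=
  xget 1%g [set s | [/\ s \in N, ka s = x.1 & kb s = x.2]]%classic.

Lemma kummer_invP x :
  [/\ kummer_inv x \in N, ka (kummer_inv x) = x.1 & kb (kummer_inv x) = x.2].
Proof.
rewrite /kummer_inv; case: xgetP => [s _ //|h].
by have [s sN [sa sb]] := surj x.1 x.2; case: (h s).
Qed.

Lemma kummer_inv_morphM : {in [set: Zm * Zm]%SET &, {morph kummer_inv : x y / (x * y)%g}}.
Proof.
move=> x y _ _; have [xN xa xb] := kummer_invP x; have [yN ya yb] := kummer_invP y.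
have [xyN xya xyb] := kummer_invP (x * y)%g.
by apply: kummer_inj; rewrite ?groupM // ?kummer_kaM ?kummer_kbM // ?xya ?xyb ?xa ?xb ?ya ?yb.
Qed.
Canonical kummer_inv_morphism := Morphism kummer_inv_morphM.

Lemma kummer_invK s : s \in N -> kummer_inv (ka s, kb s) = s.
Proof.
by move=> sN; have [xN xa xb] := kummer_invP (ka s, kb s); apply: kummer_inj.
Qed.

Lemma kummer_inv_inj : ('injm kummer_inv)%g.
Proof.
apply/injmP => x y _ _ xy; have [xN xa xb] := kummer_invP x.
have [yN ya yb] := kummer_invP y.
by rewrite [x]surjective_pairing [y]surjective_pairing -xa -xb -ya -yb xy.
Qed.

Lemma kummer_inv_im : (kummer_inv @* [set: Zm * Zm]%SET = N)%g.
Proof.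
apply/setP => s; apply/morphimP/idP => [[x _ _ ->]|sN].
  by have [] := kummer_invP x.
by exists (ka s, kb s); rewrite ?inE //= kummer_invK.
Qed.

Lemma kummer_cN : c \notin N.
Proof.
rewrite kummer_memN cz; apply/eqP => zV.
have : z ^+ 2 == 1 by rewrite expr2 -{1}zV mulVf.
rewrite -(prim_order_dvd zprim) => /dvdn_leq => /(_ isT).
by rewrite leqNgt -{1}(expn1 2) ltn_exp2l // m2.
Qed.

Definition swap_act (x : Zm * Zm) (t : 'Z_2) : Zm * Zm :=
  if odd t then (- x.2, - x.1) else x.

Lemma swap_act1 x : swap_act x 1%g = x. Proof. by []. Qed.

Lemma odd_Z2M (s t : 'Z_2) : odd (s * t)%g = odd s (+) odd t.
Proof. by case: s t => [[|[|//]] ?] [[|[|//]] ?]. Qed.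

Lemma swap_actM x (s t : 'Z_2) : swap_act x (s * t)%g = swap_act (swap_act x s) t.
Proof.
rewrite /swap_act odd_Z2M; case: (odd s); case: (odd t) => //=.
by rewrite !opprK; case: x.
Qed.

Definition swap_action := TotalAction swap_act1 swap_actM.

Lemma swap_is_groupAction : is_groupAction [set: Zm * Zm]%SET swap_action.
Proof.
move=> t _; rewrite inE; apply/andP; split.
  by apply/fintype.subsetP => x _; rewrite inE.
apply/morphicP => x y _ _; rewrite !actpermE /= /swap_act.
case: ifP => // _; congr (_, _); exact: opprD.
Qed.

Definition swap_groupAction := GroupAction swap_is_groupAction.

Definition cycle_c (t : 'Z_2) : gal_of L := (c ^+ t)%g.

Lemma cycle_c_morphM : {in [set: 'Z_2]%SET &, {morph cycle_c : x y / (x * y)%g}}.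
Proof.
move=> x y _ _; case: x y => [[|[|//]] ?] [[|[|//]] ?] /=;
  by rewrite /cycle_c /= ?expg0 ?expg1 ?mul1g ?mulg1 ?kummer_cc.
Qed.
Canonical cycle_c_morphism := Morphism cycle_c_morphM.

Lemma cycle_c_inj : ('injm cycle_c)%g.
Proof.
have c1 : c <> 1%g by move=> c1; move: kummer_cN; rewrite c1 group1.
apply/injmP => x y _ _; case: x y => [[|[|//]] ?] [[|[|//]] ?] /=;
  rewrite /cycle_c /= ?expg0 ?expg1 => e; try exact: val_inj; by case: c1.
Qed.

Lemma cycle_c_im : (cycle_c @* [set: 'Z_2]%SET = <[c]>)%g.
Proof.
apply/setP => s; apply/morphimP/cycleP => [[x _ _ ->]|[i ->]]; first by exists x.
exists (inZp i : 'Z_2); rewrite ?inE //= /cycle_c /=.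
have c2 : (c ^+ 2 = 1)%g by rewrite expgS expg1 kummer_cc.
by rewrite [in LHS](divn_eq i 2) expgD mulnC expgM c2 expg1n mul1g.
Qed.

Lemma kummer_norm_c : (c \in 'N(N))%g.
Proof.
rewrite inE; apply/fintype.subsetP => s; rewrite mem_conjg kummer_cV => sN.
have := kummer_conjN sN.
by rewrite -conjgM kummer_cc conjg1.
Qed.

Lemma kummer_gal_k : ('Gal(L / k) = N * <[c]>)%g.
Proof.
have nN : (<[c]> \subset 'N(N))%g by rewrite cycle_subG kummer_norm_c.
rewrite -(norm_joinEr nN) -[RHS]gal_fixedField.
suff kf : k = fixedField (N <*> <[c]>)%G :> {vspace E} by rewrite kf.
apply/vspaceP => x; apply/idP/idP => [xk|].
  have /kE[xF cx] := xk; apply/fixedFieldP; first exact: (subvP FL).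
  move=> s /=; rewrite (norm_joinEr nN) => /mulsgP[t u tN].
  move=> /cycleP[i ->] ->; rewrite galM ?(subvP FL) // (mem_galP t FL tN _ xF).
  elim: i => [|i IH]; first by rewrite expg0 gal_id.
  by rewrite expgSr galM ?(subvP FL) // IH.
move=> /mem_fixedFieldP[xL fx]; apply/kE; split.
  apply: (mem_fixed_gal galL FL xL) => s sN; apply: fx.
  by rewrite mem_gen // inE sN.
by apply: fx; rewrite mem_gen // inE cycle_id orbT.
Qed.

Lemma kummer_sdprod : exists to : groupAction [set: 'Z_2]%SET [set: Zm * Zm]%SET,
  ('Gal(L / k) \isog [set: sdprod_by to]%SET)%g.
Proof.
exists swap_groupAction; rewrite isog_sym.
have act_c : {in [set: Zm * Zm]%SET & [set: 'Z_2]%SET,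
    morph_act swap_groupAction 'J kummer_inv_morphism cycle_c_morphism}%act.
  move=> x t _ _ /=; rewrite /swap_act /cycle_c.
  case: t => [[|[|//]] ?] /=; first by rewrite expg0 conjg1.
  rewrite expg1; have [xN xa xb] := kummer_invP x.
  have [yN ya yb] := kummer_invP (- x.2, - x.1).
  apply: kummer_inj => //; first exact: kummer_conjN.
    by rewrite kummer_ka_conj // ya xb.
  by rewrite kummer_kb_conj // yb xa.
apply/isogP; exists (xsdprod_morphism act_c).
  rewrite injm_xsdprodm kummer_inv_inj cycle_c_inj kummer_inv_im cycle_c_im /=.
  apply/eqP/setP => s; rewrite !inE; apply/andP/eqP => [[sN /cycleP[i si]]|->].
    move: sN; rewrite si (divn_eq i 2) expgD mulnC expgM expgS expg1 kummer_cc expg1n mul1g.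
    by rewrite modn2; case: (odd i) => //=; rewrite expg1 (negPf kummer_cN).
  by split; rewrite ?group1.
rewrite /= im_xsdprodm kummer_inv_im cycle_c_im; exact: esym kummer_gal_k.
Qed.

(** * The subgroups H and G in coordinates *)

Section ProperSubgroup.

Variable H : {group gal_of L}.
Hypothesis HD2 : H \proper 'Gal(L / D2)%g.
Hypothesis H1 : H :!=: 1%g.

Local Notation A2 := 'Gal(L / D2)%g.

Lemma kummer_A2P s : s \in A2 <-> s \in N /\ kb s = 0.
Proof.
rewrite kummer_memD2; split=> [/andP[sz /eqP sb]|[sN sb]].
  have sN : s \in N by rewrite kummer_memN.
  by split=> //; apply: (kummer_kb_uniq (i := 0)); rewrite // mul1r.
move: (sN); rewrite kummer_memN => -> /=.
by rewrite (kummer_kbE sN) sb expr0 mul1r.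
Qed.

Lemma kummer_A1P s : s \in 'Gal(L / D1)%g <-> s \in N /\ ka s = 0.
Proof.
rewrite kummer_memD1; split=> [/andP[sz /eqP sb]|[sN sb]].
  have sN : s \in N by rewrite kummer_memN.
  by split=> //; apply: (kummer_ka_uniq (i := 0)); rewrite // mul1r.
move: (sN); rewrite kummer_memN => -> /=.
by rewrite (kummer_kaE sN) sb expr0 mul1r.
Qed.

Lemma card_Zm : #|{: Zm}| = M.
Proof. by rewrite card_ord Zp_cast. Qed.

Lemma kummer_card_A2 : #|A2| = M.
Proof.
pose f (x : Zm) := kummer_inv (x, 0).
have -> : A2 = [set f x | x : Zm].
  apply/setP => s; apply/idP/imsetP => [/kummer_A2P[sN sb]|[x _ ->]].
    by exists (ka s) => //; rewrite /f -sb kummer_invK.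
  by apply/kummer_A2P; have [? ? ?] := kummer_invP (x, 0).
rewrite card_imset ?card_Zm // => x y; rewrite /f => e.
have [_ ea _] := kummer_invP (x, 0); have [_ ea' _] := kummer_invP (y, 0).
by rewrite -[x]/((x, 0 : Zm).1) -ea e ea'.
Qed.

Lemma kummer_A2_cyclic : cyclic A2.
Proof.
have [gN ga gb] := kummer_invP (1, 0).
apply/cyclicP; exists (kummer_inv (1, 0)); apply/setP => s.
apply/idP/cycleP => [/kummer_A2P[sN sb]|[i ->]].
  exists (ka s); apply: kummer_inj; rewrite ?groupX ?kummer_kaX ?kummer_kbX //.
    by rewrite ga natr_Zp.
  by rewrite gb mul0rn sb.
by apply/kummer_A2P; rewrite groupX // kummer_kbX // gb mul0rn.
Qed.

(** [A2] is cyclic of order 2^m, so H consists of all its elements killed by 2^n, that is, those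
    whose exponent is divisible by 2^(m-n). *)
Lemma kummer_card_H : exists n, [/\ (1 <= n <= m - 1)%N, #|H| = (2 ^ n)%N &
  forall s, s \in H <-> [/\ s \in N, (2 ^ (m - n) %| ka s)%N & kb s = 0]].
Proof.
have HA : H \subset A2 by case/andP: HD2.
have : (#|H| %| M)%N by rewrite -kummer_card_A2 cardSg.
move=> /(dvdn_pfactor _ _ (isT : prime 2))[n nm cH].
have n1 : (1 <= n)%N.
  by rewrite lt0n; apply: contra H1 => /eqP n0; rewrite trivg_card1 cH n0.
have nm' : (n < m)%N.
  by have := proper_card HD2; rewrite kummer_card_A2 cH ltn_exp2l.
exists n; split=> //; first by rewrite n1 /= subn1 -ltnS prednK // ltnW.
move=> s; transitivity (s \in A2 /\ (2 ^ (m - n) %| ka s)%N); last first.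
  by rewrite kummer_A2P; split=> [[[]]|[]].
have key : s \in A2 -> (s \in H) = (2 ^ (m - n) %| ka s)%N.
  move=> sA; have [sN sb] := (kummer_A2P s).1 sA.
  rewrite -[s \in H]cycle_subG -(cardSg_cyclic kummer_A2_cyclic) ?cycle_subG //.
  rewrite cH -[#|<[s]>%g|]/(#[s]%g) order_dvdn.
  have -> : (s ^+ (2 ^ n) == 1)%g = (ka s *+ 2 ^ n == 0).
    apply/eqP/eqP => [e|e]; first by rewrite -kummer_kaX // e kummer_ka1.
    apply: kummer_inj; rewrite ?groupX ?group1 //.
      by rewrite kummer_kaX // e kummer_ka1.
    by rewrite kummer_kbX // sb mul0rn kummer_kb1.
  rewrite -[X in X *+ _]natr_Zp -mulrnA -(inj_eq val_inj) /= Zp_nat /=.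
  rewrite [X in (_ %% X)%N]Zp_cast // -/(dvdn _ _).
  by rewrite -{1}(subnK (ltnW nm')) expnD dvdn_pmul2r // expn_gt0.
split=> [sH|[sA]]; last by rewrite key.
by have sA := fintype.subsetP HA _ sH; rewrite -key.
Qed.

Lemma kummer_memG n : (forall s, s \in H <-> [/\ s \in N, (2 ^ (m - n) %| ka s)%N & kb s = 0]) ->
  forall s, s \in (H * 'Gal(L / D1))%g <-> s \in N /\ (2 ^ (m - n) %| ka s)%N.
Proof.
move=> HP s; split=> [/mulsgP[t u /HP[tN ta tb] /kummer_A1P[uN ua] ->]|[sN sa]].
  by rewrite groupM // kummer_kaM // ua addr0.
have [tN ta tb] := kummer_invP (ka s, 0); have [uN ua ub] := kummer_invP (0, kb s).
apply/mulsgP; exists (kummer_inv (ka s, 0)) (kummer_inv (0, kb s)).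
- by apply/HP; rewrite ta.
- exact/kummer_A1P.
apply: kummer_inj; rewrite ?groupM // ?kummer_kaM ?kummer_kbM // ?ta ?ua ?tb ?ub.
  by rewrite addr0.
by rewrite add0r.
Qed.

Lemma kummer_group_set : group_set (H * 'Gal(L / D1))%g.
Proof.
have [n [_ _ HP]] := kummer_card_H.
have HN s : s \in H -> s \in N by move=> /HP[].
apply/comm_group_setP/centC/centsP => s sH t /kummer_A1P[tN _].
exact: kummer_comm (HN _ sH) tN.
Qed.

End ProperSubgroup.

Definition kummer_sub (n : nat) (x : 'Z_(2 ^ n) * Zm) : gal_of L :=
  kummer_inv ((x.1 * 2 ^ (m - n))%:R, x.2).

Lemma kummer_sub_isog n (G : {group gal_of L}) : (1 <= n <= m - 1)%N ->
  (forall s, s \in G <-> s \in N /\ (2 ^ (m - n) %| ka s)%N) ->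
  (G \isog [set: 'Z_(2 ^ n) * 'Z_(2 ^ m)]%SET)%g.
Proof.
move=> /andP[n1 nm] GP; have n2 : (1 < 2 ^ n)%N.
  exact: leq_ltn_trans n1 (ltn_expl n (isT : (1 < 2)%N)).
have nm' : (n <= m)%N := leq_trans nm (leq_subr 1 m).
have mE : (M = 2 ^ n * 2 ^ (m - n))%N by rewrite -expnD subnKC.
have key a : ((a * 2 ^ (m - n)) %% M = (a %% 2 ^ n) * 2 ^ (m - n))%N.
  by rewrite mE -muln_modl.
have lt (u : 'Z_(2 ^ n)) : (u %% 2 ^ n = u)%N.
  by rewrite modn_small // -{2}(Zp_cast n2).
have fM : {in [set: 'Z_(2 ^ n) * Zm]%SET &, {morph @kummer_sub n : x y / (x * y)%g}}.
  move=> x y _ _; rewrite /kummer_sub -kummer_inv_morphM ?inE //; congr kummer_inv.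
  congr (_, _); rewrite -[RHS]/(_ + _) -natrD -mulnDl.
  apply: val_inj; rewrite /= !val_Zp_nat // !key.
  by rewrite [X in (_ %% X %% _ * _)%N]Zp_cast // modn_mod.
pose f := Morphism fM.
rewrite isog_sym; apply/isogP; exists f.
  apply/injmP => x y _ _; rewrite /= /kummer_sub => e.
  have : ((x.1 * 2 ^ (m - n))%:R, x.2) = ((y.1 * 2 ^ (m - n))%:R, y.2) :> Zm * Zm.
    by apply: (injmP kummer_inv_inj); rewrite ?inE.
  case=> /(congr1 val) /=; rewrite !val_Zp_nat // !key !lt => e1 e2.
  have e3 : x.1 = y.1 :> nat.
    by move/eqP: e1; rewrite eqn_pmul2r ?expn_gt0 // => /eqP.
  by rewrite [x]surjective_pairing [y]surjective_pairing e2 (val_inj e3).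
apply/setP => s; apply/morphimP/idP => [[x _ _ ->]|/GP[sN /dvdnP[i si]]].
  apply/GP; rewrite /= /kummer_sub.
  have [tN -> _] := kummer_invP ((x.1 * 2 ^ (m - n))%:R, x.2); split=> //.
  by rewrite /= val_Zp_nat // key dvdn_mull.
exists (i%:R, kb s); rewrite ?inE //= /kummer_sub /= val_Zp_nat //.
have -> : ((i %% 2 ^ n) * 2 ^ (m - n))%:R = ka s.
  apply: val_inj; rewrite /= val_Zp_nat // -key modn_mod -si.
  by rewrite modn_small // -{2}(Zp_cast M1).
by rewrite kummer_invK.
Qed.

(** * Primes away from 2 and q *)

Variable q : nat.
Hypotheses (pq : prime q) (q4 : (4 %| q - 1)%N).
Hypothesis qE : alpha ^+ M * beta ^+ M = q%:R.
Hypothesis alphaI : integralOver (intr : int -> E) alpha.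
Hypothesis betaI : integralOver (intr : int -> E) beta.

Lemma kummer_aI : integers L alpha. Proof. by split. Qed.
Lemma kummer_bI : integers L beta. Proof. by split. Qed.
Lemma kummer_zI : integers L z.
Proof.
split=> //; exists ('X^M - 1); first by rewrite monicXnsubC // ltnW.
rewrite rmorphB /= map_polyXn rmorph1 /root !hornerE.
by rewrite (prim_expr_order zprim) subrr.
Qed.
Let aI := kummer_aI.
Let bI := kummer_bI.
Let zI := kummer_zI.

(** At these primes L/F is unramified: alpha and beta are nonzero modulo P because alpha^M beta^M =
    q, and distinct powers of z stay distinct modulo P. *)
Definition good_prime (P : set E) : Prop :=
  [/\ is_nonzero_prime L P, ~ P 2%:R & ~ P q%:R].

Lemma prime_expr_notin P x j : is_nonzero_prime L P -> integers L x -> ~ P x ->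
  ~ P (x ^+ j).
Proof.
move=> [PL _ _ P1 PM] xL nPx; elim: j => [|j IH]; first by rewrite expr0.
rewrite exprS => /PM[] //; exact: integers_expr.
Qed.

Lemma prime_mul P a u : is_nonzero_prime L P -> integers L a -> P u -> P (a * u).
Proof.
by move=> [_ [P0 _] Plin _ _] uI Pu; rewrite -[_ * _]addr0; apply: Plin.
Qed.

Lemma good_alpha P : good_prime P -> ~ P alpha /\ ~ P beta.
Proof.
move=> [pP _ nq].
have PX g : integers L g -> P g -> P (g ^+ M).
  move=> gL Pg; rewrite -(prednK (ltnW M1)) exprSr.
  by apply: prime_mul => //; exact: integers_expr.
split=> h; apply: nq; rewrite -qE; last by apply: prime_mul (PX _ bI h) => //; exact: integers_expr.
by rewrite mulrC; apply: prime_mul (PX _ aI h) => //; exact: integers_expr.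
Qed.

(* A nontrivial 2-power root of unity [y] satisfies [y - 1 %| 2]. *)
Lemma good_root_unity P i : good_prime P -> P (z ^+ i - 1) -> z ^+ i = 1.
Proof.
move=> [pP n2 _] Pi; apply/eqP; apply: contrapT => /negP y1; apply: n2.
set y := z ^+ i in Pi y1 *.
have yM : y ^+ M = 1 by rewrite /y -exprM mulnC exprM (prim_expr_order zprim) expr1n.
have [d yd dM] := prim_order_exists (expn_gt0 2 m) yM.
move: dM => /(dvdn_pfactor _ _ (isT : prime 2))[t tm dE].
case: t dE tm => [|t] dE tm.
  by move: y1; rewrite -[y]expr1 -(prim_order_dvd yd) dE.
have h1 : y ^+ (2 ^ t) != 1.
  by rewrite -(prim_order_dvd yd) dE dvdn_Pexp2l // ltnn.
have hN : y ^+ (2 ^ t) = -1.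
  have : (y ^+ (2 ^ t)) ^+ 2 == 1 by rewrite -exprM -expnSr -dE prim_expr_order.
  by rewrite sqrf_eq1 (negPf h1) => /eqP.
have yL : integers L y := integers_expr i zI.
have -> : 2%:R = - (\sum_(j < 2 ^ t) y ^+ j) * (y - 1).
  by rewrite mulNr mulrC -subrX1 hN opprB opprK.
apply: prime_mul => //; split.
  by rewrite rpredN rpred_sum // => j _; rewrite rpredX // yL.1.
apply: integral_opp; apply: (big_ind (fun y => integralOver (intr : int -> E) y)).
- exact: mxpoly.integral0.
- by move=> *; apply: integral_add.
by move=> j _; exact: (integers_expr j yL).2.
Qed.

Lemma good_fixed P g i s : good_prime P -> integers L g -> ~ P g ->
  s g = z ^+ i * g -> P (s g - g) -> z ^+ i = 1.
Proof.
move=> gP gL nPg sg Psg; apply: good_root_unity (gP) _.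
have [[PL _ _ _ PM] _ _] := gP.
move: Psg; rewrite sg -[X in _ - X]mul1r -mulrBl => /PM[] //.
have yL := integers_expr i zI.
split; first by rewrite rpredB ?yL.1 ?mem1v.
exact: integral_sub yL.2 (integral1 _).
Qed.

Lemma good_inert P s : good_prime P -> s \in N ->
  (forall x, integers L x -> P (s x - x)) -> s = 1%g.
Proof.
move=> gP sN h; have [nPa nPb] := good_alpha gP.
apply: kummer_eq1; first exact: kummer_Nz.
  rewrite (kummer_kaE sN) (good_fixed gP aI nPa (kummer_kaE sN)) ?mul1r //; exact: h.
rewrite (kummer_kbE sN) (good_fixed gP bI nPb (kummer_kbE sN)) ?mul1r //; exact: h.
Qed.

Lemma conjp_nat P s j : is_nonzero_prime L P -> conjp s P j%:R <-> P j%:R.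
Proof.
move=> [PL _ _ _ _]; have jL : integers L j%:R.
  by split; [exact: rpred_nat | exact: integral_nat].
by rewrite -{1}(rmorph_nat s j) conjpE // jL.1.
Qed.

Lemma good_conj P s : good_prime P -> good_prime (conjp s P).
Proof.
move=> [pP n2 nq]; split; first exact: conjp_prime.
  by rewrite conjp_nat.
by rewrite conjp_nat.
Qed.

Let nrmF (P : set E) := ideal_norm F (P `&` integers F)%classic.

Lemma kummer_conjF s x : s \in 'Gal(L / 1)%g -> x \in F -> s x \in F.
Proof.
move=> _; have zpow : s z \in F.
  have : (s z) ^+ M = 1 by rewrite -rmorphXn /= (prim_expr_order zprim) rmorph1.
  by move/(prim_rootP zprim) => [i ->]; rewrite rpredX ?kummer_zF.
rewrite FE => /Fadjoin_polyP[p pO ->].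
rewrite -horner_map /= -FE rpred_horner //.
apply/polyOverP => i; rewrite coef_map /=; have /polyOverP/(_ i)/vlineP[r ->] := pO.
by rewrite linearZ /= rmorph1 rpredZ // mem1v.
Qed.

Lemma mem_gal1 s : s \in 'Gal(L / 1)%g.
Proof.
apply/mem_galP; first exact: sub1v.
by move=> x /vlineP[r ->]; rewrite linearZ /= rmorph1.
Qed.

Lemma nrmF_conj P s : is_nonzero_prime L P -> nrmF (conjp s P) = nrmF P.
Proof.
move=> pP; apply: conjp_norm => // x xF; apply: kummer_conjF => //; exact: mem_gal1.
Qed.

Lemma rational_prime_above l : prime l -> exists P, is_nonzero_prime L P /\ P l%:R.
Proof.
move=> pl; pose p : set E := [set x | exists n : int, x = l%:R * n%:~R]%classic.
have int1 (n : int) : integers 1%AS (n%:~R : E).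
  by split; [exact: rpred_int | exact: (integral_id (intr : {rmorphism int -> E}))].
have lne : (l%:R : E) != 0 by apply: E_natr_neq0; rewrite prime_gt0.
have intI (a b : int) : (a%:~R : E) = b%:~R -> a = b.
  move/eqP; rewrite -subr_eq0 -rmorphB /= => h; apply/eqP; rewrite -subr_eq0.
  move: h; case: (intP (a - b)) => [//|j|j]; last rewrite rmorphN /= oppr_eq0.
    by rewrite -pmulrn (negPf (E_natr_neq0 _)).
  by rewrite -pmulrn (negPf (E_natr_neq0 _)).
have pP n : p n%:~R <-> (l %| `|n|)%N.
  split=> [[j]|/dvdnP[j nj]].
    rewrite -[l%:R]/((Posz l)%:~R) -rmorphM => /intI ->.
    by rewrite abszM dvdn_mulr.
  exists (sgz n * j); rewrite -[l%:R]/((Posz l)%:~R) -rmorphM /=; congr (_%:~R).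
  by rewrite [n in LHS]intEsg nj PoszM; ring.
have pp : is_nonzero_prime 1%AS p.
  split.
  - by move=> x [n ->]; rewrite -[l%:R]/((Posz l)%:~R) -rmorphM; exact: int1.
  - split; first by exists 0; rewrite mulr0.
    by exists l%:R => //; exists 1; rewrite mulr1.
  - move=> a u v aI' [i ->] [j ->]; have [n ->] := rat_integral_int aI'.1 aI'.2.
    by exists (n * i + j); rewrite rmorphD rmorphM /=; ring.
  - by rewrite -[1]/((1 : int)%:~R : E) => /pP; rewrite dvdn1 => /eqP l1; move: (prime_gt1 pl); rewrite l1.
  move=> u v uI vI; have [i ->] := rat_integral_int uI.1 uI.2.
  have [j ->] := rat_integral_int vI.1 vI.2; rewrite -rmorphM => /pP.
  by rewrite abszM Euclid_dvdM // => /orP[] h; [left|right]; apply/pP.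
have [P [primeP PE]] := reduction_lying_over galL (sub1v L) pp.
exists P; split=> //.
have : p l%:R by exists 1; rewrite mulr1.
by rewrite -PE => -[].
Qed.

Lemma exists_good_prime B : exists l P s,
  [/\ prime l, (B < l)%N, P l%:R, good_prime P &
      [/\ s \in N, frob_at P (nrmF P) s, odd (ka s) & ~~ odd (kb s)]].
Proof.
have [l [pl lB lm lq]] := exists_prime_nonresidue m (B + q + 2) pq q4.
have Bl : (B < l)%N by apply: leq_ltn_trans lB; rewrite -addnA leq_addr.
have ql : (q < l)%N by apply: leq_ltn_trans lB; rewrite -addnA addnCA leq_addr.
have l2 : (2 < l)%N by apply: leq_ltn_trans lB; rewrite leq_addl.
have [P [pP Pl]] := rational_prime_above pl.
have gP : good_prime P.
  split=> // /(prime_contains_dvd _ pP pl Pl).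
    by move/(dvdn_leq (isT : (0 < 2)%N)); rewrite leqNgt l2.
  by move/(dvdn_leq (prime_gt0 pq)); rewrite leqNgt ql.
(* The Frobenius is taken over Q; since l = 1 modulo 2^m, it fixes z and so lies in N, and the norm
   of P in F is l itself. *)
have [s sl] := rational_frobenius galL pP pl Pl.
have zl : z ^+ l = z.
  have -> : l = ((l - 1) + 1)%N by rewrite subnK // prime_gt0.
  rewrite exprD expr1; move: lm; rewrite (prim_order_dvd zprim) => /eqP ->.
  by rewrite mul1r.
have [P1 PM] : ~ P 1 /\ (forall u v, integers L u -> integers L v -> P (u * v) -> P u \/ P v).
  by case: pP.
have nPz : ~ P z.
  move=> /(prime_mul (a := z ^+ M.-1) pP (integers_expr _ zI)).
  by rewrite -exprSr prednK ?(ltnW M1) // (prim_expr_order zprim).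
have sN : s \in N.
  rewrite kummer_memN.
  have : (s z) ^+ M = 1 by rewrite -rmorphXn /= (prim_expr_order zprim) rmorph1.
  move/(prim_rootP zprim) => [i iE].
  have iE' : s z = z ^+ (i + M.-1) * z.
    by rewrite exprD -mulrA -exprSr prednK ?(ltnW M1) // (prim_expr_order zprim) mulr1.
  rewrite iE' (good_fixed gP zI nPz iE') ?mul1r //.
  by have := sl z zI; rewrite zl.
have nl : nrmF P = l.
  apply/eqP; rewrite eqn_leq (prime_norm_ge galL FL pP pl Pl) andbT.
  exact: (ideal_norm_le galL FL pP (prime_gt1 pl) sN sl).
(* alpha^h beta^h is a square root of q, which s does not fix since q is not a
   square modulo l. *)
have par : odd (ka s) != odd (kb s).
  apply/negP => /eqP par; pose h := (2 ^ m.-1)%N.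
  have hM : (M = h * 2)%N by rewrite -expnSr prednK // ltnW.
  pose r := alpha ^+ h * beta ^+ h.
  have r2 : r ^+ 2 = q%:R by rewrite exprMn -!exprM -hM qE.
  have rL : integers L r.
    have xL := integers_expr h aI; have yL := integers_expr h bI.
    by split; [rewrite rpredM ?xL.1 ?yL.1 | apply: integral_mul; [exact: xL.2|exact: yL.2]].
  have zh (x : Zm) : (z ^+ x) ^+ h = (-1) ^+ odd x.
    by rewrite -exprM mulnC exprM zN1 signr_odd.
  have sr : s r = r.
    rewrite /r rmorphM !rmorphXn /= (kummer_kaE sN) (kummer_kbE sN) !exprMn !zh par.
    by rewrite mulrACA -expr2 sqrr_sign mul1r.
  have nPr : ~ P r.
    have [_ _ nq] := gP; move=> Pr; apply: nq; rewrite -r2 expr2.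
    exact: prime_mul.
  have rl : r ^+ l = r * (q%:R) ^+ (l - 1)./2.
    rewrite -r2 -exprM -exprS; congr (_ ^+ _).
    have ol : odd l by case: (even_prime pl) l2 => // ->.
    rewrite mul2n -[in LHS](prednK (prime_gt0 pl)); congr (_.+1).
    rewrite subn1 -[LHS]odd_double_half.
    by move: ol; rewrite -{1}(prednK (prime_gt0 pl)) /= => /negPf ->.
  have Pq : P (q%:R ^+ (l - 1)./2 + 1).
    rewrite -natrX -[1]/(1%:R) -natrD; exact/(prime_contains_dvd _ pP pl Pl).
  have P2r : P (2%:R * r).
    have := sl r rL; rewrite sr rl => h1.
    have -> : 2%:R * r = 1 * (r - r * q%:R ^+ (l - 1)./2) + r * (q%:R ^+ (l - 1)./2 + 1).
      by ring.
    have [_ _ Plin _ _] := pP; apply: Plin => //.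
      by split; [exact: mem1v|exact: integral1].
    exact: prime_mul.
  have [_ n2 _] := gP; case: (PM _ _ _ rL P2r) => //.
  by split; [exact: rpred_nat | exact: integral_nat].
(* Exactly one exponent is odd; if it is the second, conjugating P and s by c exchanges the
   parities. *)
case oa : (odd (ka s)) par => ob.
  by exists l, P, s; split=> //; split=> //; rewrite ?nl //; move: ob; case: (odd _).
exists l, (conjp c P), (s ^ c)%g; split=> //; first by rewrite conjp_nat.
  exact: good_conj.
split; first exact: kummer_conjN.
- by rewrite nrmF_conj // nl; apply: frob_at_conj.
- by rewrite kummer_ka_conj // odd_ZmN; move: ob; case: (odd _).
by rewrite kummer_kb_conj // odd_ZmN oa.
Qed.

(** * The Chebyshev bias *)

Section ChebyshevSubgroup.

Variables (n : nat) (G : {group gal_of L}).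
Hypothesis n1m : (1 <= n <= m - 1)%N.
Hypothesis GP : forall s, s \in G <-> s \in N /\ (2 ^ (m - n) %| ka s)%N.

Let n1 : (1 <= n)%N. Proof. by case/andP: n1m. Qed.
Let nm : (n < m)%N.
Proof. by case/andP: n1m => _; rewrite subn1 -ltnS prednK // ltnW. Qed.

Local Notation K := (fixedField_aspace G).

Lemma sub_KL : (K <= L)%VS. Proof. exact: fixedField_bound. Qed.
Let KL := sub_KL.

Lemma sub_GN s : s \in G -> s \in N. Proof. by move=> /GP[]. Qed.

Lemma gal_LK : 'Gal(L / K)%g = G. Proof. exact: gal_fixedField. Qed.

Lemma sub_FK : (F <= K)%VS.
Proof.
apply/subvP => x xF; apply/fixedFieldP; first exact: (subvP FL).
by move=> s /sub_GN sN; apply: (mem_galP s FL sN _ xF).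
Qed.
Let FK := sub_FK.

Lemma mem_K x : x \in K <-> x \in L /\ (forall s, s \in G -> s x = x).
Proof.
split=> [/mem_fixedFieldP//|[xL fx]]; exact/fixedFieldP.
Qed.

Let nrmK (P : set E) := ideal_norm K (P `&` integers K)%classic.

Lemma N_stab_K s x : s \in N -> x \in K -> s x \in K.
Proof.
move=> sN /mem_K[xL fx]; apply/mem_K; rewrite memv_gal //; split=> // t tG.
by rewrite -galM // -(kummer_comm (sub_GN tG) sN) galM // fx.
Qed.

Lemma nrmK_conj P s : is_nonzero_prime L P -> s \in N -> nrmK (conjp s P) = nrmK P.
Proof.
by move=> pP sN; apply: conjp_norm => // x xK; apply: N_stab_K => //; rewrite groupV.
Qed.

(** The test element alpha^(2^n) lies in K, and s multiplies it by z^(2^n ka(s)). If this is trivial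
    modulo P, then 2^m divides 2^n ka(s). *)
Lemma good_inertK P s : good_prime P -> s \in N ->
  (forall x, integers K x -> P (s x - x)) -> s \in G.
Proof.
move=> gP sN h; apply/GP; split=> //; have [nPa _] := good_alpha gP.
have [pP _ _] := gP.
pose g := alpha ^+ (2 ^ n); have gI : integers L g := integers_expr _ aI.
have tg t : t \in N -> t g = z ^+ (ka t * 2 ^ n) * g.
  by move=> tN; rewrite rmorphXn /= (kummer_kaE tN) exprMn -exprM.
have Md x : (M %| x * 2 ^ n)%N = (2 ^ (m - n) %| x)%N.
  have -> : M = (2 ^ (m - n) * 2 ^ n)%N by rewrite -expnD subnK // ltnW.
  by rewrite dvdn_pmul2r // expn_gt0.
have gK : integers K g.
  split; last exact: gI.2.
  apply/mem_K; split; first exact: gI.1.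
  move=> t tG; have [tN tk] := (GP t).1 tG; rewrite tg //.
  have /eqP -> : z ^+ (ka t * 2 ^ n) == 1.
    by rewrite -(prim_order_dvd zprim) Md.
  by rewrite mul1r.
have := good_fixed gP gI (prime_expr_notin pP aI nPa) (tg s sN) (h g gK).
by move=> /eqP; rewrite -(prim_order_dvd zprim) Md.
Qed.

Definition frobK P s := s \in G /\ frob_at P (nrmK P) s.

Lemma frobK_unique P s t : good_prime P -> frobK P s -> frobK P t -> s = t.
Proof.
move=> gP [sG hs] [tG ht]; have [pP _ _] := gP.
apply: (frob_at_unique FL pP _ (sub_GN sG) (sub_GN tG) hs ht) => u uN.
exact: good_inert gP uN.
Qed.

Lemma frobK_conj P s t : good_prime P -> t \in N -> frobK P s -> frobK (conjp t P) s.
Proof.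
move=> [pP _ _] tN [sG hs]; split=> //; rewrite nrmK_conj //.
have := frob_at_conj t pP hs.
by rewrite /conjg -(kummer_comm tN (sub_GN sG)) mulKg.
Qed.

(** That s^f lies in G comes from uniqueness: a Frobenius over K exists in G and satisfies the same
    congruence, and the inertia in N is trivial. *)
Lemma frobK_power P s : good_prime P -> s \in N -> frob_at P (nrmF P) s ->
  exists f, [/\ (0 < f)%N, nrmK P = (nrmF P ^ f)%N, frobK P (s ^+ f)%g &
    forall j, (0 < j)%N -> (s ^+ j)%g \in G -> (f <= j)%N].
Proof.
move=> gP sN hs; have [pP _ _] := gP.
have [f [f0 fE fr fmin]] := frobenius_power galL FK KL pP sN hs.
exists f; split=> //; last by move=> j j0 sj; apply: fmin; rewrite // gal_LK.
split=> //.
have [t tF] := frobenius_exists galL KL pP; case: tF => tK ht.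
have tG : t \in G by rewrite -gal_LK.
rewrite (_ : (s ^+ f)%g = t) //.
apply: (frob_at_unique FL pP _ (groupX f sN) (sub_GN tG) fr ht) => u uN.
exact: good_inert gP uN.
Qed.

Lemma frobF_exists P : good_prime P -> exists2 s, s \in N & frob_at P (nrmF P) s.
Proof. by move=> [pP _ _]; have [s [sN hs]] := frobenius_exists galL FL pP; exists s. Qed.

Lemma dvdn_Zm_expg s d j : (d <= m)%N -> s \in N ->
  (2 ^ d %| ka (s ^+ j)%g)%N = (2 ^ d %| ka s * j)%N.
Proof.
move=> dm sN; rewrite kummer_kaX // -[X in X *+ _]natr_Zp -mulrnA val_Zp_nat //.
by rewrite /dvdn modn_dvdm // dvdn_exp2l.
Qed.

(** If t in N is a Frobenius over F, then s = t^f, so 2^(m-n+1) divides f ka(t). An even f could be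
    halved, against its minimality; an odd f leaves t itself in G, so f = 1. *)
Lemma frobK_norm_eq P s : good_prime P -> frobK P s ->
  (2 ^ (m - n).+1 %| ka s)%N -> nrmK P = nrmF P.
Proof.
move=> gP sK sk; have [t tN ht] := frobF_exists gP.
have [f [f0 fE fr fmin]] := frobK_power gP tN ht.
have e := frobK_unique gP sK fr.
have mn : ((m - n).+1 <= m)%N by rewrite -subSn ?(ltnW nm) // leq_subLR -add1n leq_add2r.
have mn' := leq_trans (leqnSn _) mn.
have tfG j : ((t ^+ j)%g \in G) = (2 ^ (m - n) %| ka t * j)%N.
  rewrite -dvdn_Zm_expg //; apply/idP/idP => [/GP[]//|h].
  by apply/GP; rewrite groupX.
move: sk; rewrite e dvdn_Zm_expg // => sk.
case fo : (odd f).
  have f1 : (f <= 1)%N.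
    apply: fmin => //; rewrite tfG muln1.
    have : (2 ^ (m - n) %| ka t * f)%N by apply: dvdn_trans sk; rewrite dvdn_exp2l.
    by rewrite Gauss_dvdl // coprimeXl // coprime2n.
  by rewrite fE (_ : f = 1)%N ?expn1 //; apply/eqP; rewrite eqn_leq f1.
have fh : f = (f./2 * 2)%N by rewrite muln2 -[LHS]odd_double_half fo.
have : (f <= f./2)%N.
  apply: fmin; first by move: f0; rewrite {1}fh muln_gt0 => /andP[].
  rewrite tfG; move: sk; rewrite {1}fh mulnA expnSr dvdn_pmul2r //.
by rewrite leqNgt ltn_half_double -addnn -{1}[f]addn0 ltn_add2l f0.
Qed.

(** As c need not preserve K, the norm over K of the conjugate prime is found by squeezing. It is at
    most [nrmK P] because s^c lies in G and has this Frobenius exponent; it is at least the norm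
    over F, which c preserves and which equals [nrmK P]. *)
Lemma frobK_transport P s : good_prime P -> frobK P s ->
  (2 ^ (m - n).+1 %| ka s)%N -> (s ^ c)%g \in G ->
  [/\ good_prime (conjp c P), frobK (conjp c P) (s ^ c)%g,
    nrmK (conjp c P) = nrmK P & nrmK (conjp c P) = nrmF (conjp c P)].
Proof.
move=> gP sK sk scG; have e := frobK_norm_eq gP sK sk.
have [pP _ _] := gP; have [sG hs] := sK.
have gP' := good_conj c gP; have [pP' _ _] := gP'.
have fr := frob_at_conj c pP hs.
have nF : nrmF (conjp c P) = nrmF P by apply: nrmF_conj.
have scK : (s ^ c)%g \in 'Gal(L / K)%g by rewrite gal_LK.
have le : (nrmK (conjp c P) <= nrmK P)%N.
  exact: (ideal_norm_le galL KL pP' (ideal_norm_gt1 galL KL pP) scK fr).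
have ge : (nrmF (conjp c P) <= nrmK (conjp c P))%N.
  have [f f0 fE] := ideal_norm_power galL FK KL pP'.
  rewrite [nrmK _]fE -[X in (X <= _)%N]expn1 leq_exp2l //.
  exact: (ideal_norm_gt1 galL FL pP').
have eK : nrmK (conjp c P) = nrmK P.
  by apply/eqP; rewrite eqn_leq le e -nF ge.
by split=> //; rewrite ?nF -?e //; split=> //; rewrite eK.
Qed.

(** When the two norms agree, integers of K are congruent modulo P to integers of F, which s fixes.
    Hence an s stabilising P acts trivially on the residues of K. *)
Lemma good_decomposition P s : good_prime P -> nrmK P = nrmF P -> s \in N ->
  conjp s P = P -> s \in G.
Proof.
move=> gP e sN sP; apply: (good_inertK gP sN) => x xK.
have [pP _ _] := gP; have [PL _ Plin _ _] := pP.
have [y yF Pxy] := ideal_norm_eq_lift galL FK KL pP e xK.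
have Psxy : P (s (x - y)) by rewrite -{1}sP; apply/conjpE => //; exact: (PL _ Pxy).1.
have -> : s x - x = -1 * (x - y) + s (x - y).
  by rewrite rmorphB /= (mem_galP s FL sN _ yF.1); ring.
apply: Plin => //.
by split; [rewrite rpredN mem1v | apply/integral_opp/integral1].
Qed.

(** As ka(s) is odd, s^f in G forces 2^(m-n) | f; the even kb(s) supplies the additional factor 2,
    and n < m excludes f = 1. *)
Lemma frobK_extra P s : good_prime P -> s \in N -> frob_at P (nrmF P) s ->
  odd (ka s) -> ~~ odd (kb s) ->
  exists2 t, frobK P t & (2 ^ (m - n).+1 %| kb t)%N /\ nrmK P <> nrmF P.
Proof.
move=> gP sN hs oa eb; have [f [f0 fE fr fmin]] := frobK_power gP sN hs.
have [pP _ _] := gP.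
have mn' : (m - n <= m)%N by apply: leq_subr.
have fG := (GP _).1 fr.1.
have df : (2 ^ (m - n) %| f)%N.
  have := fG.2; rewrite dvdn_Zm_expg // Gauss_dvdr //.
  by rewrite coprimeXl // coprime2n.
exists (s ^+ f)%g => //; split.
  have mn : ((m - n).+1 <= m)%N by rewrite -subSn ?(ltnW nm) // leq_subLR -add1n leq_add2r.
  rewrite kummer_kbX // -[X in X *+ _]natr_Zp -mulrnA val_Zp_nat //.
  rewrite /dvdn modn_dvdm ?dvdn_exp2l // -/(dvdn _ _) expnS dvdn_mul //.
  by rewrite dvdn2 (negPf eb).
have F1 := ideal_norm_gt1 galL FL pP.
rewrite fE => /eqP; rewrite -{2}(expn1 (nrmF P)) eqn_exp2l // => /eqP f1.
move: df; rewrite f1 dvdn1 => /eqP /(congr1 (logn 2)).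
by rewrite pfactorK // logn1 => /eqP; rewrite subn_eq0 leqNgt nm.
Qed.

Local Open Scope classical_set_scope.

Definition goodp (p : set E) : Prop := [/\ is_nonzero_prime K p, ~ p 2%:R & ~ p q%:R].

Let above := Defs.prime_above K L.

Lemma above_prime p : is_nonzero_prime K p -> is_prime_above K L p (above p).
Proof.
move=> pp; have [P PP] := reduction_lying_over galL KL pp.
by rewrite /above /Defs.prime_above; case: xgetP => [Q _ //|/(_ P)].
Qed.

Lemma goodp_above p P : goodp p -> is_prime_above K L p P -> good_prime P.
Proof.
move=> [pp n2 nq] [pP PE]; split=> // Pn; [apply: n2|apply: nq]; rewrite -PE; split=> //;
  by split; [exact: rpred_nat | exact: integral_nat].
Qed.

Lemma goodp_below P : good_prime P -> goodp (P `&` integers K).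
Proof.
move=> [pP n2 nq]; split=> [|[]//|[]//]; exact: (prime_below galL KL pP).
Qed.

Lemma above_transitive p P P' : is_prime_above K L p P -> is_prime_above K L p P' ->
  exists2 t, t \in G & P' = conjp t P.
Proof.
move=> [pP PE] [pP' PE'].
have [|t tG tP] := primes_transitive galL KL pP pP'; first by rewrite PE PE'.
by exists t => //; rewrite -gal_LK.
Qed.

Lemma frobK_above p P P' s : goodp p -> is_prime_above K L p P ->
  is_prime_above K L p P' -> frobK P s -> frobK P' s.
Proof.
move=> gp PP PP'; have [t tG ->] := above_transitive PP PP'.
by apply: frobK_conj; [exact: goodp_above gp PP | exact: sub_GN].
Qed.

Definition frobp (p : set E) (s : gal_of L) : Prop := goodp p /\ frobK (above p) s.

Variable R : realType.

Lemma good_frobenius_mean p s : goodp p ->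
  frobenius_mean R K [set s]%SET p = (`[< frobp p s >])%:R.
Proof.
move=> gp; have [pp _ _] := gp; have [pP PE] := above_prime pp.
have gP := goodp_above gp (above_prime pp).
rewrite /frobenius_mean -/above.
have -> : inertia K L (above p) = [set 1%g]%SET :> {set gal_of L}.
  apply/setP => t; rewrite !inE; apply/andP/eqP => [[tK /asboolP h]|->].
    by apply: good_inert gP _ h; apply: sub_GN; rewrite -gal_LK.
  split; first exact: group1.
  by apply/asboolP => x _; rewrite gal_id subrr; case: pP => _ [].
rewrite big_set1 cards1 divr1 mulg1 inE; congr (_%:R); congr nat_of_bool.
have [t tF] := frobenius_exists galL KL pP; rewrite PE in tF.
have fK : frobK (above p) (frobenius K L p (above p)).
  rewrite /frobenius; case: xgetP => [u _ [uK hu]|/(_ t)//].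
  by split; [rewrite -gal_LK | rewrite /nrmK PE].
apply/eqP/asboolP => [<-|[_ sF]]; first by split.
exact: frobK_unique gP fK sF.
Qed.

Lemma frobenius_mean_ge0 (D : {set gal_of L}) p : 0 <= frobenius_mean R K D p.
Proof. by rewrite /frobenius_mean divr_ge0 ?ler0n ?sumr_ge0. Qed.

Lemma frobenius_mean_le1 (D : {set gal_of L}) p : frobenius_mean R K D p <= 1.
Proof.
rewrite /frobenius_mean; set I := inertia _ _ _.
have [->|I0] := eqVneq #|I| 0%N; first by rewrite invr0 mulr0 ler01.
rewrite ler_pdivrMr ?ltr0n ?lt0n // mul1r -sum1_card natr_sum.
by apply: ler_sum => t _; rewrite ler_nat leq_b1.
Qed.

Lemma prime_contains_norm p : is_nonzero_prime K p ->
  exists l, [/\ prime l, (l <= ideal_norm K p)%N & p l%:R].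
Proof.
move=> pp; have [P [pP PE]] := reduction_lying_over galL KL pp.
have [l [pl Pl]] := prime_over_rational galL (subvv L) pP.
exists l; split=> //; first by rewrite -PE; exact: (prime_norm_ge galL KL pP pl Pl).
by rewrite -PE; split=> //; split; [exact: rpred_nat | exact: integral_nat].
Qed.

Lemma prime_unique p l l' : is_nonzero_prime K p -> prime l -> prime l' ->
  p l%:R -> p l'%:R -> l = l'.
Proof.
move=> pp pl pl' ppl ppl'; have [P [pP PE]] := reduction_lying_over galL KL pp.
have Pl : P l%:R by move: ppl; rewrite -PE => -[].
have Pl' : P l'%:R by move: ppl'; rewrite -PE => -[].
by have /(prime_contains_dvd _ pP pl Pl) := Pl'; rewrite dvdn_prime2 // => /eqP.
Qed.

Lemma finite_norm_le N0 :
  finite_set [set p | is_nonzero_prime K p /\ (ideal_norm K p <= N0)%N].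
Proof.
apply: sub_finite_set (finite_primes_over galL N0 KL) => p [pp le]; split=> //.
have [l [pl ll lp]] := prime_contains_norm pp.
by exists l; split=> //; exact: leq_trans ll le.
Qed.

Lemma finite_bad : finite_set [set p | is_nonzero_prime K p /\ ~ goodp p].
Proof.
apply: sub_finite_set (finite_primes_over galL (q + 2) KL) => p [pp ng]; split=> //.
have [p2|n2] := EM (p 2%:R); first by exists 2%N; split=> //; rewrite leq_addl.
have [p2|nq] := EM (p q%:R); first by exists q; split=> //; rewrite leq_addr.
by case: ng.
Qed.

(** The inequality of norms says that p has residue degree greater than 1 over F. *)
Definition extra (s : gal_of L) (p : set E) : Prop :=
  frobp p s /\ ideal_norm K p <> ideal_norm F (p `&` integers F).

Lemma below_F P : P `&` integers K `&` integers F = P `&` integers F.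
Proof.
apply/seteqP; split=> x; first by move=> [[]].
move=> [Px xF]; split=> //; split=> //.
by split; [apply: (subvP FK); exact: xF.1 | exact: xF.2].
Qed.

Lemma infinite_extra : exists s, [/\ s \in G, (2 ^ (m - n).+1 %| kb s)%N &
  infinite_set (extra s)].
Proof.
apply: contrapT => nex.
pose X := \bigcup_(s in [set s | s \in G /\ (2 ^ (m - n).+1 %| kb s)%N]) extra s.
have Xfin : finite_set X.
  apply: bigcup_finite => [|s [sG sk]]; first exact: sub_finite_set (@finite_finset _ setT).
  by apply: contrapT => inf; apply: nex; exists s.
pose g (p : set E) := xget 0%N [set l | prime l /\ p l%:R].
pose B := (\max_(p <- fset_set X) g p)%N.
have [l [P [s [pl Bl Pl gP [sN hs oa eb]]]]] := exists_good_prime B.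
have [t tF [tk ne]] := frobK_extra gP sN hs oa eb.
have [pP _ _] := gP; have gp := goodp_below gP; have [pp _ _] := gp.
have Xp : X (P `&` integers K).
  exists t; first by split=> //; case: tF.
  split; last by rewrite below_F.
  by split=> //; exact: (frobK_above gp (conj pP erefl) (above_prime pp) tF).
have pl' : (P `&` integers K) l%:R.
  by split=> //; split; [exact: rpred_nat | exact: integral_nat].
have gl : g (P `&` integers K) = l.
  rewrite /g; case: xgetP => [l' _ [pl'' lP]|/(_ l)[]//].
  exact: prime_unique pp pl'' pl lP pl'.
have : (g (P `&` integers K) <= B)%N.
  rewrite /B (big_rem (P `&` integers K)) /= ?leq_maxl //.
  by rewrite in_fset_set //; exact: mem_set.
by rewrite gl leqNgt Bl.
Qed.

(** * The norm-preserving injection *)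

Section Injection.

Variables s1 s2 : gal_of L.
Hypotheses (s1G : s1 \in G) (s2G : s2 \in G).
Hypothesis s12 : s1 = (s2 ^ c)%g.
Hypothesis s2k : (2 ^ (m - n).+1 %| ka s2)%N.

(** The choice depends on p only through its restriction to F; injectivity relies on primes with
    equal restriction sharing it. *)
Let P0 (p : set E) := Defs.prime_above F L (p `&` integers F).

Lemma P0P p : is_nonzero_prime K p -> is_prime_above F L (p `&` integers F) (P0 p).
Proof.
move=> pp; have [P [pP PE]] := reduction_lying_over galL KL pp.
have pF : is_nonzero_prime F (p `&` integers F).
  by rewrite -PE below_F; exact: (prime_below galL FL pP).
have [Q QP] := reduction_lying_over galL FL pF.
by rewrite /P0 /Defs.prime_above; case: xgetP => [Q' _ //|/(_ Q)].
Qed.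

(* As c does not normalise G, it does not act on the primes of K.  Fixing a prime P0
   above each prime of F, the prime p of K below t P0, with t in N, is sent instead to
   the prime below t c P0.  This is injective where the decomposition group of c P0
   in N is contained in G. *)
Let mover (p : set E) := xget 1%g [set t | t \in N /\ above p = conjp t (P0 p)].

Lemma moverP p : is_nonzero_prime K p -> mover p \in N /\ above p = conjp (mover p) (P0 p).
Proof.
move=> pp; have [pP PE] := P0P pp; have [pA AE] := above_prime pp.
have [|t tN tE] := primes_transitive galL FL pP pA.
  by rewrite PE -[in RHS]AE below_F.
by rewrite /mover; case: xgetP => [u _ //|/(_ t)[]].
Qed.

Definition frob_swap (p : set E) : set E :=
  conjp (mover p) (conjp c (P0 p)) `&` integers K.

Lemma frob_swap_P0 p : frobp p s2 -> [/\ good_prime (P0 p),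
  good_prime (conjp c (P0 p)), frobK (conjp c (P0 p)) s1,
  nrmK (conjp c (P0 p)) = ideal_norm K p &
  nrmK (conjp c (P0 p)) = nrmF (conjp c (P0 p))].
Proof.
move=> [gp fr]; have [pp _ _] := gp; have [mN mE] := moverP pp.
have [pA AE] := above_prime pp; have gA := goodp_above gp (above_prime pp).
have [[PL _ _ _ _] _] := P0P pp.
have PE : P0 p = conjp (mover p)^-1%g (above p).
  by rewrite mE conjpM mulgV conjp1.
have gP : good_prime (P0 p) by rewrite PE; apply: good_conj.
have mVN : (mover p)^-1%g \in N by rewrite groupV.
have f0 : frobK (P0 p) s2 by rewrite PE; apply: frobK_conj.
have [|g' f' e1 e2] := frobK_transport gP f0 s2k; first by rewrite -s12.
split=> //; first by rewrite s12.
by rewrite e1 PE nrmK_conj // /nrmK AE.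
Qed.

Lemma frob_swap_frobp p : frobp p s2 ->
  [/\ is_nonzero_prime K (frob_swap p), frobp (frob_swap p) s1,
    ideal_norm K (frob_swap p) = ideal_norm K p &
    ideal_norm K (frob_swap p) = ideal_norm F (frob_swap p `&` integers F)].
Proof.
move=> fp; have [g0 g1 f1 e1 e2] := frob_swap_P0 fp.
have [[pp _ _] _] := fp; have [mN mE] := moverP pp.
have gQ := good_conj (mover p) g1; have [pQ _ _] := gQ; have [p1 _ _] := g1.
have gS := goodp_below gQ; have [pS _ _] := gS.
have eS : nrmK (conjp (mover p) (conjp c (P0 p))) = ideal_norm K p.
  by rewrite nrmK_conj.
split=> //.
  split=> //.
  exact: (frobK_above gS (conj pQ erefl) (above_prime pS) (frobK_conj g1 mN f1)).
rewrite /frob_swap below_F -/(nrmK _) -/(nrmF _) eS -e1 e2.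
by rewrite [in RHS]nrmF_conj.
Qed.

Lemma frob_swap_inj p p' : frobp p s2 -> frobp p' s2 ->
  frob_swap p = frob_swap p' -> p = p'.
Proof.
move=> fp fp' e; have [g0 g1 f1 e1 e2] := frob_swap_P0 fp.
have [[pp _ _] _] := fp; have [mN mE] := moverP pp.
have [[pp' _ _] _] := fp'; have [mN' mE'] := moverP pp'.
have [g0' g1' _ _ _] := frob_swap_P0 fp'.
have [p0 _ _] := g0; have [p1 _ _] := g1.
have [p0' _ _] := g0'; have [p1' _ _] := g1'.
have [_ PE] := P0P pp; have [_ PE'] := P0P pp'.
have eF : conjp c (P0 p) `&` integers F = conjp c (P0 p') `&` integers F.
  have := congr1 (fun X => X `&` integers F) e; rewrite /frob_swap !below_F.
  by rewrite (conjp_below _ FL mN) (conjp_below _ FL mN').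
have ccE (P : set E) : is_nonzero_prime L P -> conjp c (conjp c P) = P.
  by move=> [PL _ _ _ _]; rewrite conjpM kummer_cc conjp1.
have eF0 : p `&` integers F = p' `&` integers F.
  rewrite -PE -PE' -(ccE _ p0) -(ccE _ p0').
  have stab x : x \in F -> (c^-1)%g x \in F by apply: kummer_conjF; exact: mem_gal1.
  have L1 : conjp c (P0 p) `<=` integers L by case: p1.
  have L1' : conjp c (P0 p') `<=` integers L by case: p1'.
  by rewrite (@conjp_below_stable _ _ F c _ FL stab L1) (@conjp_below_stable _ _ F c _ FL stab L1') eF.
have P00 : P0 p' = P0 p by rewrite /P0 eF0.
rewrite /frob_swap P00 in e.
have pQ := conjp_prime (mover p) p1; have pQ' := conjp_prime (mover p') p1.
have [t tK tE] := primes_transitive galL KL pQ pQ' (esym e).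
have tG : t \in G by rewrite -gal_LK.
have tN := sub_GN tG.
(* This element stabilises c P0, hence lies in G; N being abelian, the factor t of G can then be
   removed. *)
have uG : (mover p * t * (mover p')^-1)%g \in G.
  apply: (good_decomposition g1); first by rewrite e1 -e2.
    by rewrite !groupM ?groupV.
  have [PL _ _ _ _] := p1.
  by rewrite -!conjpM -tE conjpM mulgV conjp1.
have mG : (mover p * (mover p')^-1)%g \in G.
  move: uG; rewrite -mulgA (kummer_comm tN) ?groupV // mulgA.
  by rewrite groupMr.
have [_ AE] := above_prime pp; have [_ AE'] := above_prime pp'.
rewrite -AE -AE' mE mE' P00.
have -> : mover p = (mover p' * (mover p * (mover p')^-1))%g.
  by rewrite mulgA (kummer_comm mN' mN) mulgK.
by rewrite -conjpM conjp_below // gal_LK.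
Qed.

End Injection.

Lemma dvdn_ZmN d (x : Zm) : (d <= m)%N -> (2 ^ d %| x)%N -> (2 ^ d %| (- x)%R)%N.
Proof.
move=> dm dx; have -> : - x = (x * M.-1)%:R.
  apply/eqP; rewrite eq_sym -subr_eq0 opprK -[X in _ + X]natr_Zp -natrD.
  rewrite -mulnSr prednK ?(ltnW M1) // -(natr_Zp 0) -(inj_eq val_inj) /=.
  by rewrite val_Zp_nat // modnMl.
by rewrite val_Zp_nat // /dvdn modn_dvdm ?dvdn_exp2l // -/(dvdn _ _) dvdn_mulr.
Qed.

Lemma sum_bool_count (a : seq (set E)) (b : pred (set E)) :
  \sum_(p <- a) (b p)%:R = (count b a)%:R :> R.
Proof.
by rewrite -natr_sum -sum1_count [in RHS]big_mkcond; congr (_%:R).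
Qed.

Lemma kummer_bias : exists s1 s2 : gal_of L,
  [/\ s1 \in G, s2 \in G & extreme_chebyshev_bias R K [set s1]%SET [set s2]%SET].
Proof.
have [s1 [s1G s1k inf]] := infinite_extra.
pose s2 := (s1 ^ c)%g; have s1N := sub_GN s1G.
have mn : ((m - n).+1 <= m)%N by rewrite -subSn ?(ltnW nm) // leq_subLR -add1n leq_add2r.
have s2k : (2 ^ (m - n).+1 %| ka s2)%N by rewrite kummer_ka_conj //; apply: dvdn_ZmN.
have s2G : s2 \in G.
  apply/GP; split; first exact: kummer_conjN.
  by apply: dvdn_trans s2k; rewrite dvdn_exp2l.
have s12 : s1 = (s2 ^ c)%g by rewrite /s2 -conjgM kummer_cc conjg1.
exists s1, s2; split=> //.
have cls s : s \in G -> [set s]%SET \in classes 'Gal(L / K)%g.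
  move=> sG; rewrite gal_LK; apply/imsetP; exists s => //.
  have abG : abelian G.
    apply/centsP => t tG u uG; apply: kummer_comm; exact: sub_GN.
  by rewrite (abelian_classP _ abG).

split; [exact: fixedField_galois | exact: cls | exact: cls | left].
pose Bad := [set p | is_nonzero_prime K p /\ ~ goodp p].
(* X has more members than there are bad primes, each of which contributes at most 1. Once x exceeds
   N0, the largest norm in X, all of X is counted. *)
have [X XE Xn] := infinite_set_fset (#|` fset_set Bad|).+1 inf.
pose N0 := (\max_(p <- enum_fset X) ideal_norm K p)%N.
exists N0%:R; split; first exact: num_real.
move=> x xN; rewrite /chebyshev_diff !cards1 divr1 -mulrBr mulr_gt0 //.
  by rewrite ltr0n cardG_gt0.
pose A := [set p | is_nonzero_prime K p /\ (ideal_norm K p)%:R <= x].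
have Afin : finite_set A.
  have x0 : 0 <= x by apply: le_trans (ltW xN); rewrite ler0n.
  apply: sub_finite_set (finite_norm_le (Num.bound x)) => p [pp le]; split=> //.
  rewrite -(@ler_nat R); apply: le_trans le _; apply: ltW.
  exact: archi_boundP.
have AP p : p \in fset_set A -> A p by rewrite in_fset_set // => /set_mem.
rewrite /prime_count -/A !fsbig_finite //= subr_gt0.
pose b s (p : set E) := `[< frobp p s >].
pose bad (p : set E) := `[< ~ goodp p >].
set a := fset_set A in AP *.
have h1 : (count (b s1) a)%:R <= \sum_(p <- a) frobenius_mean R K [set s1]%SET p.
  rewrite -sum_bool_count; apply: ler_sum => p _; rewrite /b.
  case: (asboolP (frobp p s1)) => [fp|nf]; last exact: frobenius_mean_ge0.
  by rewrite (good_frobenius_mean _ fp.1) asboolT.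
have h2 : \sum_(p <- a) frobenius_mean R K [set s2]%SET p <=
    (count (b s2) a + count bad a)%:R.
  rewrite natrD -!sum_bool_count -big_split /=; apply: ler_sum => p _.
  have [gp|ng] := EM (goodp p).
    by rewrite good_frobenius_mean // lerDl ler0n.
  apply: le_trans (frobenius_mean_le1 _ _) _.
  have -> : bad p by apply/asboolP.
  by rewrite lerDr ler0n.
apply: le_lt_trans h2 _; apply: lt_le_trans _ h1; rewrite ltr_nat.
have cb0 : (count bad a <= #|` fset_set Bad|)%N.
  rewrite -size_filter; apply: uniq_leq_size; first exact: filter_uniq (fset_uniq _).
  move=> p; rewrite mem_filter => /andP[/asboolP ng /AP[pp _]].
  by rewrite in_fset_set ?mem_set //; exact: finite_bad.
(* The images under [frob_swap] have residue degree 1 over F and the members of X do not, so the two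
   lists are disjoint and both count towards s1. *)
pose u := [seq frob_swap p | p <- a & b s2 p] ++ enum_fset X.
have uU : uniq u.
  rewrite cat_uniq map_inj_in_uniq ?filter_uniq ?fset_uniq //=; last first.
    move=> p p'; rewrite !mem_filter => /andP[/asboolP fp _] /andP[/asboolP fp' _].
    exact: (frob_swap_inj s1G s12 s2k fp fp').
  rewrite andbT; apply/hasPn => p pX; apply/negP => /mapP[p'].
  rewrite mem_filter => /andP[/asboolP fp' _] pE.
  have [_ ne] := XE _ pX; apply: ne; rewrite pE.
  by have [] := frob_swap_frobp s1G s12 s2k fp'.
have uS : {subset u <= [seq p <- a | b s1 p]}.
  move=> p; rewrite mem_cat mem_filter => /orP[/mapP[p']|pX].
    rewrite mem_filter => /andP[/asboolP fp' /AP[_ le]] ->.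
    have [pp fp e _] := frob_swap_frobp s1G s12 s2k fp'.
    apply/andP; split; first exact/asboolP.
    by rewrite in_fset_set //; apply: mem_set; split; rewrite ?e.
  have [fp _] := XE _ pX; apply/andP; split; first exact/asboolP.
  rewrite in_fset_set //; apply: mem_set; split; first by case: fp => -[].
  apply: le_trans (ltW xN); rewrite ler_nat /N0 (big_rem p) //=.
  exact: leq_maxl.
have := uniq_leq_size uU uS; rewrite size_cat size_map !size_filter => le.
apply: leq_trans le; rewrite -addnS leq_add2l.
by apply: leq_trans Xn; rewrite ltnS.
Qed.
End ChebyshevSubgroup.
End KummerGroup.

(** * Complex conjugation and the main theorem *)

Section RootsOfUnity.

Variable R : realType.

Lemma zeta_sqr n : (0 < n)%N -> zeta R (2 * n) ^+ 2 = zeta R n.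
Proof.
move=> n0; rewrite /zeta.
have n0' : n%:R != 0 :> R by rewrite pnatr_eq0 -lt0n.
have -> : 2 * pi / n%:R = 2 * pi / (2 * n)%:R + 2 * pi / (2 * n)%:R :> R.
  by rewrite natrM; field.
rewrite cosD sinD expr2; congr Complex; ring.
Qed.

Lemma zeta_expr j n : (0 < n)%N -> zeta R (2 ^ j * n) ^+ (2 ^ j) = zeta R n.
Proof.
move=> n0; elim: j => [|j IH]; first by rewrite mul1n expr1.
by rewrite expnS exprM -mulnA zeta_sqr ?IH // muln_gt0 expn_gt0.
Qed.

Lemma zeta2 : zeta R 2 = -1.
Proof.
rewrite /zeta mulrAC divff ?pnatr_eq0 // mul1r cospi sinpi.
by apply/eqP; rewrite eq_complex /= oppr0 !eqxx.
Qed.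

Lemma zeta4 : zeta R 4 = (0 +i* 1)%C.
Proof.
rewrite /zeta; have -> : 2 * pi / 4%:R = pi / 2 :> R by field.
by rewrite cos_pihalf sin_pihalf.
Qed.

Lemma zeta_conj n : zeta R n * conjc (zeta R n) = 1.
Proof.
rewrite /zeta; apply/eqP; rewrite eq_complex /= mulrN opprK -!expr2 cos2Dsin2 eqxx /=.
by rewrite mulrN mulrC addNr.
Qed.

End RootsOfUnity.

Section EmbeddedConjugation.

Variables (R : realType) (E : splittingFieldType rat) (iota : {rmorphism E -> R[i]}).

Lemma pchar0_rat_ext : has_pchar0 E.
Proof. by move=> p; rewrite pchar_lalg pchar_num. Qed.

Lemma separable_rat (K L : {subfield E}) : separable K L.
Proof. by apply/separableP => x _; apply: pcharf0_separable pchar0_rat_ext x. Qed.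

Lemma conjc_rat (x : E) : x \in 1%VS -> conjc (iota x) = iota x.
Proof.
by move=> /vlineP[r ->]; rewrite rmorphZ_num rmorph1 mulr1 fmorph_rat.
Qed.

(** L is generated by one element t. The conjugate of iota t is a root of the rational minimal
    polynomial of t, all of whose roots come from Galois conjugates of t. *)
Lemma exists_conjugation (L : {subfield E}) : galois 1 L ->
  exists c : gal_of L, {in L, forall x, iota (c x) = conjc (iota x)}.
Proof.
move=> galL; have L1 : (1 <= L)%VS := sub1v L.
have LE := eq_adjoin_separable_generator (separable_rat 1 L) L1.
set t := separable_generator 1 L in LE.
have tL : t \in L by rewrite LE memv_adjoin.
have [r [_ _ rE]] := galois_factors L1 galL t tL.
have fixp (p : {poly E}) : p \is a polyOver 1%VS -> map_poly (conjc \o iota) p = map_poly iota p.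
  by move=> /polyOverP p1; apply/polyP => i; rewrite !coef_map_id0 ?rmorph0 //= conjc_rat.
have : root (map_poly iota (minPoly 1 t)) (conjc (iota t)).
  rewrite -fixp ?minPolyOver // map_poly_comp_id0 ?rmorph0 // fmorph_root fmorph_root.
  exact: root_minPoly.
rewrite rE rmorph_prod (eq_bigr (fun x => 'X - (iota x)%:P)); last first.
  by move=> x _; rewrite /= rmorphB /= map_polyX map_polyC.
rewrite -(big_map iota xpredT (fun y => 'X - y%:P)) root_prod_XsubC -map_comp.
move=> /mapP[c _ /= cE]; exists c => x; rewrite [in X in X -> _]LE.
move=> /Fadjoin_polyP[p p1 ->].
have -> : c p.[t] = p.[c t].
  rewrite -horner_map /=; congr (_.[_]); apply/polyP => i; rewrite coef_map /=.
  by have /vlineP[y ->] := polyOverP p1 i; rewrite linearZ /= rmorph1.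
rewrite -!(horner_map iota) /= -cE -[in LHS]fixp //.
by rewrite map_poly_comp_id0 ?rmorph0 // (horner_map conjc).
Qed.

End EmbeddedConjugation.

(** * Splitting fields of binomials *)

Section KummerSplittingFields.

Variables (E : splittingFieldType rat) (n : nat) (z : E).
Hypotheses (n0 : (0 < n)%N) (zprim : n.-primitive_root z).

Lemma mem_rootsP (w : E) (rs : seq E) x : 'X^n - w%:P %= \prod_(r <- rs) ('X - r%:P) ->
  (x \in rs) = (x ^+ n == w).
Proof.
move=> e; rewrite -root_prod_XsubC -(eqp_root e) rootE !hornerE.
by rewrite subr_eq0.
Qed.

Lemma splitting_root (K D : {subfield E}) w :
  splittingFieldFor K ('X^n - w%:P) D -> exists g, g ^+ n = w.
Proof.
case=> -[|g rs] e _; last by exists g; apply/eqP; rewrite -(mem_rootsP _ e) mem_head.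
have := eqp_size e; rewrite big_nil size_XnsubC // size_poly1 => -[n1].
by move: n0; rewrite n1.
Qed.

Lemma splitting_adjoin (K D : {subfield E}) w g : z \in K -> g != 0 ->
  splittingFieldFor K ('X^n - w%:P) D -> g ^+ n = w -> D = <<K; g>>%VS :> {vspace E}.
Proof.
move=> zK g0 [rs e <-] gw; have grs : g \in rs by rewrite (mem_rootsP _ e) gw.
apply/eqP; rewrite eqEsubv; apply/andP; split; last first.
  by apply/FadjoinP; rewrite seqv_sub_adjoin // subv_adjoin_seq.
apply/Fadjoin_seqP; split; first exact: subv_adjoin.
move=> x; rewrite (mem_rootsP _ e) => /eqP xw.
have : (x / g) ^+ n = 1 by rewrite expr_div_n gw xw divff // -gw expf_neq0.
move=> /(prim_rootP zprim)[i xi].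
rewrite -(divfK g0 x) xi rpredM ?memv_adjoin // (subvP (subv_adjoin _ _)) //.
by rewrite rpredX.
Qed.

(** The product of the two binomials has rational coefficients, and its roots generate the
    compositum already over Q: z is the quotient of the roots z g and g. *)
Lemma galois_splitting_prod (D1 D2 : {subfield E}) w w' : w != 0 ->
  w + w' \in 1%VS -> w * w' \in 1%VS ->
  splittingFieldFor <<1; z>>%VS ('X^n - w%:P) D1 ->
  splittingFieldFor <<1; z>>%VS ('X^n - w'%:P) D2 -> galois 1 (D1 * D2)%AS.
Proof.
move=> w0 ws wp h1 h2; have [g gw] := @splitting_root <<1; z>>%AS D1 w h1.
move: h1 h2 => [rs e1 E1] [rs' e2 E2].
have g0 : g != 0 by apply: contra w0 => /eqP g0; rewrite -gw g0 expr0n -leqn0 leqNgt n0.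
rewrite /galois sub1v separable_rat /=; apply/splitting_normalField; first exact: sub1v.
exists (('X^n - w%:P) * ('X^n - w'%:P)).
  have -> : ('X^n - w%:P) * ('X^n - w'%:P) = 'X^n ^+ 2 - (w + w')%:P * 'X^n + (w * w')%:P.
    by rewrite polyCD polyCM; ring.
  by rewrite rpredD ?rpredB ?rpredM ?rpredX ?polyOverC ?polyOverX.
exists (rs ++ rs').
  by rewrite big_cat /=; apply: eqp_trans (eqp_mulr _ e1) (eqp_mull _ e2).
apply/eqP; rewrite eqEsubv; apply/andP; split.
  apply/Fadjoin_seqP; split; first exact: sub1v.
  move=> x; rewrite mem_cat => /orP[] xr.
    apply: (subvP (field_subvMr D1 D2)); rewrite -E1 seqv_sub_adjoin //.
  apply: (subvP (field_subvMl D1 D2)); rewrite -E2 seqv_sub_adjoin //.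
have subA x : x \in rs ++ rs' -> x \in <<1 & rs ++ rs'>>%AS.
  by move=> xr; exact: seqv_sub_adjoin.
have grs : g \in <<1 & rs ++ rs'>>%AS.
  by apply: subA; rewrite mem_cat (mem_rootsP _ e1) gw eqxx.
have zA : z \in <<1 & rs ++ rs'>>%AS.
  have : z * g \in <<1 & rs ++ rs'>>%AS.
    apply: subA; rewrite mem_cat (mem_rootsP _ e1) exprMn gw.
    by rewrite (prim_expr_order zprim) mul1r eqxx.
  by move=> zg; rewrite -(mulfK g0 z) rpred_div.
have FA : (<<1; z>> <= <<1 & rs ++ rs'>>)%VS by apply/FadjoinP; rewrite sub1v.
apply: (prodv_sub (A := <<1 & rs ++ rs'>>%AS)).
  rewrite -E1; apply/(Fadjoin_seqP (K := <<1; z>>%AS)); split=> // x xr.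
  by apply: subA; rewrite mem_cat xr.
rewrite -E2; apply/(Fadjoin_seqP (K := <<1; z>>%AS)); split=> // x xr.
by apply: subA; rewrite mem_cat xr orbT.
Qed.

Lemma prodv_adjoin (K D1 D2 : {subfield E}) g : D2 = <<K; g>>%VS :> {vspace E} ->
  (K <= D1)%VS -> (D1 * D2)%VS = <<D1; g>>%VS.
Proof.
move=> D2E KD1; apply/eqP; rewrite eqEsubv; apply/andP; split.
  apply: prodv_sub; first exact: subv_adjoin.
  rewrite D2E; apply/FadjoinP; rewrite memv_adjoin.
  by rewrite (subv_trans KD1 (subv_adjoin _ _)).
apply/(FadjoinP (E := (D1 * D2)%AS)); rewrite field_subvMr; split=> //.
by apply: (subvP (field_subvMl D1 D2)); rewrite D2E memv_adjoin.
Qed.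

End KummerSplittingFields.

(** * The maximal totally real subfield *)

Section MaximalReal.

Variables (R : realType) (E : splittingFieldType rat) (iota : {rmorphism E -> R[i]}).
Variables (n : nat) (z : E) (L F k : {subfield E}) (c : gal_of L).
Hypothesis zprim : n.-primitive_root z.
Hypothesis galL : galois 1 L.
Hypothesis FE : F = <<1; z>>%VS :> {vspace E}.
Hypothesis FL : (F <= L)%VS.
Hypothesis cE : {in L, forall x, iota (c x) = conjc (iota x)}.
Hypothesis cz : c z = z^-1.

Lemma conjc_Num_real (x : R[i]) : (x \is Num.real) = (conjc x == x).
Proof.
case: x => u v; by rewrite complex_real eq_complex /= eqxx eqNr.
Qed.

Lemma galois_rat_horner (p : {poly E}) x (s : gal_of L) : p \is a polyOver 1%VS ->
  s p.[x] = p.[s x].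
Proof.
move=> p1; rewrite -horner_map /=; congr (_.[_]); apply/polyP => i; rewrite coef_map /=.
by have /vlineP[y ->] := polyOverP p1 i; rewrite linearZ /= rmorph1.
Qed.

Lemma galois_cyclotomic_comm (s : gal_of L) x : x \in F -> c (s x) = s (c x).
Proof.
rewrite FE => /(Fadjoin_polyP (K := 1%AS))[p p1 ->].
rewrite !galois_rat_horner // cz fmorphV /=.
have : (s z) ^+ n = 1 by rewrite -rmorphXn /= (prim_expr_order zprim) rmorph1.
by move=> /(prim_rootP zprim)[i ->]; rewrite rmorphXn /= cz exprVn.
Qed.

(** Any embedding sends x to iota (s x) for some Galois element s. On the abelian field F, c
    commutes with s, so c fixes s x along with x. *)
Lemma real_subfield_totally_real (M : {subfield E}) : (M <= F)%VS ->
  (forall x, x \in M -> c x = x) -> totally_real R M.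
Proof.
move=> MF fx f x; have xM := subvsP x; have xF := subvP MF _ xM.
have xL := subvP FL _ xF.
have [r [_ _ rE]] := galois_factors (sub1v L) galL _ xL.
have /polyOver1P[p pE] := minPolyOver 1 (vsval x).
have px : root (map_poly (in_alg (subvs_of M)) p) x.
  rewrite rootE; apply/eqP/val_inj; rewrite -(horner_map vsval).
  rewrite -map_poly_comp /= (eq_map_poly (g := in_alg E)).
    by apply/eqP; rewrite -pE -rootE root_minPoly.
  by move=> y; rewrite (fmorph_eq_rat (vsval \o in_alg _)) (fmorph_eq_rat (in_alg E)).
have := fmorph_root f (map_poly (in_alg (subvs_of M)) p) x; rewrite px.
rewrite -map_poly_comp /= (eq_map_poly (g := iota \o in_alg E)); last first.
  by move=> y /=; rewrite !rmorphZ_num !rmorph1.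
rewrite map_poly_comp -pE rE rmorph_prod (eq_bigr (fun y => 'X - (iota y)%:P)); last first.
  by move=> y _; rewrite /= rmorphB /= map_polyX map_polyC.
rewrite -(big_map iota xpredT (fun y => 'X - y%:P)) root_prod_XsubC -map_comp.
move=> /mapP[s _ /= ->]; rewrite conjc_Num_real -cE ?memv_gal //.
by rewrite galois_cyclotomic_comm // fx.
Qed.

(** The embedding iota alone shows that c fixes k pointwise. The subfield [k0] of F fixed by c thus
    contains k and is totally real, so maximality gives equality. *)
Lemma maximal_totally_real_fixed : is_maximal_totally_real R <<1; z>>%VS k ->
  forall x, x \in k <-> x \in F /\ c x = x.
Proof.
rewrite -FE => -[kF kR kmax].
have kc x : x \in k -> c x = x.
  move=> xk; apply: (fmorph_inj iota); rewrite cE ?(subvP FL) ?(subvP kF) //; apply/eqP.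
  by rewrite -conjc_Num_real; exact: (kR (iota \o vsval) (Subvs xk)).
pose k0 := fixedField_aspace ('Gal(L / F)%g :|: [set c])%SET.
have k0P x : x \in k0 <-> x \in F /\ c x = x.
  split=> [/mem_fixedFieldP[xL fx]|[xF cx]].
    split; last by apply: fx; rewrite inE set11 orbT.
    by apply: (mem_fixed_gal galL FL xL) => s sF; apply: fx; rewrite inE sF.
  apply/fixedFieldP; first exact: (subvP FL).
  by move=> s; rewrite inE => /orP[sF|/set1P -> //]; exact: (mem_galP s FL sF).
have <- : k0 = k; last exact: k0P.
apply: kmax.
- by apply/subvP => x xk; apply/k0P; rewrite (subvP kF) // kc.
- by apply/subvP => x /k0P[].
by apply: real_subfield_totally_real => [|x /k0P[]//]; apply/subvP => x /k0P[].
Qed.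

End MaximalReal.

Lemma integral_root_constant (E : splittingFieldType rat) n (x w : E) : (0 < n)%N ->
  integralOver (intr : int -> E) w -> x ^+ n = w -> integralOver (intr : int -> E) x.
Proof.
move=> n0 wI xw; apply: (integral_root_monic (p := 'X^n - w%:P)).
- exact: monicXnsubC.
- by rewrite rootE !hornerE xw subrr.
move=> y /(nthP 0)[i _ <-]; rewrite coefB coefXn coefC.
apply: integral_sub; first exact: integral_nat.
by case: ifP => // _; exact: mxpoly.integral0.
Qed.

Theorem theorem1p8
  (R : realType) (E : splittingFieldType rat) (iota : {rmorphism E -> R[i]})
  (m q a b : nat) (z w w' : E) (k D1 D2 : {subfield E})
  (hm : (2 <= m)%N)
  (hz : iota z = zeta R (2 ^ m))
  (hk : is_maximal_totally_real R <<1; z>>%VS k)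
  (hq5 : (5 <= q)%N) (hq : prime q) (hq4 : q = 1 %[mod 4])
  (ha : (0 < a)%N) (hb : (0 < b)%N) (hab : q = (a ^ 2 + b ^ 2)%N)
  (hw : iota w = (a%:R +i* b%:R)%C) (hw' : iota w' = (a%:R -i* b%:R)%C)
  (hD1 : splittingFieldFor <<1; z>>%VS ('X^(2 ^ m) - w%:P) D1)
  (hD2 : splittingFieldFor <<1; z>>%VS ('X^(2 ^ m) - w'%:P) D2) :
  let L := (D1 * D2)%AS in
  [/\ (k <= L)%VS,
      galois 1 L
    & forall H : {group gal_of L},
        H \proper 'Gal(L / D2)%g -> H :!=: 1%g ->
        let G := (H * 'Gal(L / D1))%g in
        [/\ group_set G,
            exists s1 s2 : gal_of L,
              [/\ s1 \in G, s2 \in G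
                & extreme_chebyshev_bias R (fixedField_aspace G)
                    [set s1]%SET [set s2]%SET]
          & exists n : nat,
              [/\ (1 <= n <= m - 1)%N,
                  G \isog [set: 'Z_(2 ^ n) * 'Z_(2 ^ m)]
                & exists to : groupAction [set: 'Z_2]
                                          [set: 'Z_(2 ^ m) * 'Z_(2 ^ m)],
                    'Gal(L / k)%g \isog [set: sdprod_by to]]]].

Proof.
move=> L; have m0 : (0 < m)%N := ltnW hm.
have M0 : (0 < 2 ^ m)%N by rewrite expn_gt0.
have iotaI := fmorph_inj iota.
have zN1 : z ^+ (2 ^ m.-1) = -1.
  apply: iotaI; rewrite rmorphXn /= hz rmorphN1 -zeta2.
  by rewrite -[in LHS](prednK m0) expnSr zeta_expr.
(* This is the element of E that iota maps to the imaginary unit; it is a power of z because m >=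
   2. *)
pose i4 := z ^+ (2 ^ (m - 2)).
have i4E : iota i4 = (0 +i* 1)%C.
  by rewrite rmorphXn /= hz -{1}(subnK hm) expnD zeta_expr // zeta4.
have i4q : i4 ^+ 2 = -1.
  rewrite -zN1 -exprM -expnSr; congr (_ ^+ (2 ^ _)).
  by rewrite -subSn // subn2.
have natC (j : nat) : (j%:R : R[i]) = (j%:R +i* 0)%C.
  by rewrite -(rmorph_nat (real_complex R)).
have wE : w = a%:R + b%:R * i4.
  apply: iotaI; rewrite hw rmorphD rmorphM !rmorph_nat /= i4E !natC.
  by apply/eqP; rewrite eq_complex /=; apply/andP; split; apply/eqP; ring.
have w'E : w' = a%:R - b%:R * i4.
  apply: iotaI; rewrite hw' rmorphB rmorphM !rmorph_nat /= i4E !natC.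
  by apply/eqP; rewrite eq_complex /=; apply/andP; split; apply/eqP; ring.
have ww : w * w' = q%:R.
  transitivity (a%:R ^+ 2 - b%:R ^+ 2 * i4 ^+ 2); first by rewrite wE w'E; ring.
  by rewrite i4q mulrN1 opprK hab natrD !natrX.
have [w0 w'0] : w != 0 /\ w' != 0.
  have : w * w' != 0 by rewrite ww E_natr_neq0 // prime_gt0.
  by rewrite mulf_eq0 negb_or => /andP.
have zprim := kummer_zprim hm zN1.
have i4F : i4 \in <<1; z>>%AS by rewrite rpredX // memv_adjoin.
have [wF w'F] : w \in <<1; z>>%AS /\ w' \in <<1; z>>%AS.
  by rewrite wE w'E; split; rewrite ?rpredB ?rpredD ?rpredM ?rpred_nat.
have galL : galois 1 L.
  apply: (galois_splitting_prod M0 zprim w0 _ _ hD1 hD2).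
    by rewrite wE w'E addrACA subrr addr0 rpredD ?rpred_nat.
  by rewrite ww rpred_nat.
have [alpha aw] := @splitting_root E _ M0 <<1; z>>%AS D1 w hD1.
have alpha0 : alpha != 0.
  by apply: contra w0 => /eqP al0; rewrite -aw al0 expr0n -leqn0 leqNgt M0.
have zF : z \in <<1; z>>%AS by rewrite memv_adjoin.
have D1E : D1 = <<<<1; z>>%AS; alpha>>%VS :> {vspace E}.
  exact: (@splitting_adjoin E _ z zprim <<1; z>>%AS D1 w).
have D1L : (D1 <= L)%VS := field_subvMr D1 D2.
have FL : (<<1; z>>%AS <= L)%VS.
  by apply: subv_trans D1L; rewrite D1E subv_adjoin.
have zL := subvP FL _ zF.
have alphaL : alpha \in L by apply: (subvP D1L); rewrite D1E memv_adjoin.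
have [c cE] := exists_conjugation iota galL.
have cz : c z = z^-1.
  apply: iotaI; rewrite cE // fmorphV hz; apply: (mulfI (x := zeta R (2 ^ m))).
    by rewrite -hz fmorph_eq0 (kummer_z0 hm zN1).
  by rewrite zeta_conj mulfV // -hz fmorph_eq0 (kummer_z0 hm zN1).
pose beta := c alpha; have ca : c alpha = beta by [].
have cb : c beta = alpha.
  by apply: iotaI; rewrite !cE ?memv_gal // conjcK.
have bw : beta ^+ (2 ^ m) = w'.
  rewrite -rmorphXn /= aw; apply: iotaI; rewrite cE ?(subvP FL) // hw hw'.
  by rewrite /= .
have beta0 : beta != 0 by rewrite fmorph_eq0.
have D2E : D2 = <<<<1; z>>%AS; beta>>%VS :> {vspace E}.
  exact: (@splitting_adjoin E _ z zprim <<1; z>>%AS D2 w').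
have LE : L = <<D1; beta>>%VS :> {vspace E}.
  by apply: (prodv_adjoin D2E); rewrite D1E subv_adjoin.
have alphaF : alpha ^+ (2 ^ m) \in <<1; z>>%AS by rewrite aw.
have betaF : beta ^+ (2 ^ m) \in <<1; z>>%AS by rewrite bw.
have kE := maximal_totally_real_fixed zprim galL (erefl _) FL cE cz hk.
have q4 : (4 %| q - 1)%N by rewrite -eqn_mod_dvd ?hq4 // prime_gt0.
have qE : alpha ^+ (2 ^ m) * beta ^+ (2 ^ m) = q%:R by rewrite aw bw.
have i4I : integralOver (intr : int -> E) i4.
  apply: (integral_root_constant (n := 2) (w := -1)) => //.
  by apply: integral_opp; exact: mxpoly.integral1.
have nI (j : nat) : integralOver (intr : int -> E) j%:R by exact: integral_nat.
have alphaI : integralOver (intr : int -> E) alpha.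
  apply: (integral_root_constant M0 _ aw); rewrite wE.
  exact: integral_add (nI a) (mxpoly.integral_mul (nI b) i4I).
have betaI : integralOver (intr : int -> E) beta.
  apply: (integral_root_constant M0 _ bw); rewrite w'E.
  exact: integral_sub (nI a) (mxpoly.integral_mul (nI b) i4I).
have FE := erefl (<<1; z>>%VS : {vspace E}).
(* One automorphism with exponents of opposite parity is enough for surjectivity, so the bound on l
   is taken to be 0. *)
have [l [P [s0 [_ _ _ _ [s0N _ oa ob]]]]] := exists_good_prime hm galL zN1
  FE D1E LE alphaF betaF alpha0 beta0 ca cb cz hq q4 qE alphaI betaI 0.
have surj := kummer_surj hm zN1 FE D1E LE alphaF betaF alpha0 beta0 ca cb cz s0N oa ob.
split=> [|//|H HD2 H1 G].
  by apply: subv_trans FL; case: hk.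
have gsG : group_set G :=
  kummer_group_set hm zN1 FE D1E D2E LE alphaF betaF alpha0 beta0 surj HD2 H1.
have [n [n1m _ HP]] :=
  kummer_card_H hm zN1 FE D1E D2E LE alphaF betaF alpha0 beta0 surj HD2 H1.
have GP s : s \in Group gsG <-> _ :=
  kummer_memG hm zN1 FE D1E LE alphaF betaF alpha0 beta0 surj HP s.
split=> //.
  exact: (kummer_bias hm galL zN1 FE D1E LE alphaF betaF alpha0 beta0 ca cb cz
    hq q4 qE alphaI betaI n1m GP R).
exists n; split=> //.
  exact: (kummer_sub_isog hm zN1 FE D1E LE alphaF betaF alpha0 beta0 surj n1m GP).
exact: (kummer_sdprod hm galL zN1 FE D1E LE alphaF betaF alpha0 beta0 ca cb cz kE surj).
Qed.
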